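(* Let $(\Gamma,S)$ be a $\delta$-hyperbolic group and let $R\geq 48\delta$. Let $x\in\Gamma$ be a base vertex. (a) The linear map $$F_x:\ e_{x_0}\wedge e_{x_1}\wedge\dots\wedge e_{x_n}\ \mapsto\ cl\big(\zeta^x_{\{x_0,\dots,x_n\}}\big)(e_{x_0}\wedge e_{x_1}\wedge\dots\wedge e_{x_n})$$ defines an odd, bounded, selfadjoint linear operator on $\mathcal{H}^R_\pm$. (b) The triple $\mathcal{E}_{x,R}=(\mathcal{H}^R_\pm,\pi_{reg},F_x)$ defines a finitely summable Fredholm module over $C^*_r(\Gamma)$. (c) This Fredholm module is $p$-summable for every $$p\,>\,20\,\delta\cdot\log(1+|S|)\cdot(1+|S|)^{2\delta}.$$
   Context: Hyperbolic groups. $B(Y,R)$ is the closed $R$-neighbourhood of $Y$. A geodesic metric space is $\delta$-hyperbolic if in every geodesic triangle each side lies in the closed $\delta$-neighbourhood of the union of the other two. $\Gamma$ is a group with finite symmetric generating set $S$ and word metric $d$; $(\Gamma,S)$ is a $\delta$-hyperbolic group if its Cayley graph (vertices $\Gamma$, edges of length one from $g$ to $gs$) is $\delta$-hyperbolic; $\delta$ is a strictly positive integer. Gromov product: $(x|y)_z=\frac12(d(x,z)+d(y,z)-d(x,y))$. Fix for every $g\in\Gamma$ a word of minimal length in $S$ representing it; this gives for $x,y\in\Gamma$ a distinguished geodesic $\overline{xy}$ in the Cayley graph, equivariantly under left translation. Mineyev's map. Fix a map $\varphi_1:\Gamma\times\Gamma\to C_0(\Gamma,\mathbb{Q})$ (finite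 rational combinations of elements of $\Gamma$), $\varphi_1(x,y)=\sum_z c_1^{x,y}(z)[z]$ (it exists by work of Mineyev), such that: $c_1^{x,y}(z)\ge0$, $\sum_zc_1^{x,y}(z)=1$; $\varphi_1(x,y)=[x]$ if $d(x,y)\le10\delta$; $Supp\,\varphi_1(x,y)\subset\{z\in B(\overline{xy},\delta):d(z,y)=10\delta\}$ if $d(x,y)>10\delta$; $\varphi_1(gx,gy)=g\varphi_1(x,y)$ for $g\in\Gamma$; $\|\varphi_1(x,y)-\varphi_1(x',y)\|_1\le C_1\lambda_1^{(x|x')_y-10\delta}$ for all $x,x',y\in\Gamma$, with $C_1=C_1(\delta,|S|)$ and Mineyev's admissible constant $\lambda_1=\big(1-(1+|S|)^{-2\delta}\big)^{1/(10\delta)}$. Vectors $\zeta_T^x$. For nonempty $T\subset\Gamma$ put $U_T=\{y\in\Gamma:\mathrm{diam}(T\cup\{y\})\le R\}$. Let $e_y$ be the basis vector of $\mathbb{C}\Gamma$ corresponding to $y$. If $x\notin U_T$ put $\xi_T^x=\sum_{y\in U_T}\big(\sum_{z\notin U_T}c_1^{x,y}(z)\big)e_y$ and $\zeta_T^x=\xi_T^x/\|\xi_T^x\|_2$ if $\xi^x_T\ne0$, $\zeta_T^x=0$ if $\xi^x_T=0$. If $x\in U_T$ put $\zeta_T^x=e_x$. Hilbert space. $\mathcal{H}^R=\bigoplus_{n\ge0}\mathcal{H}_n^R$, where $\mathcal{H}_n^R\subset\Lambda^{n+1}(\ell^2(\Gamma))$ is the closed subspace with orthonormal basis the vectors $e_{x_0}\wedge\dots\wedge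 e_{x_n}$ for subsets $\{x_0,\dots,x_n\}\subset\Gamma$ with $n+1$ elements and diameter at most $R$. $\mathcal{H}^R_\pm$ is $\mathcal{H}^R$ graded by the parity of $n$; $\pi_{reg}$ is the representation induced by left translation of $\Gamma$ on itself. For $\xi\in\mathbb{C}\Gamma$, $cl(\xi)=\mu(\xi)+\mu(\xi)^*$ on $\Lambda^*(\ell^2(\Gamma))$, where $\mu(\xi)\omega=\xi\wedge\omega$. Components of $F_x$ in $\Lambda^0$ are discarded (so that $F_x(e_x)=0$). Fredholm modules. An even Fredholm module over a unital $C^*$-algebra $A$ is a triple $(\mathcal{H}_\pm,\varrho,F)$ with $\mathcal{H}_\pm$ a $\mathbb{Z}/2\mathbb{Z}$-graded Hilbert space, $\varrho$ an even non-degenerate representation of $A$, and $F$ an odd bounded operator with $F^2-\mathrm{id}$, $F-F^*$, $[F,\varrho(a)]$ ($a\in A$) compact. For $A=C^*_r(\Gamma)$ it is called $p$-summable (over the dense subalgebra $\mathbb{C}\Gamma$) if $F^2-\mathrm{id}$, $F-F^*$ and $[F,\varrho(a)]$, $a\in\mathbb{C}\Gamma$, lie in the Schatten ideal $\ell^p(\mathcal{H})$, and finitely summable if it is $p$-summable for all sufficiently large $p$. *)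

(* Defs.v *)
From HB Require Import structures.
From mathcomp Require Import all_boot all_order perm all_algebra.
From mathcomp Require Import finmap complex ring.
From mathcomp Require Import all_classical all_reals all_analysis.

Set Implicit Arguments.
Unset Strict Implicit.
Unset Printing Implicit Defensive.

Import Order.TTheory GRing.Theory Num.Theory.
Import numFieldNormedType.Exports.

Local Open Scope classical_set_scope.
Local Open Scope ring_scope.

Record innerSpace (K : realType) := InnerSpace {
  carrier :> lmodType K[i];
  inner : carrier -> carrier -> K[i] }.

Section Operators.
Variable K : realType.
Local Notation C := K[i].

Section OneSpace.
Variable H : innerSpace K.
Implicit Types (T : H -> H) (E : set H).

Definition hnorm (v : H) : K := Num.sqrt (complex.Re (inner v v)).

Definition hcvg (u : nat -> H) (v : H) : Prop :=
  (fun n => hnorm (u n - v)) @ \oo --> (0 : K).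

Definition hcauchy (u : nat -> H) : Prop :=
  forall e : K, 0 < e -> exists N : nat,
    forall m n : nat, (N <= m)%N -> (N <= n)%N -> hnorm (u m - u n) < e.

Record is_hilbert : Prop := IsHilbert {
  inner_linear : forall (a : C) (u v w : H),
    inner (a *: u + v) w = a * inner u w + inner v w;
  inner_conj : forall u v : H, inner v u = Num.conj (inner u v);
  inner_gt0 : forall u : H, u != 0 -> 0 < inner u u;
  inner_complete : forall u : nat -> H, hcauchy u -> exists v, hcvg u v }.

Definition subspace E : Prop :=
  E 0 /\ forall (a : C) (u v : H), E u -> E v -> E (a *: u + v).

Definition lspan E : set H :=
  [set v | exists n (c : 'I_n -> C) (u : 'I_n -> H),
     (forall i, E (u i)) /\ v = \sum_(i < n) c i *: u i].

Definition closed_span E : set H :=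
  [set v | forall e : K, 0 < e -> exists2 w, lspan E w & hnorm (v - w) < e].

Definition bounded_op T : Prop :=
  linear T /\ exists M : K, forall v, hnorm (T v) <= M * hnorm v.

Definition opnorm T : K := sup [set hnorm (T v) | v in [set v | hnorm v <= 1]].

Definition is_adjoint T T' : Prop :=
  forall u v, inner (T u) v = inner u (T' v).

(* Total version; on a Hilbert space it is the usual adjoint of every bounded
   operator. *)
Definition adjoint T : H -> H :=
  xget (fun=> 0) [set T' | is_adjoint T T'].

Definition selfadjoint T : Prop := is_adjoint T T.

Definition compact_op T : Prop :=
  linear T /\
  forall u : nat -> H, (exists M : K, forall n, hnorm (u n) <= M) ->
    exists2 k : nat -> nat, (forall n, (k n < k n.+1)%N) &
      exists v, hcvg (fun n => T (u (k n))) v.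

Definition rank_le (n : nat) T : Prop :=
  exists e : 'I_n -> H, forall v, exists c : 'I_n -> C,
    T v = \sum_(i < n) c i *: e i.

(* The n-th singular value (n >= 0), as the distance in operator norm to the
   bounded operators of rank at most n. *)
Definition singular_value T (n : nat) : K :=
  inf [set opnorm (fun v => T v - T' v) |
       T' in [set T' | bounded_op T' /\ rank_le n T']].

Definition schatten (p : K) T : Prop :=
  [/\ bounded_op T, compact_op T &
      (\sum_(0 <= n <oo) (singular_value T n `^ p)%:E < +oo)%E].

Definition is_grading (Hp Hm : set H) : Prop :=
  [/\ subspace Hp, subspace Hm,
      forall u v, Hp u -> Hm v -> inner u v = 0 &
      forall v, exists u w, [/\ Hp u, Hm w & v = u + w]].

Definition even_op (Hp Hm : set H) T : Prop :=
  (forall v, Hp v -> Hp (T v)) /\ (forall v, Hm v -> Hm (T v)).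

Definition odd_op (Hp Hm : set H) T : Prop :=
  (forall v, Hp v -> Hm (T v)) /\ (forall v, Hm v -> Hp (T v)).

(* A unital C*-algebra is a set [A] of operators on a Hilbert space. *)
Record is_cstar_algebra (A : set (H -> H)) : Prop := IsCstarAlgebra {
  cstar_space : is_hilbert;
  cstar_bounded : forall a, A a -> bounded_op a;
  cstar_unit : A id;
  cstar_linear : forall (c : C) a b, A a -> A b -> A (fun v => c *: a v + b v);
  cstar_mul : forall a b, A a -> A b -> A (a \o b);
  cstar_adjoint : forall a, A a -> exists2 b, A b & is_adjoint a b;
  cstar_closed : forall a, bounded_op a ->
    (forall e : K, 0 < e -> exists2 b, A b & opnorm (fun v => a v - b v) < e) ->
    A a }.

End OneSpace.

Section Fredholm.
Variables H0 H : innerSpace K.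
Implicit Types (A : set (H0 -> H0)) (rho : (H0 -> H0) -> H -> H) (F : H -> H).

Record is_representation A rho : Prop := IsRepresentation {
  rep_bounded : forall a, A a -> bounded_op (rho a);
  rep_linear : forall (c : C) a b, A a -> A b ->
    rho (fun v => c *: a v + b v) = (fun v => c *: rho a v + rho b v);
  rep_mul : forall a b, A a -> A b -> rho (a \o b) = rho a \o rho b;
  rep_adjoint : forall a b, A a -> A b ->
    is_adjoint a b -> is_adjoint (rho a) (rho b) }.

Definition nondegenerate A rho : Prop :=
  closed_span [set v | exists a w, A a /\ v = rho a w] = setT.

Definition commutator (F T : H -> H) : H -> H := fun v => F (T v) - T (F v).

Record even_fredholm_module A (Hp Hm : set H) rho F : Prop :=
  EvenFredholmModule {
    fredholm_algebra : is_cstar_algebra A;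
    fredholm_space : is_hilbert H;
    fredholm_grading : is_grading Hp Hm;
    fredholm_rep : is_representation A rho;
    fredholm_nondegenerate : nondegenerate A rho;
    fredholm_even : forall a, A a -> even_op Hp Hm (rho a);
    fredholm_bounded : bounded_op F;
    fredholm_odd : odd_op Hp Hm F;
    fredholm_square : compact_op (fun v => F (F v) - v);
    fredholm_adjoint : compact_op (fun v => F v - adjoint F v);
    fredholm_commutator : forall a, A a -> compact_op (commutator F (rho a)) }.

(* [A0] is the dense subalgebra over which summability is tested. *)
Definition p_summable (A0 : set (H0 -> H0)) rho F (p : K) : Prop :=
  [/\ schatten p (fun v => F (F v) - v),
      schatten p (fun v => F v - adjoint F v) &
      forall a, A0 a -> schatten p (commutator F (rho a))].

Definition finitely_summable (A0 : set (H0 -> H0)) rho F : Prop :=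
  exists p0 : K, forall p, p0 < p -> p_summable A0 rho F p.

End Fredholm.
End Operators.

Section Ell2.
Variable K : realType.
Local Notation C := K[i].

Definition csq (z : C) : K := complex.Re z ^+ 2 + complex.Im z ^+ 2.

Lemma csq_ge0 z : 0 <= csq z.
Proof. by rewrite /csq addr_ge0 // sqr_ge0. Qed.

Lemma csqM a z : csq (a * z) = csq a * csq z.
Proof. by case: a => a b; case: z => x y; rewrite /csq /=; ring. Qed.

Lemma csqD_le y z : csq (y + z) <= 2 * csq y + 2 * csq z.
Proof.
case: y => a b; case: z => x y; rewrite /csq /= -subr_ge0.
rewrite [X in 0 <= X](_ : _ = (a - x) ^+ 2 + (b - y) ^+ 2); last by ring.
by rewrite addr_ge0 // sqr_ge0.
Qed.

Lemma csq0 : csq 0 = 0.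
Proof. by rewrite /csq /= expr0n addr0. Qed.

Section Space.
Variable I : choiceType.

Definition sqsum (f : I -> C) : Prop :=
  (\esum_(i in [set: I]) (csq (f i))%:E < +oo)%E.

Lemma sqsum_le (f g : I -> C) :
  (forall i, csq (f i) <= csq (g i)) -> sqsum g -> sqsum f.
Proof.
move=> le_fg; apply: le_lt_trans; apply: le_esum => i _.
by rewrite lee_fin.
Qed.

Lemma sqsum_finite (f : I -> C) : finite_set [set i | f i != 0%R] -> sqsum f.
Proof.
move=> finf; rewrite /sqsum.
rewrite (_ : (\esum_(i in _) _)%E =
  (\esum_(i in [set i | f i != 0%R]) (csq (f i))%:E)%E); last first.
  rewrite esum_mkcond [RHS]esum_mkcond; apply: eq_esum => i _.
  rewrite in_setT; case: ifPn => //; rewrite notin_setE /= => /negP.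
  by rewrite negbK => /eqP ->; rewrite csq0.
rewrite esum_fset // => [|i _]; last by rewrite lee_fin csq_ge0.
by rewrite fsbig_finite //= sumEFin ltry.
Qed.

Lemma sqsumZ (a : C) (f : I -> C) : sqsum f -> sqsum (fun i => a * f i).
Proof.
rewrite /sqsum => sf; have a0 := csq_ge0 a.
apply: (@le_lt_trans _ _
    ((csq a)%:E * \esum_(i in [set: I]) (csq (f i))%:E)%E); last first.
  by apply: lte_mul_pinfty => //; rewrite ?lee_fin.
apply: ge_ereal_sup => _ [F [finF _] <-].
rewrite fsbig_finite //= sumEFin; under eq_bigr do rewrite csqM.
rewrite -mulr_sumr EFinM lee_wpmul2l ?lee_fin //.
apply: esum_ge; exists F; first by split.
by rewrite fsbig_finite //= sumEFin.
Qed.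

Lemma sqsumD (f g : I -> C) :
  sqsum f -> sqsum g -> sqsum (fun i => f i + g i).
Proof.
move=> sf sg.
have s2 (h : I -> C) : sqsum h -> (\esum_(i in [set: I]) (csq (h i) + csq (h i))%:E < +oo)%E.
  move=> sh; under eq_esum do rewrite EFinD.
  by rewrite esumD ?lte_add_pinfty // => i _; rewrite lee_fin csq_ge0.
apply: (@le_lt_trans _ _ (\esum_(i in [set: I])
   ((csq (f i) + csq (f i))%:E + (csq (g i) + csq (g i))%:E))%E).
  apply: le_esum => i _; rewrite -EFinD lee_fin.
  by apply: (le_trans (csqD_le _ _)); rewrite !mulr2n !mulrDl !mul1r.
have ge0 (h : I -> C) i : [set: I] i -> (0 <= (csq (h i) + csq (h i))%:E)%E.
  by move=> _; rewrite lee_fin addr_ge0 ?csq_ge0.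
by rewrite (esumD (ge0 f) (ge0 g)) lte_add_pinfty ?s2.
Qed.

Definition ell2_pred : {pred I -> C} := fun f => `[< sqsum f >].

Lemma ell2_submod_closed : submod_closed ell2_pred.
Proof.
split.
  apply/asboolP/sqsum_finite; rewrite (_ : mkset _ = set0) //.
  by apply/seteqP; split => i //=; rewrite eqxx.
move=> a f g /asboolP sf /asboolP sg; apply/asboolP.
exact: (sqsumD (sqsumZ a sf) sg).
Qed.

HB.instance Definition _ :=
  GRing.isSubmodClosed.Build C (I -> C) ell2_pred ell2_submod_closed.

Record ell2 := Ell2 { ell2_coord :> I -> C; _ : ell2_coord \in ell2_pred }.

HB.instance Definition _ := [isSub for ell2_coord].
HB.instance Definition _ := [Choice of ell2 by <:].
HB.instance Definition _ := [SubChoice_isSubLmodule of ell2 by <:].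

Definition rsum (f : I -> K) : K :=
  fine (\esum_(i in [set: I]) (Num.max (f i) 0)%:E)%E -
  fine (\esum_(i in [set: I]) (Num.max (- f i) 0)%:E)%E.

Definition csum (f : I -> C) : C :=
  (rsum (fun i => complex.Re (f i)) +i* rsum (fun i => complex.Im (f i)))%C.

Definition ell2_inner (f g : ell2) : C := csum (fun i => f i * Num.conj (g i)).

Definition ell2_space : innerSpace K := InnerSpace ell2_inner.

(* The vector with the given coordinates, if these are square summable. *)
Definition to_ell2 (f : I -> C) : ell2_space := insubd (0 : ell2) f.

Lemma to_ell2E (f : I -> C) : sqsum f -> to_ell2 f = f :> (I -> C).
Proof. by move=> sf; rewrite insubdK //; apply/asboolP. Qed.

Lemma ell2P (f : ell2) : sqsum f.
Proof. by case: f => f /= /asboolP. Qed.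

End Space.
End Ell2.

Section Metric.
Variables (K : realType) (X : Type) (dist : X -> X -> K).

Definition closed_nbhd (Y : set X) (r : K) : set X :=
  [set p | (ereal_inf [set (dist p q)%:E | q in Y] <= r%:E)%E].

Definition geodesic (c : K -> X) (l : K) : Prop :=
  0 <= l /\ forall s t : K, 0 <= s <= l -> 0 <= t <= l ->
    dist (c s) (c t) = `|s - t|.

Definition side (c : K -> X) (l : K) : set X :=
  [set c t | t in [set t | 0 <= t <= l]].

(* [dist] may be a pseudometric: consecutive sides of a triangle meet in points
   at distance 0. *)
Definition geodesic_triangle (c : 'I_3 -> K -> X) (l : 'I_3 -> K) : Prop :=
  (forall i, geodesic (c i) (l i)) /\
  (forall i, dist (c i (l i)) (c (ordS i) 0) = 0).

Definition hyperbolic_space (delta : K) : Prop :=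
  forall c l, geodesic_triangle c l ->
    forall i, side (c i) (l i) `<=`
      closed_nbhd (\bigcup_(j in [set j | j != i]) side (c j) (l j)) delta.

End Metric.

Section Cayley.
Variables (K : realType) (G : groupType) (S : {fset G}).

Definition wprod (w : seq G) : G := (\big[*%g/1]_(s <- w) s)%g.

Definition is_word (w : seq G) : bool := all [in S] w.

Definition symmetric_set : Prop := forall s, s \in S -> (s^-1)%g \in S.

Definition generating : Prop := forall g, exists2 w, is_word w & wprod w = g.

(* The default value 0 is used only when [S] does not generate. *)
Definition word_length (g : G) : nat :=
  xget 0%N [set n | (exists w, [/\ is_word w, wprod w = g & size w = n]) /\
    forall w, is_word w -> wprod w = g -> (n <= size w)%N].

Definition wdist (x y : G) : nat := word_length (x^-1 * y)%g.

(* A point of the Cayley graph: the point at distance [cpos] from [csrc] on the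
   edge from [csrc] to [csrc * clab].  A vertex [g] is written (g, 1, 0), and
   also as an end of any edge at [g]. *)
Record cayley := Cayley {
  csrc : G;
  clab : G;
  cpos : K;
  _ : [&& 0 <= cpos, cpos <= 1 &
          (clab \in S) || ((clab == 1%g) && (cpos == 0))] }.

Definition cend (p : cayley) : G := (csrc p * clab p)%g.

Fact vertex_subproof : [&& 0 <= 0 :> K, 0 <= 1 :> K &
  ((1%g : G) \in S) || ((1%g == 1%g :> G) && (0 == 0 :> K))].
Proof. by rewrite lexx ler01 !eqxx orbT. Qed.

Definition vertex (g : G) : cayley := @Cayley g 1%g 0 vertex_subproof.

(* Length of a shortest path from [p] to [q] passing through an end of the edge
   of [p] and an end of the edge of [q]. *)
Definition through_ends (p q : cayley) : K :=
  Num.min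
    (Num.min (cpos p + (wdist (csrc p) (csrc q))%:R + cpos q)
             (cpos p + (wdist (csrc p) (cend q))%:R + (1 - cpos q)))
    (Num.min (1 - cpos p + (wdist (cend p) (csrc q))%:R + cpos q)
             (1 - cpos p + (wdist (cend p) (cend q))%:R + (1 - cpos q))).

(* Path pseudometric.  The edges (g, s) and (g s, s^-1) are the same edge, run
   through in opposite directions. *)
Definition cayley_dist (p q : cayley) : K :=
  if (csrc p == csrc q) && (clab p == clab q) then
    Num.min `|cpos p - cpos q| (through_ends p q)
  else if (csrc p == cend q) && (csrc q == cend p) then
    Num.min `|cpos p - (1 - cpos q)| (through_ends p q)
  else through_ends p q.

Definition hyperbolic_group (delta : nat) : Prop :=
  [/\ symmetric_set, generating, (0 < delta)%N &
      hyperbolic_space cayley_dist delta%:R].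

Definition minimal_words (w : G -> seq G) : Prop :=
  forall g, [/\ is_word (w g), wprod (w g) = g & size (w g) = word_length g].

(* The distinguished geodesic from [x] to [y]: it starts at [x] and reads the
   word [w (x^-1 y)]. *)
Definition path_of (w : G -> seq G) (x y : G) : set cayley :=
  let v := w (x^-1 * y)%g in
  [set p | p = vertex x \/
    exists i, [/\ (i < size v)%N, csrc p = (x * wprod (take i v))%g &
                  clab p = nth 1%g v i]].

Definition gromov (x y z : G) : K :=
  ((wdist x z)%:R + (wdist y z)%:R - (wdist x y)%:R) / 2.

Definition lambda1 (delta : nat) : K :=
  (1 - (1 + #|` S|%:R) `^ (- (2 * delta%:R))) `^ (10 * delta%:R)^-1.

Record mineyev_map (delta : nat) (w : G -> seq G) (C1 : K)
    (phi1 : G -> G -> {fsfun G -> rat with 0}) : Prop := MineyevMap {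
  mineyev_ge0 : forall x y z, 0 <= phi1 x y z;
  mineyev_sum : forall x y, \sum_(z <- finsupp (phi1 x y)) phi1 x y z = 1;
  mineyev_near : forall x y, (wdist x y <= 10 * delta)%N ->
    forall z, phi1 x y z = (z == x)%:R;
  mineyev_supp : forall x y, (10 * delta < wdist x y)%N ->
    forall z, z \in finsupp (phi1 x y) ->
      closed_nbhd cayley_dist (path_of w x y) delta%:R (vertex z) /\
      wdist z y = (10 * delta)%N;
  mineyev_equivariant : forall g x y z,
    phi1 (g * x)%g (g * y)%g (g * z)%g = phi1 x y z;
  mineyev_decay : forall x x' y,
    \sum_(z <- (finsupp (phi1 x y) `|` finsupp (phi1 x' y))%fset)
      `|ratr (phi1 x y z) - ratr (phi1 x' y z) : K|
    <= C1 * lambda1 delta `^ (gromov x x' y - 10 * delta%:R) }.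

Variable R : K.

Definition diam_le (T : set G) : Prop :=
  forall a b, T a -> T b -> (wdist a b)%:R <= R.

Definition U_ (T : set G) : set G := [set y | diam_le (T `|` [set y])].

Variable phi1 : G -> G -> {fsfun G -> rat with 0}.

Definition xi (x : G) (T : set G) (y : G) : K :=
  if y \in U_ T then
    \sum_(z <- finsupp (phi1 x y) | z \notin U_ T) ratr (phi1 x y z)
  else 0.

Definition xi_norm (x : G) (T : set G) : K :=
  Num.sqrt (\sum_(y \in U_ T) xi x T y ^+ 2).

(* If [xi x T] vanishes, then so does the quotient below (x / 0 = 0). *)
Definition zeta (x : G) (T : set G) (y : G) : K :=
  if x \in U_ T then (y == x)%:R else xi x T y / xi_norm x T.

(* Each finite subset A of G gives the basis vector e_A, the wedge product of
   its elements in the order [enum_fset A]. *)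
Definition Lambda : innerSpace K := ell2_space K {fset G}.

(* The coefficient of the wedge product of the sequence [s] along e_A. *)
Definition wedge_coef (s : seq G) (A : {fset G}) : K[i] :=
  if size s == #|` A| then
    \det (\matrix_(i < size s, j < size s)
            (nth 1%g s i == nth 1%g (enum_fset A) j)%:R)
  else 0.

Definition wedge (s : seq G) : Lambda := to_ell2 (wedge_coef s).

Lemma wedge_coef_neq0 (s : seq G) (A : {fset G}) :
  wedge_coef s A != 0 -> uniq s /\ A = [fset x in s]%fset.
Proof.
rewrite /wedge_coef; case: (size s =P _) => [sz|_]; last by rewrite eqxx.
set M := (\matrix_(_, _) _) => detM.
have us : uniq s.
  apply: contraNT detM => /(uniqPn 1%g)[i [j [ij js eij]]].
  have is_ : (i < size s)%N := ltn_trans ij js.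
  apply/eqP/(@determinant_alternate _ _ M (Ordinal is_) (Ordinal js)).
    by rewrite -val_eqE /= neq_ltn ij.
  by move=> k; rewrite !mxE /= eij.
split=> //; apply/eqP; rewrite eq_sym eqEfcard card_fseq undup_id // -sz leqnn.
rewrite andbT; apply/fsubsetP => y; rewrite !inE /= => ys.
apply: contraNT detM => yA; apply/eqP.
have iy : (index y s < size s)%N by rewrite index_mem.
rewrite (expand_det_row M (Ordinal iy)) big1 // => j _.
rewrite mxE /= nth_index // (_ : (_ == _) = false) ?mul0r //.
apply: contraNF yA => /eqP ->; rewrite -[_ \in A]/(_ \in enum_fset A).
by rewrite mem_nth // -sz.
Qed.

Lemma csq_wedge_coef_le1 (s : seq G) (A : {fset G}) : csq (wedge_coef s A) <= 1.
Proof.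
have [->|c0] := eqVneq (wedge_coef s A) 0; first by rewrite csq0.
have [us defA] := wedge_coef_neq0 c0.
have sA y : y \in s -> y \in enum_fset A.
  by rewrite -[_ \in enum_fset A]/(y \in A) defA !inE.
rewrite /wedge_coef; case: (size s =P _) => [sz|_]; last by rewrite csq0.
have ltn (i : 'I_(size s)) :
    (index (nth 1%g s i) (enum_fset A) < size s)%N.
  by rewrite [X in (_ < X)%N]sz index_mem sA // mem_nth.
pose f i := Ordinal (ltn i).
have injf : injective f.
  move=> i j /(congr1 (fun k => nth 1%g (enum_fset A) (val k))) /=.
  by rewrite !nth_index ?sA ?mem_nth // => /eqP; rewrite nth_uniq // => /eqP/val_inj.
rewrite (_ : (\matrix_(_, _) _) = perm_mx (perm injf)).
  by rewrite det_perm; case: (odd_perm _); rewrite /csq /= ?sqrrN ?oppr0 ?expr1n ?expr0n ?addr0.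
apply/matrixP => i j; rewrite !mxE permE -val_eqE /=.
congr (_%:R); congr nat_of_bool; apply/eqP/eqP => [->|<-].
  by rewrite index_uniq ?fset_uniq // -sz.
by rewrite nth_index // sA // mem_nth.
Qed.

Lemma wedgeE (s : seq G) : wedge s = wedge_coef s :> ({fset G} -> K[i]).
Proof.
apply/to_ell2E/sqsum_finite; apply: (@sub_finite_set _ _ [set [fset x in s]%fset]).
  by move=> A /= /wedge_coef_neq0[].
exact: finite_set1.
Qed.

(* Exterior multiplication by the vector with coordinates [v]: expand
   sum_(y, B) (v y) (f B) (y /\ e_B) along the basis, where B = A \ y. *)
Definition mu (v : G -> K[i]) (f : Lambda) : Lambda :=
  to_ell2 (fun A : {fset G} => \sum_(y <- enum_fset A)
    v y * wedge_coef (y :: enum_fset (A `\ y)%fset) A * f (A `\ y)%fset).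

Lemma muE (v : G -> K[i]) (f : Lambda) (s : seq G) :
  (forall y, v y != 0 -> y \in s) ->
  mu v f = (fun A : {fset G} => \sum_(y <- enum_fset A)
    v y * wedge_coef (y :: enum_fset (A `\ y)%fset) A * f (A `\ y)%fset)
  :> ({fset G} -> K[i]).
Proof.
move=> vs; apply: to_ell2E.
pose t y (A : {fset G}) := v y * (if y \in A then
    wedge_coef (y :: enum_fset (A `\ y)%fset) A * f (A `\ y)%fset else 0).
rewrite (_ : (fun _ => _) = fun A => \sum_(y <- undup s) t y A); last first.
  apply/funext => A.
  rewrite (bigID (fun y => v y != 0)) /= [X in _ + X]big1 ?addr0; last first.
    by move=> y /negPn/eqP ->; rewrite !mul0r.
  rewrite [RHS](bigID (fun y => (y \in A) && (v y != 0))) /= [X in _ = _ + X]big1.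
    rewrite addr0 -big_filter -[RHS]big_filter.
    rewrite (perm_big [seq y <- undup s | (y \in A) && (v y != 0)]).
      rewrite !big_filter; apply: eq_bigr => y /andP[yA _].
      by rewrite /t yA mulrA.
    apply: uniq_perm; rewrite ?filter_uniq ?undup_uniq ?fset_uniq // => y.
    rewrite !mem_filter mem_undup -[_ \in enum_fset A]/(y \in A) andbC.
    by case: (boolP (v y == 0)) => [|/vs ->] /=; rewrite ?andbF ?andbT.
  move=> y; rewrite /t; case: (y \in A) => /=; last by rewrite mulr0.
  by move=> /negPn/eqP ->; rewrite mul0r.
have st y : sqsum (t y).
  apply: sqsumZ; rewrite /sqsum; apply: (@le_lt_trans _ _
      (\esum_(A in [set A : {fset G} | y \in A]) (csq (f (A `\ y)%fset))%:E)%E).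
    rewrite [leRHS]esum_mkcond; apply: le_esum => A _.
    rewrite (_ : (A \in [set B : {fset G} | y \in B]) = (y \in A)); last first.
      by apply/idP/idP; rewrite inE.
    case: ifP => yA; last by rewrite csq0.
    by rewrite csqM lee_fin ler_piMl ?csq_ge0 ?csq_wedge_coef_le1.
  rewrite -(esum_image [set A : {fset G} | y \in A] (fun A => A `\ y)%fset
    (fun A => (csq (f A))%:E)); last first.
    move=> A B; rewrite !inE => yA yB eAB.
    by rewrite -(fsetD1K yA) eAB fsetD1K.
  apply: le_lt_trans (ell2P f); rewrite esum_mkcond; apply: le_esum => A _.
  by case: ifP => // _; rewrite lee_fin csq_ge0.
elim: (undup s) => [|y r IHr].
  apply: sqsum_finite; rewrite (_ : mkset _ = set0) //.
  by apply/seteqP; split => A //=; rewrite big_nil eqxx.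
rewrite (_ : (fun _ => _) = fun A => t y A + \sum_(j <- r) t j A).
  exact: sqsumD.
by apply/funext => A; rewrite big_cons.
Qed.

Definition cl (v : G -> K[i]) (f : Lambda) : Lambda :=
  mu v f + adjoint (mu v) f.

Definition simplex (A : {fset G}) : Prop :=
  A != fset0 /\ diam_le [set` A].

Definition rips_pred : {pred Lambda} :=
  fun f => `[< forall A, ~ simplex A -> f A = 0 >].

Lemma rips_submod_closed : submod_closed rips_pred.
Proof.
split; first by apply/asboolP.
move=> a f g /asboolP f0 /asboolP g0; apply/asboolP => A nA.
by rewrite -[LHS]/(a * f A + g A) f0 // g0 // mulr0 addr0.
Qed.

HB.instance Definition _ :=
  GRing.isSubmodClosed.Build K[i] (carrier Lambda) rips_pred rips_submod_closed.

Record rips := Rips { rips_val :> carrier Lambda; _ : rips_val \in rips_pred }.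

HB.instance Definition _ := [isSub for rips_val].
HB.instance Definition _ := [Choice of rips by <:].
HB.instance Definition _ := [SubChoice_isSubLmodule of rips by <:].

Definition rips_inner (f g : rips) : K[i] := inner (rips_val f) (rips_val g).

Definition H_R : innerSpace K := InnerSpace rips_inner.

Definition oriented_simplex (s : seq G) : Prop :=
  [/\ uniq s, s != [::] & diam_le [set` s]].

(* The vector x_0 /\ ... /\ x_n of H^R. *)
Definition e_ (s : seq G) : H_R := insubd (0 : rips) (wedge s).

Lemma e_E (s : seq G) : oriented_simplex s -> rips_val (e_ s) = wedge s.
Proof.
move=> [us s0 ds]; rewrite insubdK //; apply/asboolP => A nA.
rewrite wedgeE; apply: contra_notP nA => /eqP /wedge_coef_neq0[_ ->]; split.
  case: s s0 {us ds} => // y s _; apply/eqP => /fsetP/(_ y).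
  by rewrite !inE eqxx.
by move=> a b; rewrite /= !inE; apply: ds.
Qed.

Definition H_even : set H_R :=
  [set f : H_R | forall A : {fset G}, rips_val f A != 0 -> ~~ odd #|` A|.-1].

Definition H_odd : set H_R :=
  [set f : H_R | forall A : {fset G}, rips_val f A != 0 -> odd #|` A|.-1].

Definition is_F (x : G) (F : H_R -> H_R) : Prop :=
  linear F /\
  forall s, oriented_simplex s ->
    forall A : {fset G}, A != fset0 ->
      rips_val (F (e_ s)) A = cl (fun y => (zeta x [set` s] y)%:C%C) (wedge s) A.

Definition translation (g : G) (f : ell2_space K G) : ell2_space K G :=
  to_ell2 (fun h => f (g^-1 * h)%g).

Lemma translationE (g : G) (f : ell2_space K G) :
  translation g f = (fun h => f (g^-1 * h)%g) :> (G -> K[i]).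
Proof.
apply: to_ell2E; rewrite /sqsum.
rewrite -(@reindex_esum _ _ _ setT setT (fun h => g^-1 * h)%g
  (fun h => (csq (f h))%:E)); first exact: ell2P.
split=> // [a b _ _ /mulgI //|h _]; exists (g * h)%g => //=.
by rewrite mulKg.
Qed.

Definition group_ring : set (ell2_space K G -> ell2_space K G) :=
  [set T | exists (s : seq G) (c : G -> K[i]),
     T = fun f => \sum_(g <- s) c g *: translation g f].

Definition Cr : set (ell2_space K G -> ell2_space K G) :=
  [set T | bounded_op T /\
     forall e : K, 0 < e ->
       exists2 a, group_ring a & opnorm (fun f => T f - a f) < e].

(* [rho] is the representation pi_reg on H^R. *)
Definition extends_translation
    (rho : (ell2_space K G -> ell2_space K G) -> H_R -> H_R) : Prop :=
  forall g s, oriented_simplex s ->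
    rho (translation g) (e_ s) = e_ [seq (g * y)%g | y <- s].

End Cayley.

Arguments H_even {K G} S R _.
Arguments H_odd {K G} S R _.
Arguments group_ring K G _ : clear implicits.
Arguments Cr K G _ : clear implicits.

(* Main.v *)
Require Import Defs.
From mathcomp Require Import all_boot all_order perm all_algebra.
From mathcomp Require Import finmap complex ring lra zify.
From mathcomp Require Import all_classical all_reals all_analysis.

(** The operator F toggles vertices: it maps e_A to the sum over y of zeta_A(y)
times a sign times e_(A toggled at y).

Geometry. If xi_T does not vanish at y, then some mass of Mineyev's measure
phi(x, y) lies outside U_T, close to the geodesic from y to x. By the four point
condition (four_point) this forces y to be almost the vertex of U_T closest to x,
and provides a witness t in T almost at distance R behind y (xi_witness). It follows
that adding y to T, or removing it, affects neither xi nor zeta (zeta_toggle). Also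
xi takes the value 1 at a vertex of U_T closest to x, so that zeta is a unit vector.

The operator. By zeta_toggle the matrix of F is symmetric, so F is selfadjoint
(Fop_selfadjoint), and F is bounded because the rows and columns of its matrix have a
bounded number of entries (tog_nsq). Clifford multiplication by a unit vector has
square one; since the vector zeta is unchanged by the first toggle, the square of F is
the identity except on e_x, whose image would be the discarded empty simplex (Fop_sqr).

The representation. Let B run through the finitely many simplices which contain the
unit. Up to weights and signs, f |-> (h |-> f(h B))_B is an isometry from the Hilbert
space of the Rips complex into a finite sum of copies of the square summable functions
on the group, and it turns the translation action into the regular representation. An
operator of the reduced C*-algebra acts on each copy. As it commutes with right
translations (Cr_rtr) it preserves the image of the isometry (raw_rho), which gives the
representation rho.

Commutators. The construction of F is equivariant, so the commutator with translation
by g is that translation composed with the difference of the operators F for the base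
points g^-1 x and x (Fop_translation). Mineyev's estimate and the lower bound 1 for
the norm of xi show that this difference is at most c lam^n on vectors supported at
distance more than n from x (zeta_decay, Fop_diff_decay), where lam is Mineyev's
constant. The same decay holds, trivially, for the square of F minus the identity. A
ball of radius n has at most q^n elements with q = 1 + |S| (for nonempty S), so that cutting off at
radius n leaves an operator of rank at most m q^n. Hence the N-th singular value is at
most c lam^n as soon as N >= m q^n, and the p-th powers of the singular values are
summable if q lam^p < 1 (decays_schatten), which holds for p above the stated bound
(decay_rate). An operator of the reduced C*-algebra is a limit in norm of combinations
of translations, so its commutator with F is still small far away from x, and such
operators are compact (vanish_compact). *)

Set Implicit Arguments.
Unset Strict Implicit.
Unset Printing Implicit Defensive.

Import Order.TTheory GRing.Theory Num.Theory.
Import numFieldNormedType.Exports.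

Local Open Scope classical_set_scope.
Local Open Scope ring_scope.

(** * Hilbert space geometry *)

Lemma csq_real (K : realType) (r : K) : csq (r%:C%C) = r ^+ 2.
Proof. by rewrite /csq /= expr0n addr0. Qed.

Lemma small_factor (K : realType) (M e : K) : 0 <= M -> 0 < e ->
  exists2 d, 0 < d & M * d <= e.
Proof.
move=> M0 e0; have M1 : 0 < M + 1 by rewrite ltr_wpDl.
exists (e / (M + 1)); first exact: divr_gt0.
by rewrite mulrA ler_pdivrMr // mulrC ler_pM2l // lerDl.
Qed.

Section HilbertTheory.
Variables (K : realType) (H : innerSpace K) (hH : is_hilbert H).
Local Notation C := K[i].
Implicit Types (u v w : H) (T : H -> H).

Local Notation rin u v := (complex.Re (inner u v)).

Lemma innerDZl (a : C) u v w : inner (a *: u + v) w = a * inner u w + inner v w.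
Proof. exact: (inner_linear hH). Qed.

Lemma innerDl u v w : inner (u + v) w = inner u w + inner v w.
Proof. by rewrite -[u]scale1r innerDZl mul1r scale1r. Qed.

Lemma inner0l w : inner (0 : H) w = 0.
Proof. by apply: (addrI (inner (0 : H) w)); rewrite -innerDl !addr0. Qed.

Lemma innerZl (a : C) u w : inner (a *: u) w = a * inner u w.
Proof. by rewrite -[a *: u]addr0 innerDZl inner0l addr0. Qed.

Lemma innerC u v : inner v u = Num.conj (inner u v).
Proof. exact: (inner_conj hH). Qed.

Lemma innerDr u v w : inner w (u + v) = inner w u + inner w v.
Proof. by rewrite innerC innerDl rmorphD /= -!innerC. Qed.

Lemma innerZr (a : C) u w : inner w (a *: u) = Num.conj a * inner w u.
Proof. by rewrite innerC innerZl rmorphM /= -innerC. Qed.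

Lemma inner0r w : inner w (0 : H) = 0.
Proof. by rewrite innerC inner0l rmorph0. Qed.

Lemma innerBr u v w : inner w (u - v) = inner w u - inner w v.
Proof. by rewrite innerDr -scaleN1r innerZr rmorphN rmorph1 mulN1r. Qed.

Lemma inner_ge0 u : 0 <= inner u u.
Proof.
by have [->|/(inner_gt0 hH)/ltW//] := eqVneq u 0; rewrite inner0l.
Qed.

Lemma rin_ge0 u : 0 <= rin u u.
Proof. by have := inner_ge0 u; rewrite lecE => /andP[]. Qed.

Lemma rinC u v : rin v u = rin u v.
Proof. by rewrite innerC; case: (inner u v). Qed.

Lemma rinDl u v w : rin (u + v) w = rin u w + rin v w.
Proof. by rewrite innerDl; case: (inner u w); case: (inner v w). Qed.

Lemma rinZl (r : K) u w : rin (r%:C%C *: u) w = r * rin u w.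
Proof. by rewrite innerZl; case: (inner u w) => a b /=; rewrite mul0r subr0. Qed.

Lemma hnorm_ge0 u : 0 <= hnorm u.
Proof. exact: sqrtr_ge0. Qed.

Lemma hnorm_sqr u : hnorm u ^+ 2 = rin u u.
Proof. by rewrite sqr_sqrtr // rin_ge0. Qed.

Lemma inner_self u : inner u u = ((hnorm u ^+ 2)%:C)%C.
Proof.
rewrite hnorm_sqr; have := inner_ge0 u; rewrite lecE => /andP[/eqP /= h _].
by case: (inner u u) h => a b /= ->.
Qed.

Lemma hnorm_eq0 u : hnorm u = 0 -> u = 0.
Proof.
move=> h; apply/eqP; apply: contraT => /(inner_gt0 hH).
by rewrite inner_self h expr0n /= ltxx.
Qed.

Lemma hnorm0 : hnorm (0 : H) = 0.
Proof. by rewrite /hnorm inner0l sqrtr0. Qed.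

Lemma hnormZ (a : C) u : hnorm (a *: u) = Num.sqrt (csq a) * hnorm u.
Proof.
rewrite /hnorm innerZl innerZr inner_self -sqrtrM ?csq_ge0 //; congr Num.sqrt.
by case: a => a b; rewrite /csq /=; ring.
Qed.

Lemma hnormN u : hnorm (- u) = hnorm u.
Proof. by rewrite -scaleN1r hnormZ /csq /= oppr0 expr0n addr0 sqrrN expr1n sqrtr1 mul1r. Qed.

Lemma hnormBC u v : hnorm (u - v) = hnorm (v - u).
Proof. by rewrite -hnormN opprB. Qed.

Lemma hnormD_sqr u v : hnorm (u + v) ^+ 2 = hnorm u ^+ 2 + 2 * rin u v + hnorm v ^+ 2.
Proof.
rewrite !hnorm_sqr !rinDl ![rin _ (u + v)]rinC !rinDl [rin v u]rinC; ring.
Qed.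

(** The discriminant of the nonnegative quadratic polynomial t |-> |u + t v|^2 is
not positive. *)
Lemma rin_le u v : rin u v <= hnorm u * hnorm v.
Proof.
have [v0|v0] := eqVneq (hnorm v) 0.
  by rewrite v0 mulr0 (hnorm_eq0 v0) inner0r.
have vp : 0 < hnorm v by rewrite lt_neqAle eq_sym v0 hnorm_ge0.
pose B := rin u v; set a := hnorm u; set c := hnorm v.
have h t : 0 <= a ^+ 2 + 2 * (t * B) + t ^+ 2 * c ^+ 2.
  rewrite -[X in _ <= X](_ : hnorm (u + t%:C%C *: v) ^+ 2 = _) ?sqr_ge0 //.
  rewrite hnormD_sqr hnormZ exprMn [rin u _]rinC rinZl [rin v u]rinC -/B.
  by rewrite [Num.sqrt (csq _) ^+ 2]sqr_sqrtr ?csq_ge0 // csq_real.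
(* the minimizer of the polynomial *)
have := h (- B / c ^+ 2); rewrite -/B -/a -/c.
have -> : a ^+ 2 + 2 * (- B / c ^+ 2 * B) + (- B / c ^+ 2) ^+ 2 * c ^+ 2 =
   a ^+ 2 - B ^+ 2 / c ^+ 2 by field; rewrite -/c in v0 *.
rewrite subr_ge0 ler_pdivrMr ?exprn_gt0 // -exprMn => hB.
have [B0|B0] := leP B 0; first by rewrite (le_trans B0) ?mulr_ge0 ?hnorm_ge0.
by rewrite -(@ler_pXn2r _ 2) ?nnegrE ?mulr_ge0 ?hnorm_ge0 // ltW.
Qed.

Lemma hnormD u v : hnorm (u + v) <= hnorm u + hnorm v.
Proof.
rewrite -(@ler_pXn2r _ 2) ?nnegrE ?addr_ge0 ?hnorm_ge0 // hnormD_sqr.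
by have := rin_le u v; lra.
Qed.

Lemma hnormB u v : hnorm (u - v) <= hnorm u + hnorm v.
Proof. by rewrite -(hnormN v) hnormD. Qed.

Lemma hnorm_dist w u v : hnorm (u - v) <= hnorm (u - w) + hnorm (w - v).
Proof. by have := hnormD (u - w) (w - v); rewrite addrA subrK. Qed.

(** Polarization transports inner products along maps which are only known to
preserve norms. *)
Lemma polar_re u v : rin u v = (hnorm (u + v) ^+ 2 - hnorm (u - v) ^+ 2) / 4.
Proof.
have -> : hnorm (u - v) ^+ 2 = hnorm u ^+ 2 - 2 * rin u v + hnorm v ^+ 2.
  rewrite hnormD_sqr hnormN -scaleN1r innerZr rmorphN rmorph1 mulN1r.
  by case: (inner u v) => a b /=; ring.
by rewrite hnormD_sqr; field.
Qed.

Lemma polar_im u v : complex.Im (inner u v) = rin u ('i%C *: v).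
Proof.
rewrite innerZr; case: (inner u v) => a b.
rewrite -[Num.conj _]/(conjc 'i%C) /=; ring.
Qed.

Lemma inner_rinP (z w : H * H) :
  rin z.1 z.2 = rin w.1 w.2 -> rin z.1 ('i%C *: z.2) = rin w.1 ('i%C *: w.2) ->
  inner z.1 z.2 = inner w.1 w.2.
Proof.
move=> h1 h2; apply/eqP; rewrite eq_complex h1 eqxx /=.
by rewrite !polar_im h2.
Qed.

Lemma inner_inj u v : (forall w, inner w u = inner w v) -> u = v.
Proof.
move=> h; apply/eqP; rewrite -subr_eq0; apply/eqP/hnorm_eq0/eqP.
by rewrite -sqrf_eq0 hnorm_sqr innerBr h subrr.
Qed.

Lemma is_adjoint_uniq T T1 T2 : is_adjoint T T1 -> is_adjoint T T2 -> T1 = T2.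
Proof.
by move=> h1 h2; apply/funext => v; apply: inner_inj => w; rewrite -h1 h2.
Qed.

Lemma adjointE T T' : is_adjoint T T' -> adjoint T = T'.
Proof.
move=> h; apply: xget_unique => // T'' h''; exact: (is_adjoint_uniq h'' h).
Qed.

Lemma adjoint_le T T' (M : K) : is_adjoint T T' -> 0 <= M ->
  (forall v, hnorm (T v) <= M * hnorm v) -> forall v, hnorm (T' v) <= M * hnorm v.
Proof.
move=> hT M0 hM v; have n0 := hnorm_ge0 (T' v).
have [->|nz] := eqVneq (hnorm (T' v)) 0; first by rewrite mulr_ge0 ?hnorm_ge0.
have np : 0 < hnorm (T' v) by rewrite lt_neqAle eq_sym nz.
rewrite -(ler_pM2r np) -expr2 hnorm_sqr -hT.
apply: le_trans (rin_le _ _) _; rewrite mulrAC mulrC mulrC ler_wpM2r ?hnorm_ge0 //.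
Qed.

(** ** Convergence *)

Lemma hcvgP (s : nat -> H) v :
  hcvg s v <-> forall e : K, 0 < e -> exists N : nat,
    forall n, (N <= n)%N -> hnorm (s n - v) < e.
Proof.
split=> [/cvgrPdist_lt h e e0|h].
  have [N _ hN] := h e e0; exists N => n Nn; have := hN n Nn.
  by rewrite sub0r normrN ger0_norm ?hnorm_ge0.
apply/cvgrPdist_lt => e e0; have [N hN] := h e e0.
exists N => // n Nn; rewrite sub0r normrN ger0_norm ?hnorm_ge0 //; exact: hN.
Qed.

(** ** Bounded operators *)

Lemma lin0 T : linear T -> T 0 = 0.
Proof. by move=> h; have := h (-1) 0 0; rewrite !scaleN1r !addNr. Qed.

Lemma linD T u v : linear T -> T (u + v) = T u + T v.
Proof. by move=> h; have := h 1 u v; rewrite !scale1r. Qed.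

Lemma linZ T a u : linear T -> T (a *: u) = a *: T u.
Proof. by move=> h; rewrite -[a *: u]addr0 h (lin0 h) addr0. Qed.

Lemma linB T u v : linear T -> T (u - v) = T u - T v.
Proof. by move=> h; rewrite linD // -scaleN1r linZ // scaleN1r. Qed.

Lemma linsum T (J : Type) (r : seq J) (P : pred J) (f : J -> H) : linear T ->
  T (\sum_(j <- r | P j) f j) = \sum_(j <- r | P j) T (f j).
Proof.
move=> h; elim/big_rec2: _ => [|j x y _ <-]; [exact: lin0|exact: linD].
Qed.

Lemma bounded_opP T (M : K) : linear T -> (forall v, hnorm (T v) <= M * hnorm v) ->
  bounded_op T.
Proof. by move=> lT hM; split=> //; exists M. Qed.

Lemma bounded_op_bound T : bounded_op T ->
  exists2 M : K, 0 <= M & forall v, hnorm (T v) <= M * hnorm v.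
Proof.
move=> [_ [M hM]]; exists `|M| => // v.
by rewrite (le_trans (hM v)) // ler_wpM2r ?hnorm_ge0 // ler_norm.
Qed.

Lemma bounded_op_id : bounded_op (@id H).
Proof. by apply: (@bounded_opP _ 1) => // v; rewrite mul1r. Qed.

Lemma bounded_op0 : bounded_op (fun=> 0 : H).
Proof.
apply: (@bounded_opP _ 0) => [a u v|v]; first by rewrite scaler0 addr0.
by rewrite hnorm0 mul0r.
Qed.

Lemma bounded_op_comp T1 T2 : bounded_op T1 -> bounded_op T2 ->
  bounded_op (T1 \o T2).
Proof.
move=> b1 b2; have [M1 M10 h1] := bounded_op_bound b1.
have [M2 M20 h2] := bounded_op_bound b2; case: b1 b2 => l1 _ [l2 _].
apply: (@bounded_opP _ (M1 * M2)) => [a u v|v /=]; first by rewrite /= l2 l1.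
by rewrite (le_trans (h1 _)) // -mulrA ler_wpM2l.
Qed.

Lemma bounded_op_linear (c : C) T1 T2 : bounded_op T1 -> bounded_op T2 ->
  bounded_op (fun v => c *: T1 v + T2 v).
Proof.
move=> b1 b2; have [M1 M10 h1] := bounded_op_bound b1.
have [M2 M20 h2] := bounded_op_bound b2; case: b1 b2 => l1 _ [l2 _].
apply: (@bounded_opP _ (Num.sqrt (csq c) * M1 + M2)) => [a u v|v /=].
  by rewrite l2 l1 !scalerDr !scalerA [c * a]mulrC addrACA.
rewrite (le_trans (hnormD _ _)) // mulrDl lerD // hnormZ -mulrA.
by rewrite ler_wpM2l ?sqrtr_ge0.
Qed.

Lemma bounded_opB T1 T2 : bounded_op T1 -> bounded_op T2 ->
  bounded_op (fun v => T1 v - T2 v).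
Proof.
move=> b1 b2; rewrite (_ : (fun _ => _) = fun v => -1 *: T2 v + T1 v).
  exact: bounded_op_linear.
by apply/funext => v; rewrite scaleN1r addrC.
Qed.

Lemma bounded_op_sum (J : Type) (r : seq J) (c : J -> C) (T : J -> H -> H) :
  (forall j, bounded_op (T j)) -> bounded_op (fun v => \sum_(j <- r) c j *: T j v).
Proof.
move=> b; elim: r => [|j r IHr].
  rewrite (_ : (fun _ => _) = fun=> 0); first exact: bounded_op0.
  by apply/funext => v; rewrite big_nil.
rewrite (_ : (fun _ => _) = fun v => c j *: T j v + \sum_(j <- r) c j *: T j v).
  exact: bounded_op_linear.
by apply/funext => v; rewrite big_cons.
Qed.

Lemma opnorm_ge0 T : linear T -> 0 <= opnorm T.
Proof.
move=> lT; rewrite /opnorm; set E := [set _ | _ in _].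
have [hE|/sup_out -> //] := pselect (has_sup E).
apply: ub_le_sup; first by case: hE.
by exists 0; rewrite ?lin0 //= hnorm0.
Qed.

Lemma opnorm_le T (M : K) : 0 <= M -> (forall v, hnorm (T v) <= M * hnorm v) ->
  opnorm T <= M.
Proof.
move=> M0 hM; apply: ge_sup; first by exists (hnorm (T 0)), 0 => //=; rewrite hnorm0.
move=> _ [v /= v1 <-]; rewrite (le_trans (hM v)) //.
by rewrite -[leRHS]mulr1 ler_wpM2l.
Qed.

Lemma opnormP T v : bounded_op T -> hnorm (T v) <= opnorm T * hnorm v.
Proof.
move=> bT; have [M M0 hM] := bounded_op_bound bT; have [lT _] := bT.
have [v0|v0] := eqVneq (hnorm v) 0.
  by rewrite v0 (hnorm_eq0 v0) lin0 // hnorm0 mulr0.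
have vp : 0 < hnorm v by rewrite lt_neqAle eq_sym v0 hnorm_ge0.
rewrite -ler_pdivrMr //.
have -> : hnorm (T v) / hnorm v = hnorm (T (((hnorm v)^-1)%:C%C *: v)).
  rewrite linZ // hnormZ csq_real sqrtr_sqr ger0_norm ?invr_ge0 ?hnorm_ge0 //.
  by rewrite mulrC.
apply: ub_le_sup.
  exists M => _ [w /= w1 <-]; rewrite (le_trans (hM w)) //.
  by rewrite -[leRHS]mulr1 ler_wpM2l.
exists (((hnorm v)^-1)%:C%C *: v) => //=.
rewrite hnormZ csq_real sqrtr_sqr ger0_norm ?invr_ge0 ?hnorm_ge0 //.
by rewrite mulVf.
Qed.

End HilbertTheory.


(** * Summable families and the Hilbert space of square summable functions *)

Section RealSums.
Variables (K : realType) (I : choiceType).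
Implicit Types (a b f g : I -> K).

Definition tsum a : \bar K := \esum_(i in [set: I]) (a i)%:E.

Lemma tsum_ge0 a : (forall i, 0 <= a i) -> (0 <= tsum a)%E.
Proof. by move=> a0; apply: esum_ge0 => i _; rewrite lee_fin. Qed.

Lemma tsum_fin a : (forall i, 0 <= a i) -> (tsum a < +oo)%E -> tsum a \is a fin_num.
Proof. by move=> a0 h; rewrite ge0_fin_numE // tsum_ge0. Qed.

Lemma tsumD a b : (forall i, 0 <= a i) -> (forall i, 0 <= b i) ->
  tsum (fun i => a i + b i)%R = (tsum a + tsum b)%E.
Proof.
move=> a0 b0; rewrite /tsum -esumD; [|by move=> i _; rewrite lee_fin..].
by apply: eq_esum => i _.
Qed.

Lemma le_tsum a b : (forall i, a i <= b i) -> (tsum a <= tsum b)%E.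
Proof. by move=> h; apply: le_esum => i _; rewrite lee_fin. Qed.

Lemma tsum_lim a (M : \bar K) :
  (forall s : seq I, uniq s -> ((\sum_(i <- s) a i)%:E <= M)%E) -> (tsum a <= M)%E.
Proof.
move=> h; apply: ge_ereal_sup => _ [F [finF _] <-].
by rewrite fsbig_finite //= sumEFin; apply: h.
Qed.

Lemma tsum_ub a (s : seq I) : (forall i, 0 <= a i) -> uniq s ->
  ((\sum_(i <- s) a i)%:E <= tsum a)%E.
Proof.
move=> a0 us; apply: esum_ge; exists [set` s]; first by split=> //; exact: finite_seq.
rewrite -fsbig_seq // sumEFin lexx //.
Qed.

Lemma tsumZ (c : K) a : 0 <= c -> (forall i, 0 <= a i) ->
  tsum (fun i => c * a i)%R = (c%:E * tsum a)%E.
Proof.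
move=> c0 a0; have le (d : K) b : 0 <= d -> (forall i, 0 <= b i) ->
    (tsum (fun i => d * b i)%R <= d%:E * tsum b)%E.
  move=> d0 b0; apply: tsum_lim => s us.
  by rewrite -mulr_sumr EFinM lee_wpmul2l ?lee_fin // tsum_ub.
have [->|cn0] := eqVneq c 0.
  by rewrite mul0e /tsum esum1 // => i _; rewrite mul0r.
apply/eqP; rewrite eq_le le //=.
rewrite -[X in (_ <= X)%E]mul1e -(divff cn0) EFinM -muleA lee_wpmul2l ?lee_fin //.
have := le c^-1 (fun i => c * a i); rewrite invr_ge0 => /(_ c0).
under [tsum (fun i => c^-1 * _)%R]eq_esum do rewrite mulrA mulVf // mul1r.
by apply=> i; rewrite mulr_ge0.
Qed.

Lemma tsum_reindex (J : choiceType) (e : J -> I) (e' : I -> J) a :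
  cancel e e' -> cancel e' e ->
  tsum a = \esum_(j in [set: J]) (a (e j))%:E.
Proof.
move=> h1 h2; rewrite /tsum (@reindex_esum _ _ _ setT setT e) //.
split=> // [j k _ _ /(can_inj h1) //|i _]; by exists (e' i).
Qed.

Definition abssum f := (tsum (fun i => `|f i|)%R < +oo)%E.

Lemma abssum_le a f : (forall i, `|f i| <= a i) -> (tsum a < +oo)%E -> abssum f.
Proof. by move=> h; apply: le_lt_trans; apply: le_tsum. Qed.

Lemma abssumZ c f : abssum f -> abssum (fun i => c * f i).
Proof.
move=> sf; apply: (@abssum_le (fun i => `|c| * `|f i|)).
  by move=> i; rewrite normrM.
by rewrite tsumZ // lte_mul_pinfty // lee_fin.
Qed.

(** The sum is defined through positive and negative parts, but every other
decomposition into summable nonnegative families gives the same value. Additivity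
depends on this, as the positive part of a sum is not the sum of the positive parts. *)
Lemma rsum_sub a b : (forall i, 0 <= a i) -> (forall i, 0 <= b i) ->
  (tsum a < +oo)%E -> (tsum b < +oo)%E ->
  rsum (fun i => a i - b i) = fine (tsum a) - fine (tsum b).
Proof.
move=> a0 b0 sa sb; rewrite /rsum.
set p := fun i => Num.max (a i - b i) 0; set q := fun i => Num.max (- (a i - b i)) 0.
have p0 i : 0 <= p i by rewrite /p le_max lexx orbT.
have q0 i : 0 <= q i by rewrite /q le_max lexx orbT.
have sp : (tsum p < +oo)%E.
  apply: le_lt_trans sa; apply: le_tsum => i; rewrite /p ge_max a0 andbT.
  by rewrite lerBlDr lerDl.
have sq : (tsum q < +oo)%E.
  apply: le_lt_trans sb; apply: le_tsum => i; rewrite /q ge_max b0 andbT.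
  by rewrite opprB lerBlDr lerDl.
have e : (tsum p + tsum b = tsum q + tsum a)%E.
  rewrite -!tsumD //; apply: eq_esum => i _; congr EFin; rewrite /p /q.
  by rewrite !maxEle; case: ifPn; case: ifPn; rewrite -?ltNge; lra.
move/(congr1 fine): e; rewrite !fineD ?tsum_fin // => e.
rewrite -/(tsum p) -/(tsum q); lra.
Qed.

Lemma rsum_ge0E a : (forall i, 0 <= a i) -> (tsum a < +oo)%E -> rsum a = fine (tsum a).
Proof.
move=> a0 sa; have := @rsum_sub a (fun=> 0) a0 (fun=> lexx _) sa.
rewrite [X in (X < _)%E]/tsum esum1 // => /(_ (ltry _)).
have -> : tsum (fun=> 0 : K)%R = 0%E :> \bar K by rewrite /tsum esum1.
by rewrite subr0 => <-; congr rsum; apply/funext => i; rewrite subr0.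
Qed.

Let pos f i := Num.max (f i) 0.
Let neg f i := Num.max (- f i) 0.

Let pos_ge0 f i : 0 <= pos f i. Proof. by rewrite /pos le_max lexx orbT. Qed.
Let neg_ge0 f i : 0 <= neg f i. Proof. by rewrite /neg le_max lexx orbT. Qed.
Let posneg f i : f i = pos f i - neg f i.
Proof. by rewrite /pos /neg !maxEle; case: ifPn; case: ifPn; rewrite -?ltNge; lra. Qed.
Let pos_fin f : abssum f -> (tsum (pos f) < +oo)%E.
Proof.
apply: le_lt_trans; apply: le_tsum => i.
by rewrite /pos ge_max normr_ge0 ler_norm.
Qed.
Let neg_fin f : abssum f -> (tsum (neg f) < +oo)%E.
Proof.
apply: le_lt_trans; apply: le_tsum => i.
by rewrite /neg ge_max normr_ge0 andbT -normrN ler_norm.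
Qed.

Lemma rsumD f g : abssum f -> abssum g ->
  rsum (fun i => f i + g i) = rsum f + rsum g.
Proof.
move=> sf sg.
have -> : (fun i => f i + g i) =
   (fun i => (pos f i + pos g i) - (neg f i + neg g i)).
  by apply/funext => i; rewrite {1}posneg {1}[g i]posneg; lra.
rewrite rsum_sub; [|by move=> i; rewrite addr_ge0 ..| |]; last 2 first.
- by rewrite tsumD // lte_add_pinfty // pos_fin.
- by rewrite tsumD // lte_add_pinfty // neg_fin.
have fp h : abssum h -> tsum (pos h) \is a fin_num by move=> sh; rewrite tsum_fin ?pos_fin.
have fn h : abssum h -> tsum (neg h) \is a fin_num by move=> sh; rewrite tsum_fin ?neg_fin.
rewrite (tsumD (pos_ge0 f) (pos_ge0 g)) (tsumD (neg_ge0 f) (neg_ge0 g)).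
rewrite (fineD (fp _ sf) (fp _ sg)) (fineD (fn _ sf) (fn _ sg)) /rsum.
by rewrite -!/(tsum _) opprD addrACA.
Qed.

Lemma rsumZ c f : abssum f -> rsum (fun i => c * f i) = c * rsum f.
Proof.
move=> sf.
have fp : tsum (pos f) \is a fin_num by rewrite tsum_fin ?pos_fin.
have fn : tsum (neg f) \is a fin_num by rewrite tsum_fin ?neg_fin.
have fin (d : K) a : 0 <= d -> (forall i, 0 <= a i) -> tsum a \is a fin_num ->
    (tsum (fun i => d * a i)%R < +oo)%E.
  move=> d0 a0 fa; rewrite tsumZ // lte_mul_pinfty ?lee_fin //.
  by rewrite -ge0_fin_numE // tsum_ge0.
wlog c0 : c / 0 <= c => [main|].
  have [/main //|c0] := leP 0 c; rewrite -[c]opprK mulNr -main ?oppr_ge0 ?ltW //.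
  by rewrite /rsum opprB; congr (fine _ - fine _); apply: eq_esum => i _; rewrite !mulNr !opprK.
have -> : (fun i => c * f i) = (fun i => c * pos f i - c * neg f i).
  by apply/funext => i; rewrite {1}posneg mulrBr.
rewrite rsum_sub; [|by move=> i; rewrite mulr_ge0 ..|exact: fin|exact: fin].
rewrite (tsumZ c0 (pos_ge0 f)) (tsumZ c0 (neg_ge0 f)) !fineM //.
by rewrite /rsum -!/(tsum _) mulrBr.
Qed.

End RealSums.

Section ComplexSums.
Variables (K : realType) (I : choiceType).
Local Notation C := K[i].
Implicit Types (f g : I -> C).

Definition csummable f :=
  abssum (fun i => complex.Re (f i)) /\ abssum (fun i => complex.Im (f i)).

Lemma csumD f g : csummable f -> csummable g ->
  csum (fun i => f i + g i) = csum f + csum g.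
Proof.
move=> [f1 f2] [g1 g2]; rewrite /csum.
have -> : (fun i => complex.Re (f i + g i)) =
  (fun i => complex.Re (f i) + complex.Re (g i)) by apply/funext => i; rewrite raddfD.
have -> : (fun i => complex.Im (f i + g i)) =
  (fun i => complex.Im (f i) + complex.Im (g i)) by apply/funext => i; rewrite raddfD.
by rewrite !rsumD.
Qed.

Lemma csumZ c f : csummable f -> csum (fun i => c * f i) = c * csum f.
Proof.
move=> [f1 f2]; rewrite /csum; case: c => a b.
have -> : (fun i => complex.Re ((a +i* b)%C * f i)) =
   (fun i => a * complex.Re (f i) + (- b) * complex.Im (f i)).
  by apply/funext => i; case: (f i) => x y /=; rewrite mulNr.
have -> : (fun i => complex.Im ((a +i* b)%C * f i)) =
   (fun i => a * complex.Im (f i) + b * complex.Re (f i)).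
  by apply/funext => i; case: (f i) => x y /=.
rewrite !rsumD ?rsumZ //; try exact: abssumZ.
by rewrite /= mulNr.
Qed.

Lemma csum_conj f : csummable f -> csum (fun i => Num.conj (f i)) = Num.conj (csum f).
Proof.
move=> [f1 f2]; rewrite /csum /=.
have -> : (fun i => complex.Re (Num.conj (f i))) = (fun i => complex.Re (f i)).
  by apply/funext => i; case: (f i).
have -> : (fun i => complex.Im (Num.conj (f i))) = (fun i => -1 * complex.Im (f i)).
  by apply/funext => i; case: (f i) => x y /=; rewrite mulN1r.
by rewrite rsumZ // mulN1r.
Qed.

End ComplexSums.

Section Ell2Hilbert.
Variables (K : realType) (I : choiceType).
Local Notation C := K[i].
Local Notation E := (ell2_space K I).
Implicit Types (f g h : E).

Lemma ell2E (a : C) f g i : (a *: f + g : E) i = a * f i + g i.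
Proof. by []. Qed.

Lemma ell2DE f g i : (f + g : E) i = f i + g i. Proof. by []. Qed.
Lemma ell2BE f g i : (f - g : E) i = f i - g i. Proof. by []. Qed.
Lemma ell2ZE (a : C) f i : (a *: f : E) i = a * f i. Proof. by []. Qed.

Lemma ell2_sumE (J : Type) (r : seq J) (P : pred J) (F : J -> E) i :
  (\sum_(j <- r | P j) F j : E) i = \sum_(j <- r | P j) F j i.
Proof. by elim/big_rec2: _ => [|j x y _ <-]. Qed.

Lemma ell2_ext f g : (forall i, f i = g i) -> f = g.
Proof. by move=> h; apply: val_inj; apply/funext. Qed.

Definition nsq (f : I -> C) : \bar K := tsum (fun i => csq (f i))%R.

Lemma nsq_fin f : nsq f \is a fin_num.
Proof. by apply: tsum_fin => [i|]; [exact: csq_ge0|exact: ell2P]. Qed.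

(** From 2 |a b| <= |a|^2 + |b|^2. *)
Lemma ell2_csummable f g : csummable (fun i => f i * Num.conj (g i)).
Proof.
have b : (tsum (fun i => csq (f i) + csq (g i))%R < +oo)%E.
  rewrite tsumD; [|by move=> i; exact: csq_ge0..].
  by apply: lte_add_pinfty; exact: ell2P.
have sq (p q : K) : - (p ^+ 2 + q ^+ 2) <= p * q <= p ^+ 2 + q ^+ 2.
  by have := sqr_ge0 (p + q); have := sqr_ge0 (p - q); rewrite !expr2 => *; apply/andP; split; lra.
split; apply: abssum_le b => i; case: (f i) => p q; case: (g i) => t u;
  rewrite -[Num.conj _]/(conjc _) /csq /= ler_norml.
  by have /andP[? ?] := sq p t; have /andP[? ?] := sq q u; apply/andP; split; lra.
by have /andP[? ?] := sq p u; have /andP[? ?] := sq q t; apply/andP; split; lra.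
Qed.

Lemma ell2_innerE f g : inner f g = csum (fun i => f i * Num.conj (g i)).
Proof. by []. Qed.

Lemma ell2_inner_self f : inner f f = ((fine (nsq f))%:C)%C.
Proof.
rewrite ell2_innerE /csum.
have -> : (fun i => complex.Re (f i * Num.conj (f i))) = (fun i => csq (f i)).
  by apply/funext => i; case: (f i) => a b /=; rewrite /csq /=; ring.
have -> : (fun i => complex.Im (f i * Num.conj (f i))) = (fun i => 0).
  by apply/funext => i; case: (f i) => a b /=; ring.
rewrite !rsum_ge0E //; [|by rewrite /tsum esum1..|by move=> i; exact: csq_ge0|exact: ell2P].
by rewrite [X in (_ +i* fine X)%C](_ : _ = 0%E) // /tsum esum1.
Qed.

Lemma ell2_hnorm f : hnorm f = Num.sqrt (fine (nsq f)).
Proof. by rewrite /hnorm ell2_inner_self. Qed.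

Lemma fine_nsq_ge0 (f : I -> C) : 0 <= fine (nsq f).
Proof. by rewrite fine_ge0 // tsum_ge0 // => i; exact: csq_ge0. Qed.

Lemma ell2_nsq f : nsq f = (hnorm f ^+ 2)%:E.
Proof. by rewrite ell2_hnorm sqr_sqrtr ?fine_nsq_ge0 // fineK // nsq_fin. Qed.

Lemma ell2_hnorm_le f (M : K) : 0 <= M -> (nsq f <= (M ^+ 2)%:E)%E -> hnorm f <= M.
Proof.
by move=> M0; rewrite ell2_nsq lee_fin ler_pXn2r ?nnegrE ?sqrtr_ge0.
Qed.

Lemma sum_csq_le f (s : seq I) : uniq s -> \sum_(i <- s) csq (f i) <= hnorm f ^+ 2.
Proof.
move=> us; rewrite -lee_fin -ell2_nsq; apply: tsum_ub => // i; exact: csq_ge0.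
Qed.

Lemma csq_le_hnorm f i : csq (f i) <= hnorm f ^+ 2.
Proof. by have := @sum_csq_le f [:: i] isT; rewrite big_seq1. Qed.

Lemma csqB_eq0 (z : C) : csq z = 0 -> z = 0.
Proof.
case: z => a b; rewrite /csq /= => /eqP.
by rewrite paddr_eq0 ?sqr_ge0 // !sqrf_eq0 => /andP[/eqP -> /eqP ->].
Qed.

Lemma csqN (z : C) : csq (- z) = csq z.
Proof. by case: z => a b; rewrite /csq /= !sqrrN. Qed.

Lemma csqBC (z t : C) : csq (z - t) = csq (t - z).
Proof. by rewrite -csqN opprB. Qed.

Lemma cauchy_real (s : nat -> K) :
  (forall e : K, 0 < e -> exists N, forall m n, (N <= m)%N -> (N <= n)%N ->
     `|s m - s n| < e) ->
  exists l, forall e : K, 0 < e -> exists N, forall n, (N <= n)%N -> `|l - s n| < e.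
Proof.
move=> h; have /cvg_ex[l hl] : cvgn s.
  apply/cauchy_cvgP/cauchy_exP => e e0; have [N hN] := h e e0.
  by exists (s N); exists N => // n /= Nn; apply: hN.
exists l => e e0; move/cvgrPdist_lt : hl => /(_ e e0)[N _ hN].
by exists N => n Nn; apply: hN.
Qed.

Lemma csq_lt (z : C) (e : K) : 0 < e -> `|complex.Re z| < Num.sqrt (e / 2) ->
  `|complex.Im z| < Num.sqrt (e / 2) -> csq z < e.
Proof.
move=> e0; have e2 : 0 <= e / 2 by rewrite divr_ge0 // ltW.
have sq (t : K) : `|t| < Num.sqrt (e / 2) -> t ^+ 2 < e / 2.
  by move=> h; rewrite -[t ^+ 2]real_normK ?num_real // -[ltRHS]sqr_sqrtr // ltr_pXn2r ?nnegrE ?sqrtr_ge0.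
by move=> /sq h1 /sq h2; rewrite /csq; lra.
Qed.

Lemma sqr_lt_norm (a e : K) : 0 < e -> a ^+ 2 < e ^+ 2 -> `|a| < e.
Proof.
move=> e0; rewrite -[a ^+ 2]real_normK ?num_real // ltr_pXn2r ?nnegrE //.
exact: ltW.
Qed.

Lemma sum_csq_cvg (u : nat -> E) (v : I -> C) (s : seq I) :
  (forall i (e : K), 0 < e -> exists N, forall n, (N <= n)%N -> csq (v i - u n i) < e) ->
  forall e : K, 0 < e -> exists N, forall n, (N <= n)%N ->
    \sum_(i <- s) csq (v i - u n i) < e.
Proof.
move=> h; elim: s => [|j s IHs] e e0.
  by exists 0%N => n _; rewrite big_nil.
have e2 : 0 < e / 2 by rewrite divr_gt0.
have [N hN] := IHs _ e2; have [N' hN'] := h j _ e2.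
exists (maxn N N') => n; rewrite geq_max => /andP[n1 n2].
by rewrite big_cons; have := hN n n1; have := hN' n n2; lra.
Qed.

(** The coordinatewise limit v works: a finite partial sum of |v - u_n|^2 is close to
the same partial sum of |u_m - u_n|^2 for large m. *)
Lemma ell2_complete (u : nat -> E) :
  hcauchy u -> exists v, hcvg u v.
Proof.
move=> cu.
have cc i : exists z : C, forall e : K, 0 < e -> exists N, forall n, (N <= n)%N ->
    csq (z - u n i) < e.
  have part (p : C -> K) : {morph p : z t / z - t} -> (forall z, p z ^+ 2 <= csq z) ->
      exists l, forall e : K, 0 < e -> exists N, forall n, (N <= n)%N -> `|l - p (u n i)| < e.
    move=> pB ple; apply: cauchy_real => e e0; have [N hN] := cu e e0.
    exists N => m n Nm Nn; apply: sqr_lt_norm => //; rewrite -pB.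
    apply: le_lt_trans (ple _) _; apply: le_lt_trans (csq_le_hnorm (u m - u n) i) _.
    by rewrite ltr_pXn2r ?nnegrE ?sqrtr_ge0 ?(ltW e0) ?hN.
  have [a ha] := part (@complex.Re K) (raddfB _) ltac:(by move=> z; rewrite /csq lerDl sqr_ge0).
  have [b hb] := part (@complex.Im K) (raddfB _) ltac:(by move=> z; rewrite /csq lerDr sqr_ge0).
  exists (a +i* b)%C => e e0.
  have d0 : 0 < Num.sqrt (e / 2) by rewrite sqrtr_gt0 divr_gt0.
  have [N hN] := ha _ d0; have [N' hN'] := hb _ d0.
  exists (maxn N N') => n; rewrite geq_max => /andP[/hN n1 /hN' n2].
  by apply: csq_lt => //; rewrite raddfB.
pose v i := projT1 (cid (cc i)).
have hv i : forall e : K, 0 < e -> exists N, forall n, (N <= n)%N -> csq (v i - u n i) < e.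
  by rewrite /v; case: (cid _).
have key (e : K) : 0 < e -> exists N, forall n, (N <= n)%N ->
    (tsum (fun i => csq (v i - u n i))%R <= (e ^+ 2)%:E)%E.
  move=> e0; have e2 : 0 < e / 2 by rewrite divr_gt0.
  have [N hN] := cu _ e2; exists N => n Nn; apply: tsum_lim => s us.
  have [M hM] := @sum_csq_cvg u v s hv ((e / 2) ^+ 2) ltac:(by rewrite exprn_gt0).
  pose m := maxn M N.
  have h1 := hM m (leq_maxl _ _).
  have h2 : \sum_(i <- s) csq (u m i - u n i) <= (e / 2) ^+ 2.
    apply: le_trans (@sum_csq_le (u m - u n) s us) _.
    by rewrite ler_pXn2r ?nnegrE ?sqrtr_ge0 ?(ltW e2) // ltW // hN // leq_maxr.
  rewrite lee_fin; apply: (@le_trans _ _ (\sum_(i <- s)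
     (2 * csq (v i - u m i) + 2 * csq (u m i - u n i)))).
    apply: ler_sum => i _; have := csqD_le (v i - u m i) (u m i - u n i).
    by rewrite addrA subrK.
  rewrite big_split /= -!mulr_sumr.
  have -> : e ^+ 2 = 2 * (e / 2) ^+ 2 + 2 * (e / 2) ^+ 2 by field.
  by rewrite lerD // ler_wpM2l // ltW.
have sv : sqsum v.
  have [N /(_ N (leqnn _)) hN] := key 1 ltr01.
  have -> : v = fun i => (v i - u N i) + u N i by apply/funext => i; rewrite subrK.
  by apply: sqsumD (ell2P _); rewrite /sqsum (le_lt_trans hN) // ltry.
exists (to_ell2 v); apply/cvgrPdist_lt => e e0.
have e2 : 0 < e / 2 by rewrite divr_gt0.
have [N hN] := key _ e2; exists N => // n /= Nn; rewrite sub0r normrN.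
rewrite ger0_norm ?sqrtr_ge0 // (@le_lt_trans _ _ (e / 2)) ?ltr_pdivrMr ?ltr_pMr ?ltr1n //.
apply: ell2_hnorm_le; first exact: ltW.
apply: le_trans (hN n Nn); rewrite /nsq le_tsum // => i.
by rewrite ell2BE to_ell2E // csqBC.
Qed.

Lemma ell2_hilbert : is_hilbert E.
Proof.
have lin (a : C) f g h : inner (a *: f + g) h = a * inner f h + inner g h :> C.
  have e : (fun i => (a *: f + g) i * Num.conj (h i)) =
      (fun i => a * (f i * Num.conj (h i)) + g i * Num.conj (h i)).
    by apply/funext => i; rewrite ell2E mulrDl mulrA.
  have sZ : csummable (fun i => a * (f i * Num.conj (h i))).
    rewrite (_ : (fun _ => _) = (fun i => (a *: f) i * Num.conj (h i))).
      exact: ell2_csummable.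
    by apply/funext => i; rewrite ell2ZE mulrA.
  have sg := ell2_csummable g h; have sf := ell2_csummable f h.
  by rewrite !ell2_innerE e (csumD sZ sg) (csumZ a sf).
have con f g : inner g f = Num.conj (inner f g) :> C.
  rewrite !ell2_innerE -csum_conj; last exact: ell2_csummable.
  by congr csum; apply/funext => i; rewrite rmorphM /= conjCK mulrC.
have pos f : f != 0 -> 0 < inner f f.
  move=> f0; rewrite ell2_inner_self ltcR lt_neqAle fine_nsq_ge0 andbT eq_sym.
  apply: contra f0 => /eqP h; apply/eqP/ell2_ext => i; apply: csqB_eq0.
  have := csq_le_hnorm f i; rewrite ell2_hnorm h sqrtr0 expr0n /=.
  by have := csq_ge0 (f i) => *; apply/eqP; rewrite eq_le; apply/andP.
split=> // u; exact: ell2_complete.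
Qed.

Local Notation hE := ell2_hilbert.

(** ** The standard basis and bounded operators *)

Definition dvec (i : I) : E := to_ell2 (fun j => (j == i)%:R).

Lemma dvecE i j : dvec i j = (j == i)%:R.
Proof.
rewrite /dvec to_ell2E //; apply/sqsum_finite; apply: (@sub_finite_set _ _ [set i]).
  by move=> k /=; case: (k =P i) => // _; rewrite eqxx.
exact: finite_set1.
Qed.

Lemma sum_dvecE (s : seq I) (c : I -> C) i : uniq s ->
  (\sum_(j <- s) c j *: dvec j) i = if i \in s then c i else 0.
Proof.
move=> us; rewrite ell2_sumE; under eq_bigr do rewrite ell2ZE dvecE.
case: ifPn => hi.
  rewrite (bigD1_seq i) //= eqxx mulr1 big1 ?addr0 // => j /negPf ji.
  by rewrite eq_sym ji mulr0.
rewrite big_seq big1 // => j js; case: eqP => [ij|_]; last by rewrite mulr0.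
by move: hi; rewrite ij js.
Qed.

Lemma inner_dvec f i : inner f (dvec i) = f i.
Proof.
rewrite ell2_innerE /csum.
have fin (a : I -> K) : (forall j, j != i -> a j = 0) -> rsum a = a i.
  move=> a0; rewrite /rsum.
  have one (b : I -> K) : (forall j, 0 <= b j) -> (forall j, j != i -> b j = 0) ->
      fine (\esum_(j in [set: I]) (b j)%:E)%E = b i.
    move=> b0 bi; rewrite (_ : (\esum_(j in _) _)%E = (\esum_(j in [set i]) (b j)%:E)%E).
      by rewrite esum_set1 ?lee_fin.
    rewrite [RHS]esum_mkcond; apply: eq_esum => j _.
    have [->|ji] := eqVneq j i; first by rewrite ifT // inE.
    by rewrite bi // if_same.
  rewrite !one; try by move=> j; rewrite le_max lexx orbT.
  - by rewrite !maxEle; case: ifPn; case: ifPn; rewrite -?ltNge; lra.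
  - by move=> j /a0 ->; rewrite oppr0 maxxx.
  - by move=> j /a0 ->; rewrite maxxx.
by rewrite !fin ?dvecE ?eqxx; [case: (f i) => a b /=; congr Complex; ring| |];
  move=> j /negPf ji; rewrite dvecE ji -[Num.conj _]/(conjc 0); case: (f j) => a b /=; ring.
Qed.

(** Any finite set carrying all but e^2 of |f|^2 works, and so does every larger one. *)
Lemma ell2_dense f (e : K) : 0 < e -> exists s : seq I, uniq s /\
  forall t : seq I, uniq t -> {subset s <= t} ->
    hnorm (f - \sum_(j <- t) f j *: dvec j) <= e.
Proof.
move=> e0; have : ((hnorm f ^+ 2 - e ^+ 2)%:E < nsq f)%E.
  by rewrite ell2_nsq lte_fin ltrBlDr ltrDl exprn_gt0.
move/ereal_sup_gt => [_ [F [finF _] <-]]; rewrite fsbig_finite //= sumEFin lte_fin => hF.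
exists (fset_set F); split=> // t ut st; set g : E := \sum_(j <- t) _.
apply: ell2_hnorm_le; first exact: ltW.
have dec : nsq f = (nsq g + nsq (f - g)%R)%E.
  rewrite /nsq -tsumD; [|by move=> i; exact: csq_ge0..].
  apply: eq_esum => i _; congr EFin; rewrite ell2BE /g sum_dvecE //.
  by case: ifP => _; rewrite ?subrr ?subr0 csq0 ?addr0 ?add0r.
have hg : hnorm f ^+ 2 - e ^+ 2 <= hnorm g ^+ 2.
  apply/ltW/(lt_le_trans hF); apply: le_trans (sum_csq_le g (fset_uniq (fset_set F))).
  rewrite big_seq [leRHS]big_seq; apply: ler_sum => i iF.
  by rewrite /g sum_dvecE // st.
move: dec; rewrite !ell2_nsq -EFinD => -[dec]; rewrite lee_fin; lra.
Qed.

(** Suited to the defect of an identity which holds on the basis: it is bounded by a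
multiple of the norm, and subtracting a finite combination does not lower it. *)
Lemma dense_le0 (phi : E -> K) (B : K) : (forall f, phi f <= B * hnorm f) ->
  (forall f (s : seq I) (c : I -> C), phi f <= phi (f - \sum_(j <- s) c j *: dvec j)) ->
  forall f, phi f <= 0.
Proof.
move=> hB hs f; rewrite leNgt; apply/negP => p0.
have [d d0 hd] := small_factor (normr_ge0 B) (divr_gt0 p0 (ltr0n K 2)).
have [s [us /(_ s us (fun i => id)) hg]] := ell2_dense f d0.
have := le_trans (hs f s f) (hB _); set h := hnorm _ in hg *.
have h0 : 0 <= h by exact: hnorm_ge0.
have h1 : B * h <= `|B| * d.
  by apply: (@le_trans _ _ (`|B| * h)); [rewrite ler_wpM2r ?ler_norm|rewrite ler_wpM2l].
have fin (a b c : K) : a <= b -> b <= c -> c <= a / 2 -> 0 < a -> False by lra.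
by move=> h2; exact: fin h2 h1 hd p0.
Qed.

(** Linearity gives agreement on finite combinations of basis vectors, and these
are dense. *)
Lemma bounded_op_dvec (H : innerSpace K) (T T' : E -> H) : is_hilbert H ->
  linear T -> linear T' ->
  (exists M : K, forall f, hnorm (T f) <= M * hnorm f) ->
  (exists M : K, forall f, hnorm (T' f) <= M * hnorm f) ->
  (forall i, T (dvec i) = T' (dvec i)) -> T = T'.
Proof.
move=> hH lT lT' [M hM] [M' hM'] h; apply/funext => f.
apply/eqP; rewrite -subr_eq0; apply/eqP/(hnorm_eq0 hH)/eqP.
rewrite eq_le hnorm_ge0 andbT.
apply: (dense_le0 (phi := fun f => hnorm (T f - T' f)) (B := M + M')) => {f} [f|f s c].
  by apply: le_trans (hnormB hH _ _) _; rewrite mulrDl lerD.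
have linDZ (U : E -> H) (lU : linear U) (u v : E) : U (u - v) = U u - U v.
  by have := lU (-1) v u; rewrite !scaleN1r ![- _ + _]addrC.
set g : E := \sum_(j <- s) _; have Ug : T g = T' g.
  rewrite /g; elim: (s) => [|j r IHr]; last by rewrite big_cons lT lT' h IHr.
  rewrite big_nil; have := linDZ T lT 0 0; have := linDZ T' lT' 0 0.
  by rewrite !subrr => -> ->.
by rewrite !linDZ // Ug opprB addrA subrK.
Qed.

End Ell2Hilbert.

(** * Orientation signs *)

Section FsetActions.
Variable G : groupType.
Implicit Types (g h y z : G) (A B : {fset G}).
Local Open Scope fset_scope.

Definition toggle y A := if y \in A then A `\ y else y |` A.

Definition gset g A : {fset G} := [fset (g * y)%g | y in A].

Lemma in_gset g A y : (y \in gset g A) = ((g^-1 * y)%g \in A).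
Proof.
apply/imfsetP/idP => [[z /= zA ->]|h]; first by rewrite mulKg.
by exists (g^-1 * y)%g => //; rewrite mulVKg.
Qed.

Lemma gsetM g h A : gset (g * h)%g A = gset g (gset h A).
Proof. by apply/fsetP => y; rewrite !in_gset invgM mulgA. Qed.

Lemma gset1 A : gset 1%g A = A.
Proof. by apply/fsetP => y; rewrite in_gset invg1 mul1g. Qed.

Lemma gsetK g : cancel (gset g) (gset g^-1).
Proof. by move=> A; rewrite -gsetM mulVg gset1. Qed.

Lemma gsetKV g : cancel (gset g^-1) (gset g).
Proof. by move=> A; rewrite -gsetM mulgV gset1. Qed.

Lemma card_gset g A : #|` gset g A| = #|` A|.
Proof. by rewrite card_imfset //; exact: mulgI. Qed.

Lemma gset_eq0 g A : (gset g A == fset0) = (A == fset0).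
Proof. by rewrite -!cardfs_eq0 card_gset. Qed.

Lemma in_toggle y z A : (z \in toggle y A) = (z == y) (+) (z \in A).
Proof.
rewrite /toggle; have [->|zy] := eqVneq z y.
  by case: (boolP (y \in A)) => yA; rewrite !inE eqxx.
by case: (boolP (y \in A)) => yA; rewrite !inE (negPf zy).
Qed.

Lemma toggleK y : involutive (toggle y).
Proof. by move=> A; apply/fsetP => z; rewrite !in_toggle addbA addbb. Qed.

Lemma toggleC y z A : toggle y (toggle z A) = toggle z (toggle y A).
Proof. by apply/fsetP => t; rewrite !in_toggle addbCA. Qed.

Lemma gset_toggle g y A : gset g (toggle y A) = toggle (g * y)%g (gset g A).
Proof.
apply/fsetP => t; rewrite !(in_gset, in_toggle); congr addb.
by rewrite -(inj_eq (mulgI g)) mulVKg.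
Qed.

Lemma toggle_eq0 y A : (toggle y A == fset0) = (A == [fset y]).
Proof.
apply/eqP/eqP => h; last first.
  by apply/fsetP => z; rewrite in_toggle h !inE addbb.
by rewrite -(toggleK y A) h; apply/fsetP => z; rewrite in_toggle !inE addbF.
Qed.

Lemma card_toggle y A : odd #|` toggle y A| = ~~ odd #|` A|.
Proof.
rewrite /toggle; case: ifPn => yA; last by rewrite cardfsU1 yA.
by rewrite [in RHS](cardfsD1 y) yA /= negbK.
Qed.

End FsetActions.

Section Signs.
Variables (K : realType) (G : groupType).
Local Notation C := K[i].
Implicit Types (g h y z : G) (A B : {fset G}) (s t u : seq G).

(** For two orderings of the same set, the sign of the permutation between
them. *)
Definition sgn n s t : C :=
  \det (\matrix_(i < n, j < n) (nth 1%g s i == nth 1%g t j)%:R).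

(** The product of the two 0-1 matrices composes the matchings of the entries. *)
Lemma sgn_trans n s t u : size s = n -> size t = n -> uniq t -> {subset s <= t} ->
  sgn n s t * sgn n t u = sgn n s u.
Proof.
move=> ss st ut sub; rewrite /sgn -det_mulmx; congr (\det _).
apply/matrixP => i j; rewrite !mxE.
have sit : nth 1%g s i \in t by apply: sub; rewrite mem_nth // ss.
have kn : (index (nth 1%g s i) t < n)%N by rewrite -[X in (_ < X)%N]st index_mem.
rewrite (bigD1 (Ordinal kn)) //= !mxE /= nth_index // eqxx mul1r.
rewrite big1 ?addr0 // => k kk; rewrite !mxE.
case: eqP => [e|_]; last by rewrite mul0r.
by case/eqP: kk; apply: val_inj; rewrite /= e index_uniq // st.
Qed.

Lemma sgn_id n s : size s = n -> uniq s -> sgn n s s = 1.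
Proof.
move=> ss us; rewrite /sgn -[RHS](det1 _ n); congr (\det _).
apply/matrixP => i j; rewrite !mxE nth_uniq ?ss //.
Qed.

Lemma sgnC n s t : sgn n s t = sgn n t s.
Proof.
rewrite /sgn -det_tr; congr (\det _); apply/matrixP => i j.
by rewrite !mxE eq_sym.
Qed.

Lemma sgn_map n g s t : size s = n -> size t = n ->
  sgn n [seq (g * y)%g | y <- s] [seq (g * y)%g | y <- t] = sgn n s t.
Proof.
move=> ss st; rewrite /sgn; congr (\det _); apply/matrixP => i j.
by rewrite !mxE !(nth_map 1%g) ?ss ?st // (inj_eq (mulgI g)).
Qed.

Lemma sgn_cons n y s t : size s = n -> size t = n -> y \notin s -> y \notin t ->
  sgn n.+1 (y :: s) (y :: t) = sgn n s t.
Proof.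
move=> ss st ys yt; rewrite /sgn (expand_det_row _ ord0) (bigD1 ord0) //=.
rewrite big1 ?addr0 => [|j]; last first.
  case: (unliftP ord0 j) => [j' ->|-> //] _; rewrite mxE /=.
  case: eqP => [e|_]; last by rewrite mul0r.
  by move: yt; rewrite e mem_nth // st /= add0n; exact: ltn_ord.
rewrite mxE /= eqxx mul1r /cofactor addn0 expr0 mul1r; congr (\det _).
by apply/matrixP => i j; rewrite !mxE /=.
Qed.

Lemma sgn_swap n y z s t : sgn n.+2 (y :: z :: s) t = - sgn n.+2 (z :: y :: s) t.
Proof.
pose i0 : 'I_n.+2 := ord0; pose i1 : 'I_n.+2 := lift ord0 ord0.
rewrite /sgn; set M := (X in _ = - \det X).
rewrite (_ : (\matrix_(_, _) _) = row_perm (tperm i0 i1) M).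
  by rewrite row_permE det_mulmx det_perm odd_tperm /= mulN1r.
apply/matrixP => i j; rewrite !mxE; congr (_ == _)%:R.
case: tpermP => [->|->|/eqP n0 /eqP n1] //.
by case: i n0 n1 => [[|[|i]] hi] //=; rewrite -!val_eqE.
Qed.

Lemma wedge_trans s t A : size s = size t -> uniq t -> {subset s <= t} ->
  sgn (size s) s t * wedge_coef K t A = wedge_coef K s A.
Proof.
move=> ss ut st; rewrite /wedge_coef -ss; case: eqP => // _; last by rewrite mulr0.
by rewrite -!/(sgn _ _ _) sgn_trans.
Qed.

Lemma wedge_sgn s A : uniq s -> A =i s ->
  size s = #|` A| /\ wedge_coef K s A = sgn (size s) s (enum_fset A).
Proof.
move=> us As; have sz : size s = #|` A|.
  by apply/eqP; rewrite eqn_leq !uniq_leq_size ?fset_uniq //;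
    move=> y; rewrite ?As // => h; rewrite -As.
by split=> //; rewrite /wedge_coef sz eqxx.
Qed.

Lemma wedge_sqr s A : uniq s -> A =i s -> wedge_coef K s A * wedge_coef K s A = 1.
Proof.
move=> us As; have [sz ->] := wedge_sgn us As.
rewrite {2}sgnC sgn_trans ?sgn_id //; first exact: fset_uniq.
by move=> y; rewrite -As.
Qed.

(** The matrix entry between e_A and e_(toggle y A) of exterior multiplication by y
plus its adjoint. *)
Definition sigma y A : C := wedge_coef K (y :: enum_fset (A `\ y)%fset) (y |` A)%fset.

(** The sign with which translation by g acts on e_A: the enumeration of the
translate need not follow that of A. *)
Definition eps g A : C := wedge_coef K [seq (g * y)%g | y <- enum_fset A] (gset g A).

Lemma sigma_toggle y A : sigma y (toggle y A) = sigma y A.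
Proof.
rewrite /sigma; congr wedge_coef.
  congr (_ :: enum_fset _); apply/fsetP => z; rewrite !inE in_toggle.
  by case: (z == y).
by apply/fsetP => z; rewrite !inE in_toggle; case: (z == y).
Qed.

Lemma sigma_sqr y A : sigma y A * sigma y A = 1.
Proof.
apply: wedge_sqr => [|z]; first by rewrite /= fset_uniq !inE eqxx.
by rewrite !inE; case: (z == y).
Qed.

Lemma eps_sqr g A : eps g A * eps g A = 1.
Proof.
apply: wedge_sqr => [|z]; first by rewrite map_inj_uniq ?fset_uniq //; exact: mulgI.
rewrite in_gset; apply/idP/mapP => [h|[t tA ->]]; last by rewrite mulKg.
by exists (g^-1 * z)%g => //; rewrite mulVKg.
Qed.

Lemma wedge_cons y s A : y \notin A -> uniq s -> A =i s ->
  wedge_coef K (y :: s) (y |` A)%fset = wedge_coef K s A * sigma y A.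
Proof.
move=> yA us As; have [sz ->] := wedge_sgn us As.
rewrite /sigma (_ : A `\ y = A)%fset; last first.
  by apply/fsetP => z; rewrite !inE; case: eqP => // ->; rewrite (negPf yA).
rewrite -(@sgn_cons _ y) //; last by rewrite -As.
apply/esym/(@wedge_trans (y :: s) (y :: enum_fset A) (y |` A)%fset) => /=.
- by rewrite sz.
- by rewrite yA fset_uniq.
- by move=> z; rewrite !inE -As.
Qed.

Lemma sigmaE y A : y \notin A -> sigma y A = wedge_coef K (y :: enum_fset A) (y |` A)%fset.
Proof.
move=> yA; rewrite wedge_cons ?fset_uniq //.
have [_ ->] := @wedge_sgn (enum_fset A) A (fset_uniq _) (fun=> erefl).
by rewrite sgn_id ?fset_uniq ?mul1r.
Qed.

Lemma sigma_anti_base y z A : y != z -> y \notin A -> z \notin A ->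
  sigma y A * sigma z (y |` A)%fset = - (sigma z A * sigma y (z |` A)%fset).
Proof.
move=> yz yA zA; rewrite (sigmaE yA) (sigmaE zA).
rewrite -wedge_cons /= ?yA ?fset_uniq ?inE ?negb_or ?zA 1?eq_sym ?yz //; last first.
  by move=> t; rewrite !inE.
rewrite -wedge_cons /= ?zA ?fset_uniq ?inE ?negb_or ?yA ?yz //; last first.
  by move=> t; rewrite !inE.
rewrite /wedge_coef /= -!/(sgn _ _ _) sgn_swap fsetUCA.
by case: ifP => // _; rewrite oppr0.
Qed.

(** Exterior multiplications and contractions by distinct basis vectors
anticommute. If y and z are outside A this is a swap of two rows of a determinant;
toggling y or z in the identity reduces the other cases to this one. *)
Lemma sigma_anti y z A : y != z ->
  sigma y A * sigma z (toggle y A) = - (sigma z A * sigma y (toggle z A)).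
Proof.
have swap (a1 a2 a3 a4 : C) : a2 * a2 = 1 -> a3 * a3 = 1 ->
    a1 * a2 = - (a3 * a4) -> a1 * a3 = - (a2 * a4).
  move=> h2 h3 h; have -> : a1 = - (a3 * a4) * a2 by rewrite -h -mulrA h2 mulr1.
  transitivity (- (a2 * a4) * (a3 * a3)); first by ring.
  by rewrite h3 mulr1.
pose Q y z B := sigma y B * sigma z (toggle y B) = - (sigma z B * sigma y (toggle z B)).
have QC a b B : Q a b B -> Q b a B by rewrite /Q => ->; rewrite opprK.
have Qt a b B : Q a b B -> Q a b (toggle a B).
  rewrite /Q sigma_toggle toggleK (toggleC b a) sigma_toggle.
  by apply: swap; exact: sigma_sqr.
rewrite -/(Q y z A) => yz.
have base B : y \notin B -> z \notin B -> Q y z B.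
  move=> yB zB; have := sigma_anti_base yz yB zB.
  by rewrite /Q /toggle (negPf yB) (negPf zB).
wlog yA : A / y \notin A => [H|].
  have [yA|yA] := boolP (y \in A); last exact: H.
  by rewrite -(toggleK y A); apply/Qt/H; rewrite in_toggle eqxx yA.
have [zA|zA] := boolP (z \in A); last exact: base.
rewrite -(toggleK z A); apply/QC/Qt/QC/base; rewrite in_toggle ?eqxx ?zA //.
by rewrite (negPf yz).
Qed.

Lemma wedge_gset g s A : uniq s -> A =i s ->
  wedge_coef K [seq (g * y)%g | y <- s] (gset g A) = wedge_coef K s A * eps g A.
Proof.
move=> us As; have [sz ->] := wedge_sgn us As.
rewrite -(@sgn_map _ g) // /eps.
have ut : uniq [seq (g * y)%g | y <- enum_fset A].
  by rewrite map_inj_uniq ?fset_uniq //; exact: mulgI.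
have sub : {subset [seq (g * y)%g | y <- s] <= [seq (g * y)%g | y <- enum_fset A]}.
  by move=> _ /mapP[y ys ->]; rewrite map_f // -[_ \in _]/(y \in A) As.
have := wedge_trans (gset g A) _ ut sub; rewrite !size_map => <- //.
Qed.

(** Cocycle identity: translation by g after translation by h is translation by g h. *)
Lemma epsM g h A : eps (g * h)%g A = eps h A * eps g (gset h A).
Proof.
rewrite -wedge_gset.
- rewrite /eps -gsetM -map_comp; congr wedge_coef; apply: eq_map => y /=.
  by rewrite mulgA.
- by rewrite map_inj_uniq ?fset_uniq //; exact: mulgI.
- move=> y; rewrite in_gset; apply/idP/mapP => [yA|[z zA ->]]; last by rewrite mulKg.
  by exists (h^-1 * y)%g => //; rewrite mulVKg.
Qed.

(** Translation by g intertwines Clifford multiplication by y and by g y. *)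
Lemma eps_sigma g y A : sigma y A * eps g (toggle y A) = eps g A * sigma (g * y)%g (gset g A).
Proof.
have base B : y \notin B ->
    sigma y B * eps g (toggle y B) = eps g B * sigma (g * y)%g (gset g B).
  move=> yB; have gyB : (g * y)%g \notin gset g B by rewrite in_gset mulKg.
  rewrite {1}(sigmaE yB) /toggle (negPf yB) -wedge_gset; last 2 first.
  - by rewrite /= yB fset_uniq.
  - by move=> z; rewrite !inE.
  rewrite (_ : gset g _ = (g * y)%g |` gset g B)%fset; last first.
    by have := gset_toggle g y B; rewrite /toggle (negPf yB) (negPf gyB).
  rewrite /= wedge_cons //.
  - by rewrite map_inj_uniq ?fset_uniq //; exact: mulgI.
  - move=> z; rewrite in_gset; apply/idP/mapP => [zA|[t tA ->]]; last by rewrite mulKg.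
    by exists (g^-1 * z)%g => //; rewrite mulVKg.
have [yA|yA] := boolP (y \in A); last exact: base.
have := base (toggle y A); rewrite in_toggle eqxx yA => /(_ isT).
rewrite toggleK sigma_toggle gset_toggle sigma_toggle => h.
have e1 := eps_sqr g A; have e2 := eps_sqr g (toggle y A).
apply/esym; transitivity (eps g (toggle y A) * (eps g (toggle y A) *  sigma (g * y)%g (gset g A)) * eps g A).
  by rewrite mulrA e2 mul1r mulrC.
by rewrite -h mulrA -mulrA -mulrA e1 mulr1 mulrC.
Qed.

Lemma csq_sign (z : C) : z * z = 1 -> csq z = 1.
Proof.
move=> /eqP; rewrite -expr2 sqrf_eq1 => /orP[] /eqP ->;
  by rewrite /csq /= ?oppr0 ?sqrrN expr0n addr0 expr1n.
Qed.

End Signs.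

(** * Geometry of the Cayley graph *)

Section WordMetric.
Variables (G : groupType) (S : {fset G}).
Hypotheses (symS : symmetric_set S) (genS : generating S).
Implicit Types (g h x y z : G).

Local Notation wl := (word_length S).
Local Notation d := (wdist S).

Lemma wprod_cat (u v : seq G) : wprod (u ++ v) = (wprod u * wprod v)%g.
Proof. by rewrite /wprod big_cat. Qed.

Lemma word_lengthP g : (exists w, [/\ is_word S w, wprod w = g & size w = wl g]) /\
  forall w, is_word S w -> wprod w = g -> (wl g <= size w)%N.
Proof.
rewrite /word_length; set E := [set n | _].
suff ex : exists n, E n by exact: (xgetPex 0%N ex).
have ex : exists n, `[< exists w, [/\ is_word S w, wprod w = g & size w = n] >].
  by have [w ww wg] := genS g; exists (size w); apply/asboolP; exists w.
exists (ex_minn ex); case: ex_minnP => n /asboolP[w [ww wg wn]] min; split; first by exists w.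
by move=> v vw vg; apply: min; apply/asboolP; exists v.
Qed.

Lemma wl_le w : is_word S w -> (wl (wprod w) <= size w)%N.
Proof. by move=> ww; have [_] := word_lengthP (wprod w); apply. Qed.

Lemma wl_word g : exists w, [/\ is_word S w, wprod w = g & size w = wl g].
Proof. by have [] := word_lengthP g. Qed.

Lemma wlM g h : (wl (g * h)%g <= wl g + wl h)%N.
Proof.
have [u [uw <- <-]] := wl_word g; have [v [vw <- <-]] := wl_word h.
by rewrite -wprod_cat -size_cat wl_le // /is_word all_cat; apply/andP.
Qed.

Lemma wl1 : wl 1%g = 0%N.
Proof. by apply/eqP; rewrite -leqn0; have := @wl_le [::] isT; rewrite /wprod big_nil. Qed.

Lemma wl_mem s : s \in S -> (wl s <= 1)%N.
Proof.
by move=> sS; have := @wl_le [:: s]; rewrite /wprod big_seq1 /= sS; apply.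
Qed.

Lemma wlV_le g : (wl g^-1%g <= wl g)%N.
Proof.
have [u [uw <- <-]] := wl_word g; elim: u uw => [|s u IHu].
  by rewrite /wprod big_nil invg1 wl1.
rewrite /= => /andP[sS uw]; rewrite /wprod big_cons invgM.
apply: leq_trans (wlM _ _) _; rewrite addnC -add1n leq_add ?IHu //.
by rewrite wl_mem // symS.
Qed.

Lemma wlV g : wl g^-1%g = wl g.
Proof. by apply/eqP; rewrite eqn_leq wlV_le -{1}[g]invgK wlV_le. Qed.

Lemma wdist_tri y x z : (d x z <= d x y + d y z)%N.
Proof.
rewrite /wdist; have -> : (x^-1 * z = x^-1 * y * (y^-1 * z))%g by rewrite mulgA mulgK.
exact: wlM.
Qed.

Lemma wdistC x y : d x y = d y x.
Proof. by rewrite /wdist -wlV invgM invgK. Qed.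

Lemma wdistxx x : d x x = 0%N.
Proof. by rewrite /wdist mulVg wl1. Qed.

Lemma wdist_mul g x y : d (g * x)%g (g * y)%g = d x y.
Proof. by rewrite /wdist invgM -mulgA mulKg. Qed.

Fixpoint ball (n : nat) : {fset G} :=
  if n is n'.+1 then (ball n' `|` [fset y in [seq (g * s)%g | g <- enum_fset (ball n'), s <- enum_fset S]])%fset
  else [fset 1%g]%fset.

Lemma card_ball n : (#|` ball n| <= (1 + #|` S|) ^ n)%N.
Proof.
elim: n => [|n IHn]; first by rewrite cardfs1.
apply: leq_trans (leq_card_fsetU _ _) _; rewrite expnSr mulnDr muln1.
by rewrite leq_add // card_fseq (leq_trans (size_undup _)) // size_allpairs leq_mul.
Qed.

Lemma mem_ball n g : (wl g <= n)%N -> g \in ball n.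
Proof.
have mono m k : (m <= k)%N -> {subset ball m <= ball k}.
  move=> /subnK <-; elim: (k - m)%N => [|j IHj] y hy //=.
  by rewrite inE IHj.
have [w [ww <- <-]] := wl_word g; move=> /mono; apply.
elim/last_ind: w ww => [|w s IHw]; first by rewrite /wprod big_nil /= inE.
rewrite /is_word all_rcons => /andP[sS ww].
rewrite size_rcons -cats1 wprod_cat /wprod big_seq1 /= inE; apply/orP; right.
by rewrite inE; apply/allpairsP; exists (wprod w, s); split=> //; exact: IHw.
Qed.

Variables (w : G -> seq G) (hw : minimal_words S w).

(** From the index d x y on, the path stays at y. *)
Definition gpath x y (i : nat) : G := (x * wprod (take i (w (x^-1 * y))))%g.

Lemma size_w x y : size (w (x^-1 * y)%g) = d x y.
Proof. by have [_ _ ->] := hw (x^-1 * y)%g. Qed.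

Lemma gpath0 x y : gpath x y 0 = x.
Proof. by rewrite /gpath take0 /wprod big_nil mulg1. Qed.

Lemma gpath_end x y i : (d x y <= i)%N -> gpath x y i = y.
Proof.
move=> h; rewrite /gpath take_oversize ?size_w //.
by have [_ -> _] := hw (x^-1 * y)%g; rewrite mulVKg.
Qed.

Lemma gpathS x y i : gpath x y i.+1 = (gpath x y i * nth 1%g (w (x^-1 * y)) i)%g.
Proof.
rewrite /gpath; case: (ltnP i (d x y)) => h.
  by rewrite (take_nth 1%g) ?size_w // -cats1 wprod_cat mulgA /wprod big_seq1.
by rewrite nth_default ?size_w // mulg1 !take_oversize ?size_w // ltnW.
Qed.

Lemma nth_w_mem x y i : (i < d x y)%N -> nth 1%g (w (x^-1 * y)) i \in S.
Proof.
move=> h; have [ww _ _] := hw (x^-1 * y)%g.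
by move/allP: ww; apply; rewrite mem_nth // size_w.
Qed.

Lemma gpath_le x y i j : (i <= j)%N -> (d (gpath x y i) (gpath x y j) <= j - i)%N.
Proof.
move=> ij; have -> : j = (i + (j - i))%N by rewrite subnKC.
rewrite addKn; elim: (j - i)%N => [|k IHk]; first by rewrite addn0 wdistxx.
apply: leq_trans (wdist_tri (gpath x y (i + k)) _ _) _.
rewrite addnS -[k.+1]addn1 leq_add // gpathS /wdist mulKg.
case: (ltnP (i + k) (d x y)) => h; first by rewrite wl_mem // nth_w_mem.
by rewrite nth_default ?size_w // wl1.
Qed.

Lemma gpath_dist x y i j : (i <= j)%N -> (j <= d x y)%N ->
  d (gpath x y i) (gpath x y j) = (j - i)%N.
Proof.
move=> ij jn; apply/eqP; rewrite eqn_leq gpath_le //=.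
have h1 := wdist_tri (gpath x y i) x y.
have h2 := wdist_tri (gpath x y j) (gpath x y i) y.
have := gpath_le x y (leq0n i); have := gpath_le x y jn.
rewrite gpath0 (gpath_end (leqnn _)) subn0; lia.
Qed.

Lemma gpath_dist0 x y i : (i <= d x y)%N -> d x (gpath x y i) = i.
Proof. by move=> h; have := gpath_dist (leq0n i) h; rewrite gpath0 subn0. Qed.

Lemma gpath_dist1 x y i : (i <= d x y)%N -> d (gpath x y i) y = (d x y - i)%N.
Proof. by move=> h; have := gpath_dist h (leqnn _); rewrite [gpath x y (d x y)]gpath_end. Qed.

End WordMetric.

Section CayleyGraph.
Variables (K : realType) (G : groupType) (S : {fset G}).
Hypotheses (symS : symmetric_set S) (genS : generating S).
Variables (w : G -> seq G) (hw : minimal_words S w).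
Implicit Types (g h x y z : G) (p q : cayley K S).
Local Notation d := (wdist S).
Local Notation wdC := (wdistC symS genS).

Lemma cpos_ge0 p : 0 <= cpos p.
Proof. by case: p => a b c /= /and3P[]. Qed.
Lemma cpos_le1 p : cpos p <= 1.
Proof. by case: p => a b c /= /and3P[]. Qed.

Lemma wdist_cend p : (d (csrc p) (cend p) <= 1)%N.
Proof.
case: p => u s c hp; rewrite /cend /wdist /= mulKg.
case/and3P: hp => _ _ /orP[/(wl_mem genS) //|/andP[/eqP -> _]]; by rewrite wl1.
Qed.

Lemma through_endsC p q : through_ends p q = through_ends q p.
Proof.
rewrite /through_ends minACA; congr Num.min; congr Num.min;
  rewrite wdC addrAC [X in X + _]addrC; lra.
Qed.

Lemma cayley_distC p q : cayley_dist p q = cayley_dist q p.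
Proof.
rewrite /cayley_dist through_endsC (eq_sym (csrc p) (csrc q)) (eq_sym (clab p)).
rewrite distrC [(csrc p == cend q) && _]andbC.
by case: ifP => // _; case: ifP => // _; congr Num.min; congr (`|_|); lra.
Qed.

(** From a vertex p, a shortest path to a point of an edge enters this edge through
one of its ends, even when p itself is an end of the edge. *)
Lemma cayley_dist_end p q : cpos p = 0 ->
  Num.min ((d (csrc p) (csrc q))%:R + cpos q) ((d (csrc p) (cend q))%:R + (1 - cpos q))
    <= cayley_dist p q.
Proof.
move=> p0; have q0 := cpos_ge0 q; have q1 := cpos_le1 q.
have thr : Num.min ((d (csrc p) (csrc q))%:R + cpos q)
    ((d (csrc p) (cend q))%:R + (1 - cpos q)) <= through_ends p q.
  have pe : (d (csrc p) (cend p))%:R <= 1 :> K by rewrite (ler_nat _ _ 1) wdist_cend.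
  have t1 : (d (csrc p) (csrc q))%:R <= (d (csrc p) (cend p))%:R + (d (cend p) (csrc q))%:R :> K.
    by rewrite -natrD ler_nat wdist_tri.
  have t2 : (d (csrc p) (cend q))%:R <= (d (csrc p) (cend p))%:R + (d (cend p) (cend q))%:R :> K.
    by rewrite -natrD ler_nat wdist_tri.
  rewrite /through_ends p0 !le_min !ge_min !add0r subr0.
  rewrite -!andbA; apply/and4P; split; apply/orP; [left|right|left|right]; lra.
rewrite /cayley_dist; case: ifPn => [/andP[/eqP e _]|_].
  rewrite le_min thr andbT ge_min p0 sub0r normrN ger0_norm // e wdistxx // add0r lexx //.
case: ifPn => [/andP[/eqP e _]|_ //].
rewrite le_min thr andbT ge_min p0 sub0r normrN ger0_norm ?subr_ge0 //.
by rewrite {2}e wdistxx // add0r lexx orbT.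
Qed.

(** A total constructor, so that a curve can be defined before its points are known
to be legitimate. *)
Definition mkc (u s : G) (t : K) : cayley K S :=
  match @idP [&& 0 <= t, t <= 1 & (s \in S) || ((s == 1%g) && (t == 0))] with
  | ReflectT h => Cayley u h
  | ReflectF _ => vertex K S u
  end.

Lemma mkcE u s t : [&& 0 <= t, t <= 1 & (s \in S) || ((s == 1%g) && (t == 0))] ->
  [/\ csrc (mkc u s t) = u, clab (mkc u s t) = s & cpos (mkc u s t) = t].
Proof. by rewrite /mkc; case: {-}_ / idP. Qed.

(** The distinguished geodesic as a curve of unit speed. At its end t = d x y the
label takes the default value 1 at position 0, which encodes the vertex y. *)
Definition gcurve x y (t : K) : cayley K S :=
  let i := Num.truncn t in mkc (gpath w x y i) (nth 1%g (w (x^-1 * y)%g) i) (t - i%:R).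

Lemma gcurveP x y (t : K) : 0 <= t <= (d x y)%:R -> exists i : nat,
  let p := gcurve x y t in
  [/\ (i <= d x y)%N, csrc p = gpath w x y i, cend p = gpath w x y i.+1,
     t = i%:R + cpos p &
     [/\ clab p = nth 1%g (w (x^-1 * y)%g) i, cpos p < 1 & (i = d x y -> cpos p = 0)]].
Proof.
move=> /andP[t0 tn]; exists (Num.truncn t).
have /andP[i1 i2] := truncn_itv t0; set i := Num.truncn t in i1 i2 *.
have le_in : (i <= d x y)%N by rewrite -(ler_nat K) (le_trans i1).
have [] := @mkcE (gpath w x y i) (nth 1%g (w (x^-1 * y)%g) i) (t - i%:R).
  rewrite subr_ge0 i1 lerBlDl natr1 ltW //=.
  move: le_in; rewrite leq_eqVlt => /orP[/eqP e|/(nth_w_mem hw) -> //].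
  rewrite nth_default ?eqxx ?(size_w hw) ?e //= subr_eq0 orbC.
  by apply/orP; left; rewrite eq_le tn -e i1.
rewrite -/(gcurve x y t) => h1 h2 h3; split=> //; last split=> //.
- by rewrite /cend h1 h2 (gpathS hw).
- by rewrite h3 addrC subrK.
- by rewrite h3 ltrBlDl natr1.
- by move=> e; rewrite h3; apply/eqP; rewrite subr_eq0 eq_le i1 e tn.
Qed.

(** Along the path the distance grows by exactly one at each step, so that among
the routes through the ends of the two edges the one along the path is shortest. *)
Lemma gcurve_geodesic x y : geodesic (@cayley_dist K G S) (gcurve x y) (d x y)%:R.
Proof.
split=> // s t; wlog st : s t / s <= t => [H hs ht|].
  case: (leP s t) => h; first exact: H.
  by rewrite cayley_distC distrC H // ltW.
move=> hs ht; have [i [i_n si ei se [li s1 sn]]] := gcurveP hs.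
have [j [j_n sj ej te [lj t1 tn]]] := gcurveP ht.
set p := gcurve x y s in si ei se li s1 sn *; set q := gcurve x y t in sj ej te lj t1 tn *.
have p0 := cpos_ge0 p; have q0 := cpos_ge0 q.
rewrite distrC ger0_norm ?subr_ge0 //.
have ij : (i <= j)%N.
  rewrite leqNgt; apply/negP => ji; have : j.+1%:R <= i%:R :> K by rewrite ler_nat.
  by rewrite -natr1; lra.
have dge0 a b : 0 <= (d a b)%:R :> K by [].
move: ij; rewrite leq_eqVlt => /orP[/eqP e|ij].
  rewrite /cayley_dist si sj li lj e !eqxx /=.
  have -> : t - s = `|cpos p - cpos q|.
    by rewrite distrC te se e ger0_norm; move: st; rewrite te se e; lra.
  apply/min_idPl; rewrite /through_ends ei ej si sj e.
  have : cpos p <= cpos q by move: st; rewrite se te e; lra.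
  move=> pq; rewrite distrC ger0_norm ?subr_ge0 //.
  move: j_n; rewrite leq_eqVlt => /orP[/eqP jn|jn].
    by rewrite tn // sn ?e // subrr !le_min !addr_ge0 ?subr_ge0 ?subr0 ?dge0.
  have -> : d (gpath w x y j) (gpath w x y j.+1) = 1%N.
    by rewrite (gpath_dist genS hw) // subSnn.
  have -> : d (gpath w x y j.+1) (gpath w x y j) = 1%N.
    by rewrite wdC (gpath_dist genS hw) // subSnn.
  rewrite !(wdistxx genS) !le_min -!andbA; apply/and4P; split; lra.
have jS : j = d x y -> gpath w x y j.+1 = gpath w x y j.
  by move=> jn; rewrite [LHS](gpath_end hw) ?jn ?leqnSn // (gpath_end hw).
have dij : (d (gpath w x y i) (gpath w x y j))%:R = j%:R - i%:R :> K.
  by rewrite (gpath_dist genS hw (ltnW ij) j_n) natrB // ltnW.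
have dij1 : (d (gpath w x y i.+1) (gpath w x y j))%:R = j%:R - i%:R - 1 :> K.
  by rewrite (gpath_dist genS hw ij j_n) natrB // -natr1; lra.
have dijS : (d (gpath w x y i) (gpath w x y j.+1))%:R >= j%:R - i%:R + cpos q :> K.
  move: j_n; rewrite leq_eqVlt => /orP[/eqP jn|jn].
    by rewrite jS // dij tn // addr0.
  by rewrite (gpath_dist genS hw) ?(leqW (ltnW ij)) // natrB ?(leqW (ltnW ij)) // -natr1; lra.
have dijSS : (d (gpath w x y i.+1) (gpath w x y j.+1))%:R >= j%:R - i%:R - 1 + cpos q :> K.
  move: j_n; rewrite leq_eqVlt => /orP[/eqP jn|jn].
    by rewrite jS // dij1 tn // addr0.
  by rewrite (gpath_dist genS hw) ?(leqW ij) // natrB ?(leqW ij) // -!natr1; lra.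
have ji : i%:R + 1 <= j%:R :> K by rewrite natr1 ler_nat.
rewrite /cayley_dist si sj; case: ifPn => [/andP[/eqP e _]|_].
  by move: dij; rewrite e (wdistxx genS) => h; exfalso; move: h; lra.
rewrite ej ei; case: ifPn => [/andP[/eqP e _]|_].
  by move: dijS; rewrite -e (wdistxx genS) => h; exfalso; move: h; lra.
rewrite /through_ends si sj ei ej dij dij1; apply/eqP; rewrite eq_le; apply/andP; split.
  by rewrite !ge_min; apply/orP; right; apply/orP; left; lra.
rewrite !le_min -!andbA; apply/and4P; split; lra.
Qed.

Lemma gcurve0 x y : csrc (gcurve x y 0) = x /\ cpos (gcurve x y 0) = 0.
Proof.
have h : 0 <= (0 : K) <= (d x y)%:R by rewrite lexx ler0n.
have [i [i_n si ei se [_ s1 sn]]] := gcurveP h.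
have p0 := cpos_ge0 (gcurve x y 0).
have i0 : i = 0%N.
  by apply/eqP; rewrite -(eqr_nat K); have := ler0n K i; rewrite eq_le => -> //; lra.
by rewrite si i0 gpath0; split=> //; move: se; rewrite i0; lra.
Qed.

Lemma gcurve_nat x y i : (i <= d x y)%N ->
  csrc (gcurve x y i%:R) = gpath w x y i /\ cpos (gcurve x y i%:R) = 0.
Proof.
move=> i_n; have h : 0 <= (i%:R : K) <= (d x y)%:R by rewrite ler0n ler_nat.
have [j [j_n sj ej te [_ t1 tn]]] := gcurveP h.
have p0 := cpos_ge0 (gcurve x y i%:R).
have ij : i = j.
  apply/eqP; rewrite eqn_leq; apply/andP; split; last by rewrite -(ler_nat K); lra.
  by rewrite -ltnS -(ltr_nat K) -natr1; lra.
by rewrite sj ij; split=> //; move: te; rewrite ij; lra.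
Qed.

(** A detour from the geodesic to p and back costs less than 2 r. *)
Lemma near_geodesic x y (p q : cayley K S) (k : nat) (r : K) : (k <= d x y)%N ->
  csrc q = gpath w x y k -> cend q = gpath w x y k.+1 -> cpos p = 0 ->
  cayley_dist p q < r ->
  (d x (csrc p) + d (csrc p) y)%:R < (d x y)%:R + 2 * r.
Proof.
move=> kn sq eq p0 /(le_lt_trans (cayley_dist_end q p0)).
have q0 := cpos_ge0 q; have q1 := cpos_le1 q.
have main j : (j <= d x y)%N ->
    (d x (csrc p) + d (csrc p) y)%:R <= (d x y)%:R + 2 * (d (csrc p) (gpath w x y j))%:R :> K.
  move=> jn; have h1 := wdist_tri genS (gpath w x y j) x (csrc p).
  have h2 := wdist_tri genS (gpath w x y j) (csrc p) y.
  move: h1 h2; rewrite (gpath_dist0 genS hw) // (gpath_dist1 genS hw) //.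
  rewrite (wdC (gpath w x y j)) => h1 h2.
  rewrite -natrM -natrD ler_nat; lia.
rewrite sq eq gt_min => /orP[h|h]; first by have := main k kn; lra.
move: kn; rewrite leq_eqVlt => /orP[/eqP e|kn]; last by have := main _ kn; lra.
move: h; rewrite (gpath_end hw) ?e // => h.
by have := main _ (leqnn _); rewrite (gpath_end hw) //; lra.
Qed.

(** The infimum in the neighbourhood need not be attained, but distances between
vertices are integers, so that the slack can be rounded away. *)
Lemma near_pathP x y z (dl : nat) :
  closed_nbhd (@cayley_dist K G S) (path_of w x y) dl%:R (vertex K S z) ->
  (d x z + d z y <= d x y + 2 * dl)%N.
Proof.
rewrite /closed_nbhd /= => h.
have /ereal_inf_lt[_ [q hq <-]] : (ereal_inf [set (cayley_dist (vertex K S z) q)%:E |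
    q in path_of w x y] < (dl%:R + 4^-1)%:E)%E.
  by apply: le_lt_trans h _; rewrite lte_fin ltrDl invr_gt0.
rewrite lte_fin => hd.
(* twice the slack 1/4 is still less than one, the gap between integers *)
suff : (d x z + d z y)%:R < (d x y)%:R + 2 * (dl%:R + 4^-1) :> K.
  move=> h'; rewrite -ltnS -(ltr_nat K); apply: lt_le_trans h' _; rewrite -[X in _ <= X]natr1 natrD natrM; lra.
case: hq => [e|[k [kn sk lk]]].
  rewrite e in hd.
  have := @cayley_dist_end (vertex K S z) (vertex K S x) erefl.
  rewrite /= /cend /= mulg1 => /le_lt_trans/(_ hd).
  rewrite addr0 subr0 gt_min => hz.
  have {}hz : (d z x)%:R < dl%:R + 4^-1 :> K by case/orP: hz; lra.
  have : (d z y <= d x z + d x y)%N by rewrite (wdC x z) wdist_tri.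
  rewrite -(ler_nat K) natrD [d z x]wdC in hz *; rewrite natrD; lra.
move: kn; rewrite (size_w hw) => kn.
apply: (@near_geodesic x y (vertex K S z) q k) => //; first exact: ltnW.
by rewrite /cend sk lk (gpathS hw).
Qed.

Variable dl : nat.
Hypothesis slimK : hyperbolic_space (@cayley_dist K G S) dl%:R.

(** Slimness for the triangle with vertices a, c, b, in the form of an excess over
the triangle inequality, which is easier to combine than neighbourhoods. *)
Lemma slim a b c i : (i <= d a c)%N -> let p := gpath w a c i in
  (d a p + d p b <= d a b + 2 * dl)%N \/ (d b p + d p c <= d b c + 2 * dl)%N.
Proof.
move=> i_n p.
pose v (k : 'I_3) : G := nth 1%g [:: a; c; b] k.
pose cu (k : 'I_3) := gcurve (v k) (v (ordS k)).
pose l (k : 'I_3) : K := (d (v k) (v (ordS k)))%:R.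
have tri : geodesic_triangle (@cayley_dist K G S) cu l.
  split=> k; first exact: gcurve_geodesic.
  have [e1 e2] := @gcurve_nat (v k) (v (ordS k)) _ (leqnn _).
  have [e3 e4] := gcurve0 (v (ordS k)) (v (ordS (ordS k))).
  rewrite (gpath_end hw) // in e1.
  apply/eqP; rewrite eq_le; apply/andP; split; last first.
    apply: le_trans (cayley_dist_end _ _); last by rewrite -/(cu k) e2.
    by rewrite le_min; apply/andP; split; rewrite addr_ge0 ?cpos_ge0 ?subr_ge0 ?cpos_le1.
  have thr : through_ends (cu k (l k)) (cu (ordS k) 0) <= 0.
    rewrite /through_ends !ge_min; apply/orP; left; apply/orP; left.
    by rewrite /cu /l e1 e2 e3 e4 wdistxx // !addr0.
  by rewrite /cayley_dist; case: ifP => _; [|case: ifP => _ //]; rewrite ge_min thr orbT.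
have pside : side (cu ord0) (l ord0) (gcurve a c i%:R).
  by exists i%:R => //=; rewrite ler0n ler_nat.
have := slimK tri pside; rewrite /closed_nbhd /= => h.
have [sp cp] := gcurve_nat i_n.
have /ereal_inf_lt[_ [q [k /= k0 [t tl <-]] <-]] : (ereal_inf [set (cayley_dist (gcurve a c i%:R) q)%:E |
    q in \bigcup_(j in [set j | j != ord0]) side (cu j) (l j)] < (dl%:R + 4^-1)%:E)%E.
  by apply: le_lt_trans h _; rewrite lte_fin ltrDl invr_gt0.
rewrite lte_fin => hd; have [j [j_n sj ej _ _]] := gcurveP tl.
have := near_geodesic j_n sj ej cp hd; rewrite sp -/p => hr.
have {}hr : (d (v k) p + d p (v (ordS k)) <= d (v k) (v (ordS k)) + 2 * dl)%N.
  rewrite -ltnS -(ltr_nat K); apply: lt_le_trans hr _; rewrite -[X in _ <= X]natr1 natrD natrM; lra.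
move: hr; case: k k0 {tl sj ej j_n hd} => [[|[|[|//]]] hk] //= _; rewrite /v /=.
  by rewrite (wdC c p) (wdC p b) (wdC c b) addnC; right.
by rewrite (wdC b p) (wdC p a) (wdC b a) addnC; left.
Qed.

(** Gromov's four point condition. On a geodesic from a to c take the first vertex
p which is almost between b and c; just before p the geodesic was almost between
a and b, so that p is almost between both pairs. Slimness of the triangle a, c, e
places p almost between a and e or between e and c as well, and adding the two
estimates at p bounds d a c + d b e. *)
Lemma four_point a b c e : (0 < dl)%N ->
  (d a c + d b e <= d a e + d b c + 6 * dl)%N \/
  (d a c + d b e <= d a b + d c e + 6 * dl)%N.
Proof.
move=> dl0; pose P i := gpath w a c i.
(* the first vertex of [a, c] which is close to [b, c] *)
have ex : exists i, (i <= d a c)%N && (d b (P i) + d (P i) c <= d b c + 2 * dl)%N.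
  by exists (d a c); rewrite leqnn /P (gpath_end hw) // wdistxx // addn0 leq_addr.
pose m := ex_minn ex.
have [m1 m2 m3] : [/\ (m <= d a c)%N, (d b (P m) + d (P m) c <= d b c + 2 * dl)%N &
    (d a (P m) + d (P m) b <= d a b + 2 * dl + 2)%N].
  rewrite /m; case: ex_minnP => i /andP[i_n hi] min; split=> //.
  case: i i_n hi min => [|i] i_n hi min.
    by rewrite /P gpath0 wdistxx // add0n -addnA leq_addr.
  have [hL|hR] := slim b (ltnW i_n); last first.
    by have := min i; rewrite (ltnW i_n) hR ltnn => /(_ isT).
  have h1 := gpath_le genS hw a c (leqnSn i); rewrite subSnn in h1.
  have := wdist_tri genS (gpath w a c i) a (P i.+1).
  have := wdist_tri genS (gpath w a c i) (P i.+1) b.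
  rewrite (wdC (P i.+1) (gpath w a c i)) /P; lia.
have t1 := wdist_tri genS (P m) b e.
have dac : (d a (P m) + d (P m) c = d a c)%N.
  by rewrite /P (gpath_dist0 genS hw) // (gpath_dist1 genS hw) // subnKC.
have [h|h] := slim e m1; [left|right]; rewrite -/(P m) in h.
  lia.
by move: h m3; rewrite (wdC e (P m)) (wdC (P m) b) (wdC e c); lia.
Qed.

End CayleyGraph.


(** * The vectors zeta *)

Section Zeta.
Variables (K : realType) (G : groupType) (S : {fset G}) (delta : nat).
Hypothesis hyp : hyperbolic_group K S delta.
Variables (w : G -> seq G) (hw : minimal_words S w).
Variables (C1 : K) (phi1 : G -> G -> {fsfun G -> rat with 0}).
Hypothesis hphi1 : mineyev_map S delta w C1 phi1.
Variables (R : K) (hR : 48 * delta%:R <= R).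
Implicit Types (x y z t : G) (T : set G) (A : {fset G}).

Local Notation d := (wdist S).
Local Notation U := (U_ S R).
Local Notation xi := (xi S R phi1).
Local Notation xi_norm := (xi_norm S R phi1).
Local Notation zeta := (zeta S R phi1).

Let N : nat := Num.truncn R.

Lemma symS : symmetric_set S. Proof. by case: hyp. Qed.
Lemma genS : generating S. Proof. by case: hyp. Qed.
Lemma delta_gt0 : (0 < delta)%N. Proof. by case: hyp. Qed.

Let wdC := wdistC symS genS.

Lemma R_ge0 : 0 <= R.
Proof. by apply: le_trans hR; rewrite mulr_ge0. Qed.

Lemma le_N (n : nat) : (n%:R <= R) = (n <= N)%N.
Proof. by rewrite truncn_ge_nat // R_ge0. Qed.

Lemma N_ge : (48 * delta <= N)%N.
Proof. by rewrite -le_N natrM. Qed.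

Lemma fp (a b c e : G) : (d a c + d b e <= d a e + d b c + 6 * delta)%N \/
  (d a c + d b e <= d a b + d c e + 6 * delta)%N.
Proof.
case: hyp => h1 h2 h3 h4.
exact: (@four_point K G S h1 h2 w hw delta h4).
Qed.

Definition small T := T !=set0 /\ diam_le S R T.

Lemma smallP T a b : small T -> T a -> T b -> (d a b <= N)%N.
Proof. by move=> [_ h] Ta Tb; rewrite -le_N h. Qed.

Lemma inU T y : small T -> U T y <-> (forall a, T a -> (d a y <= N)%N).
Proof.
move=> sT; split=> [h a Ta|h a b].
  by rewrite -le_N; apply: h; [left|right].
case=> [Ta|->]; case=> [Tb|->]; rewrite le_N.
- exact: (smallP sT).
- exact: h.
- by rewrite wdC h.
- by rewrite (wdistxx genS).
Qed.

Lemma notinU T y : small T -> ~ U T y -> exists2 a, T a & (N < d a y)%N.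
Proof.
move=> sT /(contra_not ((inU y sT).2)) /existsNP[a /not_implyP[Ta]].
by move=> /negP; rewrite -ltnNge => h; exists a.
Qed.

Definition adjoin T y : set G := T `|` [set y].

Lemma small_adjoin T y : small T -> U T y -> small (adjoin T y).
Proof. by move=> [[a Ta] _] Uy; split=> //; exists a; left. Qed.

Lemma inU_adjoin T y y' : small T -> U T y ->
  U (adjoin T y) y' <-> U T y' /\ (d y y' <= N)%N.
Proof.
move=> sT Uy; rewrite (inU _ (small_adjoin sT Uy)) (inU _ sT); split.
  by move=> h; split=> [a Ta|]; apply: h; [left|right].
by move=> [h1 h2] a [/h1 //|->].
Qed.

(** A point almost on the geodesic from x to y, at distance 10 delta from y, is
closer to x than y is, by at least 8 delta. *)
Lemma phi_supp x y z : z \in finsupp (phi1 x y) ->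
  ((d x y <= 10 * delta)%N /\ z = x) \/
  [/\ (10 * delta < d x y)%N, d z y = (10 * delta)%N & (d x z + 8 * delta <= d x y)%N].
Proof.
move=> hz; case: (leqP (d x y) (10 * delta)) => hxy; [left|right].
  split=> //; move: hz; rewrite mem_finsupp (mineyev_near hphi1) //.
  by case: (z =P x) => // _; rewrite mulr0n eqxx.
have [h1 h2] := mineyev_supp hphi1 hxy hz.
have := near_pathP symS genS hw h1; split=> //; lia.
Qed.

Lemma phi_ge0 x y z : 0 <= ratr (phi1 x y z) :> K.
Proof. by rewrite ler0q (mineyev_ge0 hphi1). Qed.

Lemma phi_sum x y : \sum_(z <- finsupp (phi1 x y)) ratr (phi1 x y z) = 1 :> K.
Proof. by rewrite -rmorph_sum (mineyev_sum hphi1) rmorph1. Qed.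

Lemma xiE x T y : xi x T y = if y \in U T then
  \sum_(z <- finsupp (phi1 x y) | z \notin U T) ratr (phi1 x y z) else 0.
Proof. by []. Qed.

Lemma xi_ge0 x T y : 0 <= xi x T y.
Proof. by rewrite xiE; case: ifP => // _; apply: sumr_ge0 => z _; exact: phi_ge0. Qed.

Lemma xi_le1 x T y : xi x T y <= 1.
Proof.
rewrite xiE; case: ifP => // _; rewrite -(phi_sum x y) big_mkcond.
by apply: ler_sum => z _; case: ifP => // _; exact: phi_ge0.
Qed.

Lemma xi_neq0 x T y : xi x T y != 0 ->
  U T y /\ exists2 z, z \in finsupp (phi1 x y) & ~ U T z.
Proof.
rewrite xiE; case: ifPn => [|_]; last by rewrite eqxx.
rewrite inE => Uy h; split=> //.
apply: contrapT => h'; move/eqP: h; apply; rewrite big_seq_cond big1 // => z.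
by move=> /andP[hz]; rewrite notin_setE => nz; case: h'; exists z.
Qed.

Lemma xi_neq0I x T y z : U T y -> z \in finsupp (phi1 x y) -> ~ U T z -> xi x T y != 0.
Proof.
move=> Uy hz nz; rewrite xiE mem_set //.
apply/eqP => h; have := @psumr_neq0 K _ (finsupp (phi1 x y)) (fun z => z \notin U T)
  (fun z => ratr (phi1 x y z)).
rewrite h eqxx => /(_ (fun z _ => phi_ge0 x y z))/esym/hasPn/(_ z hz)/negP; apply.
rewrite memNset //=; by rewrite lt_neqAle phi_ge0 andbT eq_sym fmorph_eq0 -mem_finsupp.
Qed.

(** Mass of the measure phi leaves U at some z, which is closer to x than y by
8 delta and more than R away from some t in T. The four point condition for x, z,
y, t puts t almost at distance R behind y, as seen from x. *)
Lemma xi_witness x T y : small T -> xi x T y != 0 ->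
  exists2 t, T t & (d x y + N < d x t + 16 * delta)%N.
Proof.
move=> sT /xi_neq0[Uy [z hz nz]].
have [t Tt tz] := notinU sT nz; exists t => //; have := N_ge.
have yt := (inU y sT).1 Uy t Tt.
have [[h1 h2]|[h1 h2 h3]] := phi_supp hz.
  by move: tz; rewrite h2 (wdC t x); lia.
have := fp x z y t; rewrite (wdC z t) (wdC y t); lia.
Qed.

(** All of U is within R of t, so no vertex of U can be much closer to x than y. *)
Lemma witness_closest x T y t y' : T t -> small T ->
  (d x y + N < d x t + 16 * delta)%N -> U T y' -> (d x y < d x y' + 16 * delta)%N.
Proof.
move=> Tt sT h Uy'; have := wdist_tri genS y' x t.
have := (inU y' sT).1 Uy' t Tt; rewrite (wdC t y'); lia.
Qed.

(** By the four point condition for x, y, t, y', a vertex y' of U is near y, or lies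
behind y as seen from x. *)
Lemma witness_dist x T y t y' : T t -> small T -> U T y ->
  (d x y + N < d x t + 16 * delta)%N -> U T y' ->
  (d y y' < 22 * delta)%N \/ (d y y' + d x y < d x y' + 22 * delta)%N.
Proof.
move=> Tt sT Uy h Uy'.
have h1 := (inU y' sT).1 Uy' t Tt; have h2 := (inU y sT).1 Uy t Tt.
have := fp x y t y'; rewrite (wdC y t); lia.
Qed.

(** Adjoining y removes from U the vertices at distance more than R from y. By
witness_dist such a vertex lies far behind y as seen from x, so that xi
vanishes there by witness_closest, and it is not in the support of the measures phi that matter. *)
Lemma xi_adjoin x T y : small T -> ~ U T x -> xi x T y != 0 ->
  forall y', xi x (adjoin T y) y' = xi x T y'.
Proof.
move=> sT nx hy y'; have [Uy _] := xi_neq0 hy.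
have [t Tt ht] := xi_witness sT hy; have NN := N_ge; have d0 := delta_gt0.
rewrite !xiE; have [Uy'|nUy'] := pselect (U T y'); last first.
  by rewrite !memNset // => /(inU_adjoin y' sT Uy)[].
case: (leqP (d y y') N) => yy'; last first.
  have nU' : ~ U (adjoin T y) y' by move=> /(inU_adjoin y' sT Uy)[_]; rewrite leqNgt yy'.
  rewrite [y' \in U (adjoin T y)]memNset // -xiE; apply/esym/eqP; apply: contraT => hy'.
  have [t' Tt' ht'] := xi_witness sT hy'.
  have := witness_closest Tt' sT ht' Uy; have := witness_dist Tt sT Uy ht Uy'; lia.
have Uy'' : U (adjoin T y) y' by apply/(inU_adjoin y' sT Uy).
rewrite !mem_set //; rewrite big_seq_cond [RHS]big_seq_cond.
apply: eq_bigl => z; case: (boolP (z \in finsupp _)) => //= hz; congr (~~ _).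
apply/idP/idP; rewrite !inE => Uz; first by have [] := (inU_adjoin z sT Uy).1 Uz.
apply/(inU_adjoin z sT Uy); split=> //; rewrite leqNgt; apply/negP => yz.
have [[h1 h2]|[h1 h2 h3]] := phi_supp hz; first by apply: nx; rewrite -h2.
have := witness_dist Tt sT Uy ht Uz.
have := fp x z y' y; rewrite (wdC z y) (wdC y' y); lia.
Qed.

(** The adjoined vertex y does not push mass out of U, because the support of phi is
within 10 delta of y. So the mass that leaves was already outside for T. *)
Lemma xi_adjoin_neq0 x T y : small T -> U T y -> ~ U (adjoin T y) x ->
  xi x (adjoin T y) y != 0 -> ~ U T x /\ xi x T y != 0.
Proof.
move=> sT Uy nx hy; have sT' := small_adjoin sT Uy.
have [Uy' [z hz nz]] := xi_neq0 hy; have NN := N_ge; have d0 := delta_gt0.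
have nUz : ~ U T z.
  have [t [Tt|->] tz] := notinU sT' nz; last first.
    have [[h1 h2]|[h1 h2 h3]] := phi_supp hz.
      by move: tz; rewrite h2 (wdC y x); lia.
    by move: tz; rewrite (wdC y z); lia.
  by move=> /(inU z sT)/(_ t Tt); rewrite leqNgt tz.
have hxi := xi_neq0I Uy hz nUz; split=> // Ux.
have [t Tt ht] := xi_witness sT hxi.
have := (inU x sT).1 Ux t Tt; rewrite (wdC t x) => h.
apply: nx; apply/(inU_adjoin x sT Uy); split=> //; rewrite (wdC y x); lia.
Qed.

Lemma xi_normE x T : xi_norm x T = Num.sqrt (\sum_(y \in [set: G]) xi x T y ^+ 2).
Proof.
rewrite /Defs.xi_norm; congr Num.sqrt; apply: fsbig_widen => // y [_ ny] /=.
by rewrite xiE memNset // expr0n.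
Qed.

Lemma zetaE x T y : zeta x T y =
  if x \in U T then (y == x)%:R else xi x T y / xi_norm x T.
Proof. by []. Qed.

Lemma zeta_neq0 x T y : ~ U T x -> zeta x T y != 0 -> xi x T y != 0.
Proof. by move=> nx; rewrite zetaE memNset //; apply: contraNN => /eqP ->; rewrite mul0r. Qed.

Lemma zeta_adjoin x T y : small T -> U T y ->
  zeta x T y != 0 \/ zeta x (adjoin T y) y != 0 ->
  forall y', zeta x (adjoin T y) y' = zeta x T y'.
Proof.
move=> sT Uy h y'; have sub z : U (adjoin T y) z -> U T z.
  by move=> /(inU_adjoin z sT Uy)[].
have [Ux|nx] := pselect (U T x).
  have [Ux'|nx'] := pselect (U (adjoin T y) x); first by rewrite !zetaE !mem_set.
  exfalso; case: h => [|hz]; last first.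
    by have [] := xi_adjoin_neq0 sT Uy nx' (zeta_neq0 nx' hz).
  rewrite zetaE mem_set //; case: (y =P x) => [yx _|]; last by rewrite eqxx.
  by apply: nx'; apply/(inU_adjoin x sT Uy); rewrite yx (wdistxx genS).
have nx' : ~ U (adjoin T y) x by move/sub.
have hy : xi x T y != 0.
  case: h => hz; first exact: zeta_neq0 hz.
  by have [] := xi_adjoin_neq0 sT Uy nx' (zeta_neq0 nx' hz).
have e := xi_adjoin sT nx hy.
by rewrite !zetaE !memNset // e !xi_normE; under eq_fsbigr do rewrite e.
Qed.

(** The support of phi consists of points closer to x than y, hence outside U. *)
Lemma xi_closest x T y : small T -> ~ U T x -> U T y ->
  (forall y', U T y' -> (d x y <= d x y')%N) -> xi x T y = 1.
Proof.
move=> sT nx Uy min; rewrite xiE mem_set // -(phi_sum x y).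
rewrite big_seq_cond [RHS]big_seq; apply: eq_bigl => z.
case: (boolP (z \in finsupp _)) => //= hz; apply/negP; rewrite inE => Uz.
have d0 := delta_gt0.
have [[h1 h2]|[h1 h2 h3]] := phi_supp hz; first by apply: nx; rewrite -h2.
by have := min z Uz; lia.
Qed.

(** The set U, drawn from a ball around some vertex of A in order to be finite. *)
Definition nb A : {fset G} :=
  if enum_fset A is a :: _ then
    [fset y in gset a (ball S N) | y \in U [set` A]]%fset
  else fset0.

Lemma simplex_small A : simplex S R A <-> small [set` A].
Proof.
split=> -[h1 h2]; split=> //; first by have [a aA] := fset0Pn _ h1; exists a.
by case: h1 => a aA; apply/fset0Pn; exists a.
Qed.

Lemma in_nb A y : simplex S R A -> (y \in nb A) = (y \in U [set` A]).
Proof.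
move=> sA; have sm := (simplex_small A).1 sA.
rewrite /nb; case eA: (enum_fset A) => [|a s].
  by case: sA => /fset0Pn[a]; rewrite -[_ \in A]/(a \in enum_fset A) eA.
have aA : a \in A by rewrite -[_ \in A]/(a \in enum_fset A) eA mem_head.
rewrite !inE /= in_gset; case: (boolP (y \in U [set` A])); rewrite ?andbF // inE => Uy.
rewrite andbT; apply: (mem_ball genS); have := (inU y sm).1 Uy a aA.
by [].
Qed.

Lemma card_nb A : (#|` nb A| <= (1 + #|` S|) ^ N)%N.
Proof.
rewrite /nb; case: (enum_fset A) => [|a s]; first by rewrite cardfs0.
apply: leq_trans (card_ball S N); rewrite -(card_gset a (ball S N)).
by apply/fsubset_leq_card/fsubsetP => y; rewrite !inE /= => /andP[].
Qed.

Lemma adjoin_fset A y : [set` (y |` A)%fset] = adjoin [set` A] y.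
Proof.
apply/seteqP; split=> z /=; rewrite !inE; first by case/orP => [/eqP ->|zA]; [right|left].
by case=> [zA|->]; rewrite ?eqxx //; apply/orP; right.
Qed.

Lemma U_mem A y : simplex S R A -> y \in A -> U [set` A] y.
Proof.
move=> /simplex_small sm yA; apply/(inU _ sm) => a aA; exact: (smallP sm).
Qed.

Lemma U_sub A B y : simplex S R A -> simplex S R B -> {subset A <= B} ->
  U [set` B] y -> U [set` A] y.
Proof.
move=> /simplex_small sA /simplex_small sB sub /(inU _ sB) h.
by apply/(inU _ sA) => a /sub aA; apply: h.
Qed.

Lemma simplexU1 A y : simplex S R A -> U [set` A] y -> simplex S R (y |` A)%fset.
Proof.
move=> /simplex_small sA Uy; apply/simplex_small; rewrite adjoin_fset.
exact: small_adjoin.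
Qed.

Lemma simplex_subset A B : simplex S R A -> B != fset0 -> {subset B <= A} -> simplex S R B.
Proof. by move=> [_ h] B0 sub; split=> // a b /sub aA /sub bA; apply: h. Qed.

Lemma simplex_toggle A y : simplex S R A -> A != [fset y]%fset -> U [set` A] y ->
  simplex S R (toggle y A) /\ U [set` toggle y A] y.
Proof.
move=> sA Ay Uy; rewrite -toggle_eq0 in Ay.
have st : simplex S R (toggle y A).
  move: Ay; rewrite /toggle; case: ifPn => yA A0; last exact: simplexU1.
  by apply: (simplex_subset sA A0) => z; rewrite !inE => /andP[].
split=> //; have [yA|yA] := boolP (y \in A).
  by apply: (U_sub st sA _ Uy) => z; rewrite in_toggle; case: eqP => [->|].
by apply: U_mem => //; rewrite in_toggle eqxx.
Qed.

Lemma zeta_U x A y : zeta x [set` A] y != 0 -> simplex S R A -> U [set` A] y.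
Proof.
rewrite zetaE => h sA; move: h; case: ifPn => Ux.
  by case: (y =P x) => [-> _|_]; [move: Ux; rewrite inE|rewrite eqxx].
rewrite notin_setE in Ux.
have [/xi_neq0[] //|] := boolP (xi x [set` A] y != 0).
by move=> /negPn/eqP ->; rewrite mul0r eqxx.
Qed.

(** Adding a vertex of the support of zeta to the simplex, or removing it, does not
change zeta. This is why the matrix of F is symmetric and why the same unit vector
acts at both steps of the square of F. *)
Lemma zeta_toggle x A y : simplex S R A -> A != [fset y]%fset ->
  zeta x [set` A] y != 0 \/ zeta x [set` toggle y A] y != 0 ->
  forall y', zeta x [set` toggle y A] y' = zeta x [set` A] y'.
Proof.
move=> sA Ay h y'.
have [yA|yA] := boolP (y \in A).
  have Uy := U_mem sA yA; have [st Uy'] := simplex_toggle sA Ay Uy.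
  have e : A = (y |` toggle y A)%fset by rewrite /toggle yA fsetD1K.
  have eT : [set` A] = adjoin [set` toggle y A] y by rewrite -adjoin_fset -e.
  rewrite eT; apply/esym; apply: zeta_adjoin => //; first exact/simplex_small.
  by rewrite -eT; case: h; [right|left].
have Uy : U [set` A] y.
  case: h => [/zeta_U //|]; first exact.
  rewrite /toggle (negPf yA) adjoin_fset => h; apply: contrapT => nU.
  move: h; have Tne : U (adjoin [set` A] y) `<=` U [set` A].
    move=> z Uz a b Ta Tb; apply: Uz.
      by case: Ta => ?; [left; left|right].
    by case: Tb => ?; [left; left|right].
  have nU' : ~ U (adjoin [set` A] y) y by move/Tne.
  rewrite zetaE; case: ifPn => Ux.
    by case: (y =P x) => [yx|_]; [case: nU'; move: Ux; rewrite inE yx|rewrite eqxx].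
  by rewrite xiE memNset // mul0r eqxx.
rewrite /toggle (negPf yA) adjoin_fset; apply: zeta_adjoin => //.
  exact/simplex_small.
by move: h; rewrite /toggle (negPf yA) adjoin_fset.
Qed.

Lemma zeta_sym x A y : simplex S R A -> A != [fset y]%fset ->
  zeta x [set` toggle y A] y = zeta x [set` A] y.
Proof.
move=> sA Ay; have [h1|h1] := eqVneq (zeta x [set` A] y) 0; last first.
  by apply: zeta_toggle => //; left.
have [h2|h2] := eqVneq (zeta x [set` toggle y A] y) 0; first by rewrite h1 h2.
by apply: zeta_toggle => //; right.
Qed.

(** The support of phi x y is within 10 delta of y, so that no mass leaves U for a
one point set. Such a set can have its vertex in the support of zeta only if this
vertex is x. *)
Lemma zeta_single x y : zeta x [set` [fset y]%fset] y != 0 -> x = y.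
Proof.
have sy : simplex S R [fset y]%fset.
  split; first by apply/fset0Pn; exists y; rewrite inE.
  by move=> a b /=; rewrite !inE => /eqP -> /eqP ->; rewrite (wdistxx genS) R_ge0.
have sm := (simplex_small _).1 sy.
have U1 z : (d y z <= N)%N -> U [set` [fset y]%fset] z.
  by move=> h; apply/(inU _ sm) => a /=; rewrite inE => /eqP ->.
have [Ux|nx] := pselect (U [set` [fset y]%fset] x).
  by rewrite zetaE mem_set //; case: (y =P x) => // _; rewrite eqxx.
move/(zeta_neq0 nx)/xi_neq0 => [_ [z hz nz]]; exfalso; have NN := N_ge.
have [[h1 h2]|[h1 h2 h3]] := phi_supp hz.
  by apply: nx; apply: U1; rewrite wdC; lia.
by apply: nz; apply: U1; rewrite wdC h2; lia.
Qed.

Lemma sum_nbE x A (f : G -> K) : simplex S R A -> (forall y, f y != 0 -> U [set` A] y) ->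
  \sum_(y \in [set: G]) f y = \sum_(y <- nb A) f y.
Proof.
move=> sA h; rewrite -(fsbig_widen [set` nb A]) //.
  by rewrite fsbig_finite //= set_fsetK.
move=> y [_ ny] /=; apply/eqP; apply: contraT => /h Uy; exfalso; apply: ny => /=.
by rewrite in_nb // inE.
Qed.

Lemma xi_sqr_neq0 x A y : xi x [set` A] y ^+ 2 != 0 -> U [set` A] y.
Proof. by rewrite sqrf_eq0 => /xi_neq0[]. Qed.

Lemma xi_normE_nb x A : simplex S R A ->
  xi_norm x [set` A] ^+ 2 = \sum_(y <- nb A) xi x [set` A] y ^+ 2.
Proof.
move=> sA; rewrite xi_normE (@sum_nbE x A) //; last by move=> y /xi_sqr_neq0.
by rewrite sqr_sqrtr // sumr_ge0 // => y _; exact: sqr_ge0.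
Qed.

(** At a vertex of U closest to x the value of xi is one. *)
Lemma xi_norm_ge1 x A : simplex S R A -> ~ U [set` A] x -> 1 <= xi_norm x [set` A].
Proof.
move=> sA nx; have sm := (simplex_small _).1 sA.
have ex : exists n, `[< exists2 y, U [set` A] y & d x y = n >].
  by have [[a aA] _] := sm; exists (d x a); apply/asboolP; exists a => //; exact: U_mem.
case: (ex_minnP ex) => n /asboolP[y Uy yn] min.
have h : xi x [set` A] y = 1.
  apply: (xi_closest sm) => // y' Uy'; rewrite yn; apply: min; apply/asboolP.
  by exists y'.
rewrite -(@ler_pXn2r _ 2) ?nnegrE ?sqrtr_ge0 // expr1n xi_normE_nb //.
have ynb : y \in nb A by rewrite in_nb // inE.
rewrite (big_fsetD1 y) //= h expr1n lerDl sumr_ge0 // => z _; exact: sqr_ge0.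
Qed.

Lemma zeta_ge0 x T y : 0 <= zeta x T y.
Proof.
by rewrite zetaE; case: ifP => _; rewrite ?ler0n // divr_ge0 ?xi_ge0 ?sqrtr_ge0.
Qed.

Lemma zeta_norm x A : simplex S R A -> \sum_(y <- nb A) zeta x [set` A] y ^+ 2 = 1.
Proof.
move=> sA; have [Ux|nx] := pselect (U [set` A] x).
  have xnb : x \in nb A by rewrite in_nb // inE.
  rewrite (big_fsetD1 x) //= zetaE mem_set // eqxx expr1n big_seq big1 ?addr0 // => y.
  by rewrite !inE zetaE mem_set // => /andP[/negPf -> _]; rewrite expr0n.
have n1 := xi_norm_ge1 sA nx.
have n0 : xi_norm x [set` A] != 0 by rewrite gt_eqF // (lt_le_trans ltr01).
under eq_bigr do rewrite zetaE memNset // expr_div_n.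
by rewrite -mulr_suml -xi_normE_nb // divff // sqrf_eq0.
Qed.

Lemma zeta_le1 x A y : simplex S R A -> zeta x [set` A] y <= 1.
Proof.
move=> sA; have [->//|h] := eqVneq (zeta x [set` A] y) 0.
have ynb : y \in nb A by rewrite in_nb // inE; exact: zeta_U h sA.
rewrite -(@ler_pXn2r _ 2) ?nnegrE ?zeta_ge0 // expr1n -(zeta_norm x sA).
rewrite (big_fsetD1 y) //= lerDl sumr_ge0 // => z _; exact: sqr_ge0.
Qed.

(** ** Equivariance *)

Lemma simplex_gset g A : simplex S R (gset g A) <-> simplex S R A.
Proof.
rewrite /simplex gset_eq0; split=> -[A0 h]; split=> // a b aA bA.
  have := h (g * a)%g (g * b)%g; rewrite wdist_mul; apply; by rewrite /= in_gset mulKg.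
move: aA bA; rewrite /= !in_gset => aA bA.
by have := h _ _ aA bA; rewrite wdist_mul.
Qed.

Lemma U_gset g A y : simplex S R A ->
  U [set` gset g A] (g * y)%g <-> U [set` A] y.
Proof.
move=> sA; have sm := (simplex_small _).1 sA.
have sm' := (simplex_small _).1 ((simplex_gset g A).2 sA).
rewrite (inU _ sm) (inU _ sm'); split=> h a /= aA.
  by rewrite -(wdist_mul S g); apply: h; rewrite /= in_gset mulKg.
by rewrite -[a](mulVKg g) wdist_mul; apply: h; rewrite /= -in_gset.
Qed.

Lemma finsupp_gset g x y : finsupp (phi1 (g * x)%g (g * y)%g) = gset g (finsupp (phi1 x y)).
Proof.
apply/fsetP => z; rewrite in_gset !mem_finsupp.
by rewrite -(mineyev_equivariant hphi1 g x y) mulVKg.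
Qed.

Lemma xi_gset g x A y : simplex S R A ->
  xi (g * x)%g [set` gset g A] (g * y)%g = xi x [set` A] y.
Proof.
move=> sA; have mU z : ((g * z)%g \in U [set` gset g A]) = (z \in U [set` A]).
  by apply/idP/idP; rewrite !inE => /(U_gset g z sA).
rewrite !xiE mU; case: ifP => // _; rewrite finsupp_gset.
rewrite big_mkcond [RHS]big_mkcond big_imfset /=; last by move=> a b _ _; exact: mulgI.
by apply: eq_bigr => z _; rewrite mU (mineyev_equivariant hphi1).
Qed.

Lemma zeta_gset g x A y : simplex S R A ->
  zeta (g * x)%g [set` gset g A] (g * y)%g = zeta x [set` A] y.
Proof.
move=> sA; have mU z : ((g * z)%g \in U [set` gset g A]) = (z \in U [set` A]).
  by apply/idP/idP; rewrite !inE => /(U_gset g z sA).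
rewrite !zetaE mU (inj_eq (mulgI g)) xi_gset //; case: ifP => // _; congr (_ / _).
rewrite !xi_normE; congr Num.sqrt.
rewrite (@reindex_fsbigT _ _ _ _ _ (fun z => g * z)%g).
  by apply: eq_fsbigr => z _; rewrite xi_gset.
exists (fun z => g^-1 * z)%g => z; [exact: mulKg|exact: mulVKg].
Qed.

(** ** Decay *)

Section Decay.
Variables (lam : K) (lam0 : 0 < lam) (lam1 : lam < 1) (hlam : lambda1 K S delta <= lam).
Variables x x' : G.

(* At a simplex at least this far from x, neither x nor x' is in U, and for y in U
   the exponent in the decay of phi is at least the excess of the distance over m. *)
Let m : nat := (N + d x x' + 10 * delta)%N.

Lemma xi_diff A y : `|xi x [set` A] y - xi x' [set` A] y| <=
  \sum_(z <- (finsupp (phi1 x y) `|` finsupp (phi1 x' y))%fset)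
     `|ratr (phi1 x y z) - ratr (phi1 x' y z) : K|.
Proof.
rewrite !xiE; case: ifP => _; last by rewrite subrr normr0 sumr_ge0.
have ext x0 (F : {fset G}) : (finsupp (phi1 x0 y) `<=` F)%fset ->
   \sum_(z <- finsupp (phi1 x0 y) | z \notin U [set` A]) ratr (phi1 x0 y z) =
   \sum_(z <- F | z \notin U [set` A]) ratr (phi1 x0 y z) :> K.
  move=> /fsubsetP sF; rewrite big_mkcond [RHS]big_mkcond.
  apply: big_fset_incl; first exact/fsubsetP.
  by move=> z _; rewrite mem_finsupp negbK => /eqP ->; rewrite rmorph0 if_same.
rewrite (ext x (finsupp (phi1 x y) `|` finsupp (phi1 x' y))%fset) ?fsubsetUl //.
rewrite (ext x' (finsupp (phi1 x y) `|` finsupp (phi1 x' y))%fset) ?fsubsetUr //.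
rewrite -sumrB; apply: (le_trans (ler_norm_sum _ _ _)).
by rewrite big_mkcond; apply: ler_sum => z _; case: ifP.
Qed.

Lemma xi_decay A y (n : nat) : simplex S R A -> U [set` A] y ->
  (forall a, a \in A -> (n <= d x a)%N) -> (m <= n)%N ->
  `|xi x [set` A] y - xi x' [set` A] y| <= `|C1| * lam ^+ (n - m).
Proof.
move=> sA Uy far mn; apply: le_trans (xi_diff A y) _.
apply: le_trans (mineyev_decay hphi1 x x' y) _.
have sm := (simplex_small _).1 sA; have [[a aA] _] := sm.
have h1 := far a aA; have h2 := (inU _ sm).1 Uy a aA.
have h3 := wdist_tri genS y x a; have h4 := wdist_tri genS x' x y.
have e0 : (n - m)%:R <= gromov K S x x' y - 10 * delta%:R.
  rewrite /gromov natrB // /m (natrD _ (N + d x x')) (natrD _ N) (natrM _ 10).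
  have : (d x y)%:R <= (d x x')%:R + (d x' y)%:R :> K by rewrite -natrD ler_nat.
  have : n%:R <= (d x y)%:R + N%:R :> K.
    by rewrite -natrD ler_nat; move: h3; rewrite (wdC y a); lia.
  lra.
have l1 : 0 <= lambda1 K S delta by exact: powR_ge0.
apply: (@le_trans _ _ (`|C1| * lambda1 K S delta `^ (gromov K S x x' y - 10 * delta%:R))).
  by rewrite ler_wpM2r ?powR_ge0 // ler_norm.
rewrite ler_wpM2l // -powR_mulrn ?(ltW lam0) //.
apply: (@le_trans _ _ (lam `^ (gromov K S x x' y - 10 * delta%:R))).
  by rewrite ge0_ler_powR // ?nnegrE ?(ltW lam0) // (le_trans _ e0).
by rewrite /powR gt_eqF // ler_expR ler_wnM2r // ln_le0 // ltW.
Qed.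

(** The vectors zeta for two base points differ by an exponentially small
amount far away: the norms of the vectors xi are at least one, so
normalization does not spoil the estimate for Mineyev's map. *)
Lemma zeta_decay : exists2 C : K, 0 <= C & forall A y (n : nat), simplex S R A ->
  (forall a, a \in A -> (n <= d x a)%N) ->
  `|zeta x [set` A] y - zeta x' [set` A] y| <= C * lam ^+ n.
Proof.
pose M : K := ((1 + #|` S|) ^ N)%:R.
have M0 : 0 <= M by rewrite ler0n.
have lm0 : lam ^+ m != 0 by rewrite expf_neq0 // gt_eqF.
have lmp : 0 < lam ^+ m by rewrite exprn_gt0.
exists ((1 + (1 + M) * `|C1|) / lam ^+ m) => [|A y n sA far].
  by rewrite divr_ge0 ?(ltW lmp) // addr_ge0 // mulr_ge0 // addr_ge0.
have [nm|mn] := ltnP n m.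
  apply: (@le_trans _ _ 1).
    have := zeta_ge0 x [set` A] y; have := zeta_ge0 x' [set` A] y.
    have := zeta_le1 x y sA; have := zeta_le1 x' y sA => *.
    by rewrite ler_norml; apply/andP; split; lra.
  rewrite mulrAC ler_pdivlMr // mul1r.
  apply: (@le_trans _ _ (lam ^+ n)).
    by rewrite ler_wiXn2l ?(ltW lam0) ?(ltW lam1) // ltnW.
  by rewrite ler_peMl ?exprn_ge0 ?(ltW lam0) // lerDl mulr_ge0 // addr_ge0.
have -> : (1 + (1 + M) * `|C1|) / lam ^+ m * lam ^+ n = (1 + (1 + M) * `|C1|) * lam ^+ (n - m).
  by rewrite -{1}(subnK mn) exprD; field.
have [Uy|nUy] := pselect (U [set` A] y); last first.
  have z0 x0 : zeta x0 [set` A] y = 0.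
    by apply/eqP; apply: contraT => /zeta_U/(_ sA).
  by rewrite !z0 subrr normr0 mulr_ge0 ?exprn_ge0 ?(ltW lam0) // addr_ge0 // mulr_ge0 // addr_ge0.
have sm := (simplex_small _).1 sA; have d0 := delta_gt0.
have nx : ~ U [set` A] x.
  move=> /(inU _ sm) h; have [[a aA] _] := sm; have := far a aA.
  by have := h a aA; rewrite wdC; move: mn; rewrite /m; lia.
have nx' : ~ U [set` A] x'.
  move=> /(inU _ sm) h; have [[a aA] _] := sm; have := far a aA.
  have := wdist_tri genS x' x a.
  by have := h a aA; rewrite wdC; move: mn; rewrite /m; lia.
set e := `|C1| * lam ^+ (n - m).
have e0 : 0 <= e by rewrite mulr_ge0 // exprn_ge0 ?(ltW lam0).
have dif z : U [set` A] z -> `|xi x [set` A] z - xi x' [set` A] z| <= e.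
  by move=> Uz; apply: xi_decay.
have v1 := xi_norm_ge1 sA nx; have v1' := xi_norm_ge1 sA nx'.
set v := xi_norm x [set` A] in v1; set v' := xi_norm x' [set` A] in v1'.
have dv : `|v ^+ 2 - v' ^+ 2| <= 2 * (M * e).
  rewrite !xi_normE_nb // -sumrB; apply: (le_trans (ler_norm_sum _ _ _)).
  apply: (@le_trans _ _ (\sum_(z <- nb A) (2 * e))).
    rewrite big_seq [leRHS]big_seq; apply: ler_sum => z; rewrite in_nb // inE => Uz.
    rewrite subr_sqr normrM mulrC ler_pM //; last exact: dif.
    have := xi_ge0 x [set` A] z; have := xi_ge0 x' [set` A] z.
    have := xi_le1 x [set` A] z; have := xi_le1 x' [set` A] z => *.
    by rewrite ger0_norm; lra.
  rewrite big_const_seq count_predT iter_addr_0 -[leLHS]mulr_natr -mulrA ler_wpM2l //.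
  by rewrite mulrC ler_wpM2r // ler_nat card_nb.
have dvv : `|v - v'| <= M * e.
  have s0 : 0 < v + v' by lra.
  rewrite -(ler_pM2r s0) -[X in `|_| * X](ger0_norm (ltW s0)) -normrM -subr_sqr.
  apply: le_trans dv _; rewrite [leRHS]mulrC; apply: ler_wpM2r; [exact: mulr_ge0|lra].
rewrite !zetaE !memNset // -/v -/v'.
set a := xi x _ y; set b := xi x' _ y.
have -> : a / v - b / v' = (a - b) / v + (b / v') * ((v' - v) / v).
  by field; rewrite !gt_eqF //; lra.
have vp : 0 < v by lra.
have bv : 0 <= b / v' <= 1.
  rewrite divr_ge0 ?xi_ge0 //=; last by lra.
  rewrite ler_pdivrMr ?mul1r; [|lra]; apply: le_trans v1'; exact: xi_le1.
have q (c : K) : `|c / v| <= `|c|.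
  rewrite normrM normfV (ger0_norm (ltW vp)) ler_pdivrMr // ler_peMr //.
have := dif y Uy; rewrite -/a -/b => dab.
apply: (@le_trans _ _ (e + M * e)).
  apply: (le_trans (ler_normD _ _)); apply: lerD; first exact: le_trans (q _) dab.
  rewrite normrM -[leRHS]mul1r ler_pM //; first by rewrite ger0_norm; case/andP: bv.
  by apply: le_trans (q _) _; rewrite distrC.
rewrite -[e in e + _]mul1r -mulrDl /e mulrA ler_wpM2r ?exprn_ge0 ?(ltW lam0) //.
by rewrite lerDr.
Qed.

End Decay.
End Zeta.

(** * Adjoints of bounded operators on square summable functions *)

Section Riesz.
Variables (K : realType) (I : choiceType).
Local Notation C := K[i].
Local Notation E := (ell2_space K I).
Local Notation hE := (@ell2_hilbert K I).
Local Notation rin u v := (complex.Re (inner u v)).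
Implicit Types (u v f g : E) (T : E -> E).

(** The only candidate for the adjoint: its coordinates have to be these. *)
Definition riesz T v : E := to_ell2 (fun i => inner v (T (dvec K i))).

Lemma sqr_le_cauchy (q c : K) : 0 <= q -> 0 <= c -> q <= c * Num.sqrt q -> q <= c ^+ 2.
Proof.
move=> q0 c0 h; have s0 := sqrtr_ge0 q; set s := Num.sqrt q in h s0.
have e : q = s ^+ 2 by rewrite sqr_sqrtr.
rewrite e in h *; have [s00|sn0] := eqVneq s 0; first by rewrite s00 expr0n sqr_ge0.
have sp : 0 < s by rewrite lt_neqAle eq_sym sn0.
by rewrite ler_pXn2r ?nnegrE //; move: h; rewrite expr2 ler_pM2r.
Qed.

(** If u has the coordinates (v, T e_i) for i in s, then the sum q in question is
(v, T u), so that q <= M |v| sqrt q. *)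
Lemma riesz_sum T v (M : K) (s : seq I) : linear T -> 0 <= M ->
  (forall u, hnorm (T u) <= M * hnorm u) -> uniq s ->
  \sum_(i <- s) csq (inner v (T (dvec K i))) <= (M * hnorm v) ^+ 2.
Proof.
move=> lT M0 hM us; set c := fun i => inner v (T (dvec K i)).
pose u : E := \sum_(i <- s) c i *: dvec K i; set q := \sum_(i <- s) _.
have q0 : 0 <= q by apply: sumr_ge0 => i _; exact: csq_ge0.
have nu : hnorm u = Num.sqrt q.
  rewrite ell2_hnorm; congr Num.sqrt; rewrite /nsq /tsum.
  rewrite (_ : (\esum_(i in _) _)%E = (\esum_(i in [set` s]) (csq (c i))%:E)%E).
    rewrite esum_fset; [|exact: finite_seq|by move=> i _; rewrite lee_fin csq_ge0].
    by rewrite -fsbig_seq // sumEFin.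
  rewrite [RHS]esum_mkcond; apply: eq_esum => i _; rewrite sum_dvecE //.
  by rewrite mem_setE; case: ifP; rewrite // csq0.
apply: sqr_le_cauchy; rewrite ?mulr_ge0 ?hnorm_ge0 //.
have eq : q = rin v (T u).
  rewrite /u (linsum _ _ _ lT).
  have -> : inner v (\sum_(i <- s) T (c i *: dvec K i)) = (q%:C)%C.
    rewrite /q; elim: (s) => [|i r IHr]; first by rewrite !big_nil inner0r //; exact: hE.
    rewrite !big_cons innerDr ?IHr ?linZ ?innerZr //; try exact: hE.
    rewrite -/(c i) rmorphD /=; congr (_ + _).
    by case: (c i) => a b; rewrite -[Num.conj _]/(conjc _) /csq /=; congr Complex; ring.
  by [].
rewrite -nu {1}eq (le_trans (rin_le hE _ _)) // mulrAC [M * _]mulrC mulrC [leRHS]mulrC.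
by rewrite ler_wpM2l ?hnorm_ge0.
Qed.

Lemma rieszE T v : bounded_op T -> riesz T v = (fun i => inner v (T (dvec K i))) :> (I -> C).
Proof.
move=> bT; have [M M0 hM] := bounded_op_bound bT; have [lT _] := bT.
apply: to_ell2E; rewrite /sqsum; apply: (@le_lt_trans _ _ ((M * hnorm v) ^+ 2)%:E); last exact: ltry.
by apply: tsum_lim => s us; rewrite lee_fin riesz_sum.
Qed.

Lemma riesz_bounded T : bounded_op T -> bounded_op (riesz T).
Proof.
move=> bT; have [M M0 hM] := bounded_op_bound bT; have [lT _] := bT.
apply: (@bounded_opP _ _ _ M) => [a u v|v].
  apply: ell2_ext => i; rewrite ell2E !rieszE //; exact: (innerDZl hE).
apply: ell2_hnorm_le; first by rewrite mulr_ge0 ?hnorm_ge0.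
by apply: tsum_lim => s us; rewrite lee_fin rieszE // riesz_sum.
Qed.

(** The identity holds for finite combinations of basis vectors and extends by
density. Real parts suffice, since v can be multiplied by the imaginary unit. *)
Lemma riesz_adjoint T : bounded_op T -> is_adjoint T (riesz T).
Proof.
move=> bT; have [M M0 hM] := bounded_op_bound bT; have [lT _] := bT.
have [M' M'0 hM'] := bounded_op_bound (riesz_bounded bT).
have basis (s : seq I) (c : I -> C) v :
    inner (T (\sum_(i <- s) c i *: dvec K i)) v = inner (\sum_(i <- s) c i *: dvec K i : E) (riesz T v).
  elim: s => [|i r IHr]; first by rewrite big_nil lin0 // !(inner0l hE).
  rewrite big_cons lT !(innerDZl hE) IHr; congr (_ * _ + _).
  by rewrite (innerC hE) -[X in Num.conj X]/(_) (innerC hE (riesz T v)) inner_dvec rieszE.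
have re u v : rin (T u) v <= rin u (riesz T v).
  rewrite -subr_le0; move: u; apply: (dense_le0
    (phi := fun u => rin (T u) v - rin u (riesz T v)) (B := M * hnorm v + M' * hnorm v)).
    move=> u; rewrite mulrDl; apply: lerD.
      by apply: le_trans (rin_le hE _ _) _; rewrite mulrAC ler_wpM2r ?hnorm_ge0.
    have -> : - rin u (riesz T v) = rin u (- riesz T v).
      by rewrite -[- riesz T v]scaleN1r (innerZr hE) rmorphN rmorph1 mulN1r raddfN.
    apply: le_trans (rin_le hE _ _) _; rewrite (hnormN hE) mulrC.
    by rewrite ler_wpM2r ?hnorm_ge0.
  move=> u s c; set g : E := \sum_(j <- s) _.
  have sub (a b z : E) : inner (a - b) z = inner a z - inner b z.
    by rewrite (innerDl hE) -scaleN1r (innerZl hE) mulN1r.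
  have bg : inner (T g) v = inner g (riesz T v) by exact: basis.
  rewrite (linB _ _ lT) (sub (T u)) (sub u) bg !raddfB /=; lra.
have reE u v : rin (T u) v = rin u (riesz T v).
  apply/eqP; rewrite eq_le re /= -lerN2.
  have N (a b : E) : - rin a b = rin (- a) b.
    by rewrite -[- a]scaleN1r (innerZl hE) mulN1r raddfN.
  by rewrite !N -(scaleN1r (T u)) -linZ // scaleN1r re.
move=> u v; have lR := (riesz_bounded bT).1.
apply: (@inner_rinP _ _ hE (T u, v) (u, riesz T v)); first exact: reE.
by have := reE u ('i%C *: v); rewrite (linZ _ _ lR).
Qed.

(** Both candidates for the adjoint take the same values on basis vectors. *)
Lemma is_adjoint_dvec T T' : bounded_op T -> bounded_op T' ->
  (forall i j, (T (dvec K i)) j = Num.conj ((T' (dvec K j)) i)) -> is_adjoint T T'.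
Proof.
move=> bT bT' h; suff <- : riesz T = T' by exact: riesz_adjoint.
have bR := riesz_bounded bT.
apply: (bounded_op_dvec hE); [exact: bR.1|exact: bT'.1|exact: bR.2|exact: bT'.2|].
move=> j; apply: ell2_ext => i; rewrite rieszE // (innerC hE) inner_dvec h.
by rewrite conjCK.
Qed.

End Riesz.


(** * Operators which toggle vertices *)

Lemma sum_supp (V : nmodType) (T : choiceType) (s t : {fset T}) (F : T -> V) :
  (forall y, F y != 0 -> (y \in s) = (y \in t)) ->
  \sum_(y <- enum_fset s) F y = \sum_(y <- enum_fset t) F y.
Proof.
move=> h; have nz (r : {fset T}) : \sum_(y <- enum_fset r) F y =
    \sum_(y <- [seq y <- enum_fset r | F y != 0]) F y.
  by rewrite big_filter [RHS]big_mkcond; apply: eq_bigr => y _; case: (F y =P 0).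
rewrite nz [RHS]nz; apply: perm_big; apply: uniq_perm; rewrite ?filter_uniq ?fset_uniq //.
move=> y; rewrite !mem_filter; case: (boolP (F y != 0)) => //= /h; exact.
Qed.


Section ToggleOperators.
Variables (K : realType) (G : groupType).
Local Notation C := K[i].
Local Notation E := (Lambda K G).
Local Notation hE := (@ell2_hilbert K {fset G}).
Implicit Types (f g : E) (A B : {fset G}) (y : G).

Lemma sqr_sum_le (J : Type) (r : seq J) (a : J -> K) :
  (\sum_(j <- r) a j) ^+ 2 <= (size r)%:R * \sum_(j <- r) a j ^+ 2.
Proof.
elim: r => [|j r IHr]; first by rewrite !big_nil expr0n mulr0.
rewrite !big_cons /= -natr1; set n : K := (size r)%:R; rewrite -/n in IHr.
set s := \sum_(i <- r) a i in IHr *; set q := \sum_(i <- r) a i ^+ 2 in IHr *.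
have n0 : 0 <= n by rewrite ler0n.
have [n00|nn0] := eqVneq n 0.
  have -> : s = 0 by apply/eqP; rewrite -sqrf_eq0 eq_le sqr_ge0 andbT (le_trans IHr) // n00 mul0r.
  rewrite n00 addr0 add0r mul1r lerDl /q; apply: sumr_ge0 => i _; exact: sqr_ge0.
have np : 0 < n by rewrite lt_neqAle eq_sym nn0.
rewrite -subr_ge0 -(pmulr_rge0 _ np).
have -> : n * ((n + 1) * (a j ^+ 2 + q) - (a j + s) ^+ 2) =
   (n * a j - s) ^+ 2 + (n + 1) * (n * q - s ^+ 2) by ring.
by rewrite addr_ge0 ?sqr_ge0 // mulr_ge0 ?subr_ge0 // addr_ge0.
Qed.

Lemma csq_sum_le (J : Type) (r : seq J) (a : J -> C) :
  csq (\sum_(j <- r) a j) <= (size r)%:R * \sum_(j <- r) csq (a j).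
Proof.
rewrite /csq !raddf_sum /= big_split /= mulrDr; apply: lerD; exact: sqr_sum_le.
Qed.

Variables (L : {fset G} -> {fset G}) (M : nat).
Hypothesis cardL : forall A, (#|` L A| <= M)%N.
Hypothesis symL : forall A y, (y \in L (toggle y A)) = (y \in L A).

Definition tog (a : {fset G} -> G -> C) (f : {fset G} -> C) : {fset G} -> C :=
  fun A => \sum_(y <- enum_fset (L A)) a A y * f (toggle y A).

(** A row has at most M entries, so that Cauchy-Schwarz costs a factor M; a given
coordinate of f occurs in at most M rows, which costs another one. A bound on the
entries is required only where f does not vanish, in order to profit from vectors f
which are supported far away. *)
Lemma tog_nsq (a : {fset G} -> G -> C) (f : E) (e : K) : 0 <= e ->
  (forall A y, y \in L A -> f (toggle y A) != 0 -> csq (a A y) <= e) ->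
  (nsq (tog a f) <= (M%:R * e * M%:R)%:E * nsq f)%E.
Proof.
move=> e0 ha; have M0 : 0 <= M%:R :> K by rewrite ler0n.
have cf0 A : 0 <= csq (f A) by exact: csq_ge0.
have s0 A (F : {fset G} -> G -> K) : (forall y, 0 <= F A y) ->
    0 <= \sum_(y <- enum_fset (L A)) F A y by move=> h; apply: sumr_ge0.
apply: (@le_trans _ _ (tsum (fun A => (M%:R * e) * \sum_(y <- enum_fset (L A)) csq (f (toggle y A)))%R)).
  apply: le_tsum => A; apply: le_trans (csq_sum_le _ _) _.
  rewrite -mulrA; apply: ler_pM => //; first by apply: sumr_ge0 => y _; exact: csq_ge0.
    by rewrite ler_nat cardL.
  rewrite mulr_sumr big_seq [leRHS]big_seq; apply: ler_sum => y yL; rewrite csqM.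
  have [->|f0] := eqVneq (f (toggle y A)) 0; first by rewrite csq0 !mulr0.
  by rewrite ler_wpM2r // ha.
rewrite tsumZ ?mulr_ge0 //; last first.
  by move=> A; apply: sumr_ge0 => y _; exact: csq_ge0.
rewrite [X in (_ <= X * _)%E]EFinM -muleA; apply: lee_wpmul2l; first by rewrite lee_fin mulr_ge0.
have fub (F : {fset G} -> G -> K) : (forall A y, 0 <= F A y) ->
   tsum (fun A => \sum_(y <- enum_fset (L A)) F A y)%R =
   (\esum_(k in [set: {fset G}] `*`` (fun A => [set` L A])) (F k.1 k.2)%:E)%E.
  move=> F0; rewrite -(@esum_esum _ _ _ setT (fun A => [set` L A]) (fun A y => (F A y)%:E)); last first.
    by move=> *; rewrite lee_fin.
  apply: eq_esum => A _; rewrite esum_fset; [|exact: finite_fset|by move=> *; rewrite lee_fin].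
  by rewrite fsbig_finite ?set_fsetK ?sumEFin //; exact: finite_fset.
rewrite (fub (fun A y => csq (f (toggle y A)))) // .
pose h (k : {fset G} * G) := (toggle k.2 k.1, k.2).
have -> : (\esum_(k in [set: {fset G}] `*`` (fun A => [set` L A])) (csq (f (toggle k.2 k.1)))%:E =
   \esum_(k in [set: {fset G}] `*`` (fun A => [set` L A])) (csq (f k.1))%:E)%E.
  apply/esym; rewrite (@reindex_esum _ _ _ ([set: {fset G}] `*`` (fun A => [set` L A])) _ h) //.
  split=> [[A y] /= [_ yL]|[A y] [B z] _ _ /= [e1 e2]|[A y] /= [_ yL]].
  - by split=> //; rewrite symL.
  - by rewrite e2 in e1 *; rewrite -(toggleK z A) e1 toggleK.
  - by exists (toggle y A, y); rewrite /h /= ?toggleK // symL.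
rewrite -(fub (fun A y => csq (f A))) //.
rewrite /nsq -tsumZ //; apply: le_tsum => A.
rewrite big_const_seq count_predT iter_addr_0 -[leLHS]mulr_natl.
by rewrite ler_wpM2r // ler_nat cardL.
Qed.

Section Bounded.
Variables (a : {fset G} -> G -> C) (e : K).
Hypothesis (e0 : 0 <= e) (ha : forall A y, y \in L A -> csq (a A y) <= e).

Definition Tog (f : E) : E := to_ell2 (tog a f).

Lemma TogE f : Tog f = tog a f :> ({fset G} -> C).
Proof.
apply: to_ell2E; rewrite /sqsum -/(tsum _) -/(nsq _).
apply: le_lt_trans (@tog_nsq a f e e0 _) _; first by move=> A y yL _; exact: ha.
by rewrite ell2_nsq -EFinM ltry.
Qed.

Lemma Tog_linear : linear Tog.
Proof.
move=> c f g; apply: ell2_ext => A; rewrite ell2E !TogE /tog mulr_sumr -big_split /=.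
apply: eq_bigr => y _.
transitivity (a A y * (c * f (toggle y A) + g (toggle y A))); [by []|by ring].
Qed.

Lemma Tog_le f (e' : K) : 0 <= e' ->
  (forall A y, y \in L A -> f (toggle y A) != 0 -> csq (a A y) <= e' ^+ 2) ->
  hnorm (Tog f) <= M%:R * e' * hnorm f.
Proof.
move=> e'0 h; apply: ell2_hnorm_le; first by rewrite !mulr_ge0 ?hnorm_ge0.
rewrite TogE; apply: le_trans (@tog_nsq a f (e' ^+ 2) _ h) _; first exact: sqr_ge0.
rewrite ell2_nsq -EFinM lee_fin le_eqVlt; apply/orP; left; apply/eqP; ring.
Qed.

Lemma Tog_bounded : bounded_op Tog.
Proof.
apply: (@bounded_opP _ _ _ (M%:R * Num.sqrt e)); first exact: Tog_linear.
move=> f; apply: Tog_le; first exact: sqrtr_ge0.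
by move=> A y yL _; rewrite sqr_sqrtr // ha.
Qed.

Lemma Tog_dvec A B : Tog (dvec K A) B =
  \sum_(y <- enum_fset (L B)) a B y * (toggle y B == A)%:R.
Proof. by rewrite TogE /tog; apply: eq_bigr => y _; rewrite dvecE. Qed.

End Bounded.

Lemma Tog_adjoint (a b : {fset G} -> G -> C) (e : K) : 0 <= e ->
  (forall A y, y \in L A -> csq (a A y) <= e) ->
  (forall A y, y \in L A -> csq (b A y) <= e) ->
  (forall A y, y \in L A -> b (toggle y A) y = Num.conj (a A y)) ->
  is_adjoint (Tog a) (Tog b).
Proof.
move=> e0 ha hb hab; apply: is_adjoint_dvec; [exact: Tog_bounded ha|exact: Tog_bounded hb|].
move=> A B; have e1 := Tog_dvec e0 ha A B; have e2 := Tog_dvec e0 hb B A.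
transitivity (\sum_(y <- enum_fset (L B)) a B y * (toggle y B == A)%:R); first exact: e1.
transitivity (Num.conj (\sum_(y <- enum_fset (L A)) b A y * (toggle y A == B)%:R)); last first.
  by congr (Num.conj _).
rewrite rmorph_sum.
transitivity (\sum_(y <- enum_fset (L B)) Num.conj (b A y * (toggle y A == B)%:R)).
  rewrite big_seq [RHS]big_seq; apply: eq_bigr => y yL; rewrite rmorphM /= rmorph_nat.
  have -> : (toggle y B == A) = (toggle y A == B) by apply/eqP/eqP => <-; rewrite toggleK.
  case: eqP => [tA|_]; last by rewrite !mulr0.
  by rewrite !mulr1 -[A in RHS](toggleK y) tA hab // conjCK.
apply: sum_supp => y; case: (toggle y A =P B) => [<- _|_]; first exact: symL.
by rewrite mulr0 rmorph0 eqxx.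
Qed.

End ToggleOperators.

(** ** Exterior multiplication *)

Section Clifford.
Variables (K : realType) (G : groupType).
Local Notation C := K[i].
Local Notation E := (Lambda K G).
Implicit Types (f g : E) (A B : {fset G}) (y : G).

Lemma conj_sigma y A : Num.conj (sigma K y A) = sigma K y A.
Proof.
have /eqP := sigma_sqr K y A; rewrite -expr2 sqrf_eq1 => /orP[] /eqP ->.
  by rewrite rmorph1.
by rewrite rmorphN rmorph1.
Qed.

Lemma csq_sigma y A : csq (sigma K y A) = 1.
Proof. exact/csq_sign/sigma_sqr. Qed.

Variables (v : G -> C) (s : {fset G}).
Hypothesis vs : forall y, v y != 0 -> y \in s.

Let L (A : {fset G}) := s.
Let cardL A : (#|` L A| <= #|` s|)%N. Proof. by []. Qed.
Let symL A y : (y \in L (toggle y A)) = (y \in L A). Proof. by []. Qed.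

Let a A y : C := (y \in A)%:R * (v y * sigma K y A).
Let b A y : C := (y \notin A)%:R * (Num.conj (v y) * sigma K y A).
Let e : K := \sum_(y <- enum_fset s) csq (v y).

Let e0 : 0 <= e. Proof. by apply: sumr_ge0 => y _; exact: csq_ge0. Qed.

Let ve A y : y \in L A -> csq (v y) <= e.
Proof.
move=> yL; rewrite /e (big_fsetD1 y) //= lerDl; apply: sumr_ge0 => z _; exact: csq_ge0.
Qed.

Lemma csq_conj (z : C) : csq (Num.conj z) = csq z.
Proof. by case: z => p q; rewrite /csq /= sqrrN. Qed.

Let ha A y : y \in L A -> csq (a A y) <= e.
Proof.
move=> yL; rewrite /a; case: (y \in A); rewrite ?mul0r ?csq0 // mul1r csqM csq_sigma mulr1.
exact: ve yL.
Qed.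

Let hb A y : y \in L A -> csq (b A y) <= e.
Proof.
move=> yL; rewrite /b; case: (y \in A); rewrite ?mul0r ?csq0 // mul1r csqM csq_sigma mulr1 csq_conj.
exact: ve yL.
Qed.

Lemma mu_Tog f : mu v f = Tog L a f.
Proof.
apply: ell2_ext => A; rewrite (TogE cardL symL e0 ha) /tog.
rewrite (muE f (s := enum_fset s)); last exact: vs.
transitivity (\sum_(y <- enum_fset A) a A y * f (toggle y A)).
  rewrite big_seq [RHS]big_seq; apply: eq_bigr => y.
  rewrite -[_ \in enum_fset A]/(y \in A) => yA; rewrite /a yA mul1r /toggle yA.
  rewrite /sigma; congr (_ * wedge_coef _ _ _ * _).
  by apply/fsetP => z; rewrite !inE; case: eqP => // ->.
apply: sum_supp => y; rewrite /a; case: (y \in A); last by rewrite !mul0r eqxx.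
by have [->|/vs ->] := eqVneq (v y) 0; rewrite // !(mul0r, mulr0) eqxx.
Qed.

(** The entries b are those of contraction by v. *)
Lemma mu_adjoint : adjoint (mu v) = Tog L b.
Proof.
apply: (adjointE (@ell2_hilbert K {fset G})).
rewrite (_ : mu v = Tog L a); last by apply/funext => f; exact: mu_Tog.
apply: (@Tog_adjoint K G L #|` s| cardL symL a b e) => // A y yL.
rewrite /a /b in_toggle eqxx negbK !rmorphM /= conj_sigma sigma_toggle.
by case: (y \in A); rewrite ?rmorph0 ?rmorph1.
Qed.

Lemma clE f A : (forall y, Num.conj (v y) = v y) ->
  cl v f A = \sum_(y <- enum_fset s) v y * sigma K y A * f (toggle y A).
Proof.
move=> vr; rewrite /cl ell2DE mu_adjoint mu_Tog.
rewrite (TogE cardL symL e0 ha) (TogE cardL symL e0 hb) /tog -big_split /=.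
apply: eq_bigr => y _; rewrite /a /b vr.
by case: (y \in A); rewrite !(mul0r, mul1r, addr0, add0r).
Qed.

End Clifford.


(** * The Hilbert space of the Rips complex *)

Section RipsSpace.
Variables (K : realType) (G : groupType) (S : {fset G}) (R : K).
Local Notation C := K[i].
Local Notation E := (Lambda K G).
Local Notation hE := (@ell2_hilbert K {fset G}).
Local Notation H := (H_R S R).
Local Notation smp := (simplex S R).
Implicit Types (f g : H) (A B : {fset G}).

Lemma rips_valE (c : C) f g A : rips_val (c *: f + g) A = c * rips_val f A + rips_val g A.
Proof. by []. Qed.

Lemma rips_valB f g A : rips_val (f - g) A = rips_val f A - rips_val g A.
Proof. by []. Qed.

Lemma rips_valZ (c : C) f A : rips_val (c *: f) A = c * rips_val f A.
Proof. by []. Qed.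

Lemma rips_off f A : ~ smp A -> rips_val f A = 0.
Proof. by move=> nA; have /asboolP := valP f; apply. Qed.

Lemma rips_set0 f : rips_val f fset0 = 0.
Proof. by apply: rips_off => -[]; rewrite eqxx. Qed.

Lemma rips_ext f g : (forall A, smp A -> rips_val f A = rips_val g A) -> f = g.
Proof.
move=> h; apply: val_inj; apply: ell2_ext => A.
by have [/h //|nA] := pselect (smp A); rewrite !rips_off.
Qed.

Definition rmk (f : E) : H := insubd (0 : rips S R) f.

Lemma rmkE (f : E) : (forall A, ~ smp A -> f A = 0) -> rips_val (rmk f) = f.
Proof. by move=> h; rewrite insubdK //; apply/asboolP. Qed.

Lemma rips_hnorm f : hnorm f = hnorm (rips_val f). Proof. by []. Qed.
Lemma rips_innerE f g : inner f g = inner (rips_val f) (rips_val g). Proof. by []. Qed.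

(** Coordinates are continuous, so that vanishing off the simplices passes to
limits. *)
Lemma rips_hilbert : is_hilbert H.
Proof.
split=> [c u v w|u v|u u0|u cu].
- exact: (inner_linear hE c (rips_val u) (rips_val v) (rips_val w)).
- exact: (inner_conj hE (rips_val u) (rips_val v)).
- apply: (inner_gt0 hE (u := rips_val u)); apply: contra u0 => /eqP h.
  by apply/eqP/val_inj.
have [v hv] := inner_complete hE (u := fun n => rips_val (u n)) cu.
have vE : rips_val (rmk v) = v.
  apply: rmkE => A nA; apply/csqB_eq0/eqP; rewrite eq_le csq_ge0 andbT leNgt.
  apply/negP => p0; have e0 : 0 < Num.sqrt (csq (v A)) by rewrite sqrtr_gt0.
  have [N /(_ N (leqnn N)) hN] := (hcvgP _ _).1 hv _ e0.
  have := csq_le_hnorm (rips_val (u N) - v) A.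
  rewrite ell2BE rips_off // sub0r csqN leNgt => /negP; apply.
  by rewrite -[ltRHS]sqr_sqrtr ?csq_ge0 // ltr_pXn2r ?nnegrE ?sqrtr_ge0.
by exists (rmk v); move: hv; rewrite -{1}vE.
Qed.

Local Notation hH := rips_hilbert.

Definition bvec A : H := rmk (dvec K A).

Lemma bvecE A B : smp A -> rips_val (bvec A) B = (B == A)%:R.
Proof.
move=> sA; rewrite /bvec rmkE ?dvecE // => D nD; rewrite dvecE.
by case: eqP => // e; case: nD; rewrite e.
Qed.

Lemma csq_rips_le f A : csq (rips_val f A) <= hnorm f ^+ 2.
Proof. exact: (csq_le_hnorm (rips_val f) A). Qed.

End RipsSpace.

(** * The operator F *)

Section OperatorF.
Variables (K : realType) (G : groupType) (S : {fset G}) (delta : nat).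
Hypothesis hyp : hyperbolic_group K S delta.
Variables (w : G -> seq G) (hw : minimal_words S w).
Variables (C1 : K) (phi1 : G -> G -> {fsfun G -> rat with 0}).
Hypothesis hphi1 : mineyev_map S delta w C1 phi1.
Variables (R : K) (hR : 48 * delta%:R <= R).
Local Notation C := K[i].
Local Notation E := (Lambda K G).
Local Notation hE := (@ell2_hilbert K {fset G}).
Local Notation H := (H_R S R).
Local Notation hH := (@rips_hilbert K G S R).
Local Notation smp := (simplex S R).
Local Notation U := (U_ S R).
Local Notation zeta := (zeta S R phi1).
Local Notation nb := (nb S R).
Implicit Types (f g : H) (A B : {fset G}) (x y z : G).

Local Notation M := ((1 + #|` S|) ^ Num.truncn R)%N.

(** The vertex of a one point simplex is left out, because toggling it would lead to
the empty simplex, in the discarded degree. *)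
Definition nbe A : {fset G} :=
  if `[< smp A >] then [fset y in nb A | A != [fset y]%fset]%fset else fset0.

Lemma in_nbe A y : y \in nbe A <-> [/\ smp A, U [set` A] y & A != [fset y]%fset].
Proof.
rewrite /nbe; case: asboolP => sA; last by split=> // -[].
rewrite !inE /=; split=> [/andP[yA Ay]|[_ Uy Ay]].
  by split=> //; move: yA; rewrite (in_nb hyp hR) // inE.
by rewrite Ay andbT (in_nb hyp hR) // inE.
Qed.

Lemma card_nbe A : (#|` nbe A| <= M)%N.
Proof.
rewrite /nbe; case: asboolP => _; last by rewrite cardfs0.
apply: leq_trans (card_nb S R A).
by apply/fsubset_leq_card/fsubsetP => y; rewrite !inE /= => /andP[].
Qed.

Lemma nbe_sym A y : (y \in nbe (toggle y A)) = (y \in nbe A).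
Proof.
have half B : y \in nbe B -> y \in nbe (toggle y B).
  move=> /in_nbe[sB Uy By]; apply/in_nbe.
  have [st Ut] := simplex_toggle hyp hR sB By Uy; split=> //.
  by rewrite -toggle_eq0 toggleK; case: sB.
by apply/idP/idP => [/half|/half //]; rewrite toggleK.
Qed.

Definition cF x A y : C := (zeta x [set` A] y)%:C%C * sigma K y A.

Lemma csq_cF x A y : y \in nbe A -> csq (cF x A y) <= 1.
Proof.
move=> /in_nbe[sA _ _]; rewrite /cF csqM csq_sigma mulr1 csq_real.
by rewrite expr_le1 // ?(zeta_ge0 hphi1) // (zeta_le1 hyp hw hphi1 hR).
Qed.

Definition Fop x f : H := rmk S R (Tog nbe (cF x) (rips_val f)).

Lemma rmk_tog (a : {fset G} -> G -> C) (e : K) f : 0 <= e ->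
  (forall A y, y \in nbe A -> csq (a A y) <= e) ->
  rips_val (rmk S R (Tog nbe a (rips_val f))) = Tog nbe a (rips_val f).
Proof.
move=> e0 ha; apply: rmkE => A nA; rewrite (TogE card_nbe nbe_sym e0 ha) /tog big_seq big1 //.
by move=> y; rewrite -[_ \in enum_fset _]/(y \in nbe A) => /in_nbe[].
Qed.

Lemma Fop_val x f : rips_val (Fop x f) = Tog nbe (cF x) (rips_val f).
Proof. exact: (rmk_tog f ler01 (@csq_cF x)). Qed.

Lemma FopE x f A : rips_val (Fop x f) A =
  \sum_(y <- enum_fset (nbe A)) cF x A y * rips_val f (toggle y A).
Proof. by rewrite Fop_val (TogE card_nbe nbe_sym ler01 (@csq_cF x)). Qed.

Lemma Fop_linear x : linear (Fop x).
Proof.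
move=> c f g; apply: val_inj; rewrite /= Fop_val.
have := Tog_linear card_nbe nbe_sym ler01 (@csq_cF x) c (rips_val f) (rips_val g).
by rewrite -!Fop_val.
Qed.

Lemma Fop_bounded x : bounded_op (Fop x).
Proof.
split; first exact: Fop_linear.
have [_ [m hm]] := Tog_bounded card_nbe nbe_sym ler01 (@csq_cF x).
by exists m => f; rewrite !rips_hnorm Fop_val.
Qed.

Lemma cF_sym x A y : y \in nbe A -> cF x (toggle y A) y = Num.conj (cF x A y).
Proof.
move=> /in_nbe[sA _ Ay]; rewrite /cF rmorphM /= conj_sigma sigma_toggle.
rewrite (zeta_sym hyp hw hphi1 hR) //; congr (_ * _).
by rewrite -[Num.conj _]/(conjc _) /= oppr0.
Qed.

Lemma Fop_selfadjoint x : selfadjoint (Fop x).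
Proof.
move=> f g; rewrite !rips_innerE !Fop_val.
exact: (Tog_adjoint card_nbe nbe_sym ler01 (@csq_cF x) (@csq_cF x) (@cF_sym x)).
Qed.

Lemma Fop_odd x : odd_op (H_even S R) (H_odd S R) (Fop x).
Proof.
have key f A : rips_val (Fop x f) A != 0 -> exists B,
    rips_val f B != 0 /\ odd #|` B|.-1 = ~~ odd #|` A|.-1.
  rewrite FopE => h; apply: contrapT => nex; move/eqP: h; apply.
  rewrite big_seq big1 // => y; rewrite -[_ \in enum_fset _]/(y \in nbe A) => ye.
  have /in_nbe[[A0 _] _ Ay] := ye.
  have [->|f0] := eqVneq (rips_val f (toggle y A)) 0; first by rewrite mulr0.
  case: nex; exists (toggle y A); split=> //.
  have c1 : (0 < #|` A|)%N by rewrite cardfs_gt0.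
  have c2 : (0 < #|` toggle y A|)%N by rewrite cardfs_gt0 toggle_eq0.
  have := card_toggle y A.
  by rewrite -(prednK c1) -(prednK c2) /= negbK => <-; rewrite negbK.
split=> f hf A /key[B [/hf hB e]]; move: hB; rewrite e ?negbK //.
Qed.

(** The row of F at A uses the vector zeta of A, while Clifford multiplication uses
that of the simplex B the vector comes from. Here A = toggle y B, and the two
vectors agree at y. *)
Lemma Fop_isF x : is_F phi1 x (Fop x).
Proof.
split; first exact: Fop_linear.
move=> s os A A0; have [us s0 ds] := os.
pose B : {fset G} := [fset y in s]%fset.
have sB : [set` s] = [set` B] by apply/seteqP; split=> y /=; rewrite !inE.
have smB : smp B.
  split; last by rewrite -sB.
  have [y ys] : exists y, y \in s.
    by case: (s) s0 => // y r _; exists y; rewrite mem_head.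
  by apply/fset0Pn; exists y; rewrite !inE.
rewrite FopE e_E // sB.
rewrite (@clE _ _ _ (nb B)); first last.
- by move=> y; rewrite -[Num.conj _]/(conjc _) /= oppr0.
- move=> y h; rewrite (in_nb hyp hR) // inE.
  have zy : zeta x [set` B] y != 0 by move: h; apply: contraNN => /eqP ->.
  exact: zeta_U zy smB.
set W := fun D => wedge K s D.
have W0 D : W D != 0 -> D = B by rewrite /W wedgeE => /wedge_coef_neq0[].
pose Fa y := (if y \in nbe A then cF x A y else 0) * W (toggle y A).
pose Fb y := (if y \in nb B then (zeta x [set` B] y)%:C%C * sigma K y A else 0) * W (toggle y A).
have eab y : Fa y = Fb y.
  rewrite /Fa /Fb; have [->|/W0 e] := eqVneq (W (toggle y A)) 0; first by rewrite !mulr0.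
  congr (_ * _); have Ay : A != [fset y]%fset by rewrite -toggle_eq0 e; case: smB.
  have By : B != [fset y]%fset by rewrite -toggle_eq0 -e toggleK.
  have tB : toggle y B = A by rewrite -e toggleK.
  have [ynb|ynb] := boolP (y \in nb B).
    move: (ynb); rewrite (in_nb hyp hR) // inE => Uy.
    have [st Ut] := simplex_toggle hyp hR smB By Uy; rewrite tB in st Ut.
    rewrite ifT; last exact/in_nbe.
    by rewrite /cF -e (zeta_sym hyp hw hphi1 hR).
  rewrite ifF //; apply/negP => /in_nbe[sA Uy _]; move/negP: ynb; apply.
  rewrite (in_nb hyp hR) // inE -e.
  by have [] := simplex_toggle hyp hR sA Ay Uy.
transitivity (\sum_(y <- enum_fset (nbe A)) Fa y).
  rewrite big_seq [RHS]big_seq; apply: eq_bigr => y.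
  by rewrite /Fa -[_ \in enum_fset _]/(y \in nbe A) => ->.
transitivity (\sum_(y <- enum_fset (nb B)) Fb y); last first.
  rewrite big_seq [RHS]big_seq; apply: eq_bigr => y.
  by rewrite /Fb -[_ \in enum_fset _]/(y \in nb B) => ->.
under [RHS]eq_bigr do rewrite -eab.
apply: sum_supp => y Fy; apply/idP/idP => _.
  by move: Fy; rewrite eab /Fb; case: ifP => //; rewrite mul0r eqxx.
by move: Fy; rewrite /Fa; case: ifP => //; rewrite mul0r eqxx.
Qed.

(** The square of Clifford multiplication by a unit vector is the identity, and by
zeta_toggle the same unit vector acts twice; the terms with distinct y and z cancel
in pairs. The only defect is at the simplex x alone, whose image is the discarded
empty simplex. *)
Lemma Fop_sqr x f A : smp A -> rips_val (Fop x (Fop x f)) A =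
  if A == [fset x]%fset then 0 else rips_val f A.
Proof.
move=> sA; rewrite FopE; case: ifPn => [/eqP Ax|Ax].
  rewrite big_seq big1 // => y; rewrite -[_ \in enum_fset _]/(y \in nbe A) => /in_nbe[_ _ Ay].
  rewrite /cF zetaE mem_set; last first.
    by rewrite Ax; apply: (U_mem hyp hR); rewrite -?Ax // Ax inE.
  case: (y =P x) => [e|_]; last by rewrite !mul0r.
  by move: Ay; rewrite e Ax eqxx.
have zA y : zeta x [set` A] y != 0 -> A != [fset y]%fset.
  move=> h; apply: contraNN Ax => /eqP e; move: h; rewrite e => h.
  by rewrite (zeta_single hyp hw hphi1 hR h).
pose z_ y : C := (zeta x [set` A] y)%:C%C.
pose g y z := z_ y * z_ z * (sigma K y A * sigma K z (toggle y A)) *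
  rips_val f (toggle z (toggle y A)).
transitivity (\sum_(y <- enum_fset (nb A)) \sum_(z <- enum_fset (nb A)) g y z).
  have step1 : \sum_(y <- enum_fset (nbe A)) cF x A y * rips_val (Fop x f) (toggle y A) =
      \sum_(y <- enum_fset (nb A)) cF x A y * rips_val (Fop x f) (toggle y A).
    apply: sum_supp => y h; have zy : zeta x [set` A] y != 0.
      by apply: contraNN h => /eqP; rewrite /cF => ->; rewrite !mul0r.
    have Uy := zeta_U zy sA; rewrite (in_nb hyp hR) // mem_set //.
    by apply/in_nbe; split=> //; exact: zA.
  rewrite step1; apply: eq_bigr => y _.
  have [z0|zy] := eqVneq (zeta x [set` A] y) 0.
    rewrite /cF z0 !mul0r big1 // => z _; by rewrite /g /z_ z0 !mul0r.
  have Ay := zA y zy; have Uy := zeta_U zy sA.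
  have [st Ut] := simplex_toggle hyp hR sA Ay Uy.
  have ztg z : zeta x [set` toggle y A] z = zeta x [set` A] z.
    by apply: (zeta_toggle hyp hw hphi1 hR) => //; left.
  rewrite FopE mulr_sumr.
  transitivity (\sum_(z <- enum_fset (nbe (toggle y A))) g y z).
    by apply: eq_bigr => z _; rewrite /g /cF ztg /z_; ring.
  apply: sum_supp => z h.
  have zz : zeta x [set` A] z != 0.
    by apply: contraNN h => /eqP h0; rewrite /g /z_ h0 mulr0 !mul0r.
  rewrite (in_nb hyp hR) // [in RHS]mem_set; last exact: zeta_U zz sA.
  apply/in_nbe; split=> //; first by have h2 : zeta x [set` toggle y A] z != 0; [by rewrite ztg|exact: zeta_U h2 st].
  by rewrite -toggle_eq0; apply: contraNN h => /eqP h0; rewrite /g h0 rips_set0 mulr0.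
pose g' y z := if y == z then 0 else g y z.
have anti y z : g' y z = - g' z y.
  rewrite /g' [z == y]eq_sym; case: eqP => [_|/eqP yz]; first by rewrite oppr0.
  by rewrite /g sigma_anti // toggleC; ring.
have split_g y z : g y z = (if y == z then z_ y ^+ 2 * rips_val f A else 0) + g' y z.
  rewrite /g'; case: eqP => [<-|_]; last by rewrite add0r.
  by rewrite addr0 /g toggleK sigma_toggle sigma_sqr; ring.
under eq_bigr do under eq_bigr do rewrite split_g.
under eq_bigr do rewrite big_split /=.
rewrite big_split /=; set Q := (X in _ + X).
have Q0 : Q = 0.
  have : Q = - Q.
    rewrite {1}/Q exchange_big -sumrN; apply: eq_bigr => z _.
    by rewrite -sumrN; apply: eq_bigr => y _; rewrite anti.
  by move/eqP; rewrite -addr_eq0 -mulr2n mulrn_eq0 /= => /eqP.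
rewrite Q0 addr0.
transitivity (\sum_(y <- enum_fset (nb A)) z_ y ^+ 2 * rips_val f A).
  rewrite big_seq [RHS]big_seq; apply: eq_bigr => y yA.
  rewrite (bigD1_seq y) ?fset_uniq //= eqxx big1 ?addr0 // => z /negPf.
  by rewrite eq_sym => ->.
rewrite -mulr_suml; have := zeta_norm hyp hw hphi1 hR x sA => hz.
have -> : \sum_(y <- enum_fset (nb A)) z_ y ^+ 2 = 1.
  transitivity ((\sum_(y <- enum_fset (nb A)) zeta x [set` A] y ^+ 2)%:C)%C.
    by rewrite rmorph_sum; apply: eq_bigr => y _; rewrite rmorphXn.
  by rewrite hz.
by rewrite mul1r.
Qed.

(** ** Change of base point *)

Definition far x (n : nat) f : Prop :=
  forall A, (exists2 a, a \in A & (wdist S x a <= n)%N) -> rips_val f A = 0.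

(** The difference is an operator of the same kind, whose entries are differences
of two vectors zeta. These are small at the simplices where f lives. *)
Lemma Fop_diff_decay (lam : K) x x' : 0 < lam -> lam < 1 -> lambda1 K S delta <= lam ->
  exists2 c : K, 0 <= c & forall n f, far x n f ->
    hnorm (Fop x f - Fop x' f) <= c * lam ^+ n * hnorm f.
Proof.
move=> l0 l1 hl; have [c c0 hc] := zeta_decay hyp hw hphi1 hR l0 l1 hl x x'.
exists (M%:R * c) => [|n f hf]; first by rewrite mulr_ge0.
pose a A y := cF x A y - cF x' A y.
have aE A y : a A y = ((zeta x [set` A] y - zeta x' [set` A] y)%:C)%C * sigma K y A.
  by rewrite /a /cF -mulrBl rmorphB.
have ha A y : y \in nbe A -> csq (a A y) <= 1.
  move=> /in_nbe[sA _ _]; rewrite aE csqM csq_sigma mulr1 csq_real.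
  have := zeta_ge0 hphi1 R x [set` A] y; have := zeta_ge0 hphi1 R x' [set` A] y.
  have := zeta_le1 hyp hw hphi1 hR x y sA; have := zeta_le1 hyp hw hphi1 hR x' y sA => *.
  by rewrite -real_normK ?num_real // expr_le1 // ler_norml; apply/andP; split; lra.
have e : rips_val (Fop x f - Fop x' f) = Tog nbe a (rips_val f).
  have TE := TogE card_nbe nbe_sym ler01 ha (rips_val f).
  apply: ell2_ext => A; transitivity (tog nbe a (rips_val f) A); last first.
    exact/esym/(congr1 (fun h => h A) TE).
  transitivity (rips_val (Fop x f) A - rips_val (Fop x' f) A); first by [].
  transitivity (\sum_(y <- enum_fset (nbe A)) cF x A y * rips_val f (toggle y A) -
                \sum_(y <- enum_fset (nbe A)) cF x' A y * rips_val f (toggle y A)).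
    exact: (congr2 (fun u v => u - v) (FopE x f A) (FopE x' f A)).
  apply: esym; rewrite /tog.
  transitivity (\sum_(y <- enum_fset (nbe A))
    (cF x A y * rips_val f (toggle y A) - cF x' A y * rips_val f (toggle y A))).
    by apply: eq_bigr => y _; exact: mulrBl.
  exact: sumrB.
rewrite rips_hnorm e -[M%:R * c * _]mulrA.
apply: (Tog_le card_nbe nbe_sym ler01 ha); first by rewrite mulr_ge0 // exprn_ge0 // ltW.
move=> A y ye f0; rewrite aE csqM csq_sigma mulr1 csq_real.
have /in_nbe[sA Uy Ay] := ye; have [st Ut] := simplex_toggle hyp hR sA Ay Uy.
rewrite -!(zeta_sym hyp hw hphi1 hR _ sA Ay) -real_normK ?num_real //.
rewrite ler_pXn2r ?nnegrE ?mulr_ge0 ?exprn_ge0 ?(ltW l0) //.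
apply: hc => // b bA; rewrite leqNgt; apply/negP => bn.
by move/eqP: f0; apply; apply: hf; exists b => //; exact: ltnW.
Qed.

End OperatorF.


(** * The reduced group C*-algebra *)

Opaque to_ell2.

Section GroupAlgebra.
Variables (K : realType) (G : groupType).
Local Notation C := K[i].
Local Notation E := (ell2_space K G).
Local Notation hE := (@ell2_hilbert K G).
Local Notation Cr := (Cr K G).
Local Notation tr := (@translation K G).
Implicit Types (a b : E -> E) (f v : E) (g h k : G) (l : seq (G * C)).

Lemma trE g f h : tr g f h = f (g^-1 * h)%g.
Proof. by rewrite translationE. Qed.

Lemma tr_linear g : linear (tr g).
Proof. by move=> c f v; apply: ell2_ext => h; rewrite ell2E !trE. Qed.

Lemma tr_mul g h f : tr g (tr h f) = tr (g * h)%g f.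
Proof. by apply: ell2_ext => k; rewrite !trE invgM mulgA. Qed.

Lemma tr1 f : tr 1%g f = f.
Proof. by apply: ell2_ext => k; rewrite trE invg1 mul1g. Qed.

Lemma tr_hnorm g f : hnorm (tr g f) = hnorm f.
Proof.
rewrite !ell2_hnorm /nsq; congr (Num.sqrt (fine _)).
rewrite [RHS](@tsum_reindex _ _ _ (fun h => g^-1 * h)%g (fun h => g * h)%g).
- by apply: eq_esum => h _; rewrite trE.
- exact: mulVKg.
- exact: mulKg.
Qed.

Lemma tr_bounded g : bounded_op (tr g).
Proof.
by apply: (@bounded_opP _ _ _ 1); [exact: tr_linear|move=> f; rewrite tr_hnorm mul1r].
Qed.

Lemma tr_adjoint g : is_adjoint (tr g) (tr g^-1).
Proof.
apply: is_adjoint_dvec; [exact: tr_bounded|exact: tr_bounded|].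
move=> h k; rewrite (trE g (dvec K h) k) (trE g^-1 (dvec K k) h) invgK.
rewrite (dvecE K h (g^-1 * k)%g) (dvecE K k (g * h)%g).
have -> : ((g^-1 * k)%g == h) = ((g * h)%g == k).
  by apply/eqP/eqP => <-; rewrite ?mulVKg ?mulKg.
by case: eqP => _; rewrite ?rmorph0 ?rmorph1.
Qed.

(** Lists may repeat a group element, so that sums, products and adjoints of such
combinations are plain list operations. *)
Definition lin_tr l : E -> E := fun f => \sum_(p <- l) p.2 *: tr p.1 f.

Lemma lin_tr_ring l : group_ring K G (lin_tr l).
Proof.
exists (undup (unzip1 l)), (fun g => \sum_(p <- l | p.1 == g) p.2).
apply/funext => f; rewrite /lin_tr.
under [RHS]eq_bigr do rewrite scaler_suml.
rewrite (exchange_big_dep predT) //= big_seq [RHS]big_seq; apply: eq_bigr => p pl.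
rewrite (big_rem p.1) /=; last by rewrite mem_undup map_f.
rewrite eqxx big_seq_cond big1 ?addr0 // => g /andP[gr /eqP e].
by move: gr; rewrite -e mem_rem_uniqF // undup_uniq.
Qed.

Lemma group_ringP a : group_ring K G a -> exists l, a = lin_tr l.
Proof.
move=> [s [c ->]]; exists [seq (g, c g) | g <- s]; apply/funext => f.
by rewrite /lin_tr big_map.
Qed.

Lemma lin_tr_bounded l : bounded_op (lin_tr l).
Proof.
have := @bounded_op_sum K E hE _ l (fun p => p.2) (fun p => tr p.1); apply.
by move=> p; exact: tr_bounded.
Qed.

Lemma CrP a : Cr a <-> bounded_op a /\ forall e : K, 0 < e ->
  exists l, forall f, hnorm (a f - lin_tr l f) <= e * hnorm f.
Proof.
split=> -[ba h]; split=> // e e0.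
  have [b /group_ringP[l ->] hb] := h e e0; exists l => f.
  have bd : bounded_op (fun f => a f - lin_tr l f) by apply: (bounded_opB hE ba); exact: lin_tr_bounded.
  apply: le_trans (opnormP hE f bd) _; rewrite ler_wpM2r ?hnorm_ge0 // ltW //.
have e2 : 0 < e / 2 by rewrite divr_gt0.
have [l hl] := h _ e2; exists (lin_tr l); first exact: lin_tr_ring.
apply: (@le_lt_trans _ _ (e / 2)); first by apply: (opnorm_le hE) => //; exact: ltW.
by rewrite ltr_pdivrMr // ltr_pMr // ltr1n.
Qed.

Lemma lin_tr_Cr l : Cr (lin_tr l).
Proof.
apply/CrP; split; first exact: lin_tr_bounded.
by move=> e e0; exists l => f; rewrite subrr (hnorm0 hE) mulr_ge0 ?hnorm_ge0 // ltW.
Qed.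

Lemma tr_lin g : tr g = lin_tr [:: (g, 1)].
Proof. by apply/funext => f; rewrite /lin_tr big_seq1 scale1r. Qed.

Lemma tr_Cr g : Cr (tr g). Proof. by rewrite tr_lin; exact: lin_tr_Cr. Qed.

Lemma id_Cr : Cr id.
Proof.
by rewrite (_ : id = tr 1%g); [exact: tr_Cr|apply/funext => f; rewrite tr1].
Qed.

Lemma Cr_bounded a : Cr a -> bounded_op a. Proof. by case. Qed.
Lemma Cr_lin a : Cr a -> linear a. Proof. by move=> /Cr_bounded[]. Qed.

Lemma Cr_linear c a b : Cr a -> Cr b -> Cr (fun f => c *: a f + b f).
Proof.
move=> /CrP[ba ha] /CrP[bb hb]; apply/CrP; split; first exact: (bounded_op_linear hE).
move=> e e0; have c0 := sqrtr_ge0 (csq c); set q := Num.sqrt (csq c) in c0.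
have e2 : 0 < e / 2 by rewrite divr_gt0.
have [d d0 hd] := small_factor c0 e2.
have [l hl] := ha _ d0; have [m hm] := hb _ e2.
exists ([seq (p.1, c * p.2) | p <- l] ++ m) => f.
have -> : lin_tr ([seq (p.1, c * p.2) | p <- l] ++ m) f = c *: lin_tr l f + lin_tr m f.
  rewrite /lin_tr big_cat big_map /= scaler_sumr; congr (_ + _).
  by apply: eq_bigr => p _; rewrite scalerA.
rewrite opprD addrACA -scalerBr; apply: le_trans (hnormD hE _ _) _.
rewrite (hnormZ hE) -/q.
have h1 : q * hnorm (a f - lin_tr l f) <= e / 2 * hnorm f.
  by apply: le_trans (ler_wpM2l c0 (hl f)) _; rewrite mulrA ler_wpM2r ?hnorm_ge0.
have := hm f; have -> : e * hnorm f = e / 2 * hnorm f + e / 2 * hnorm f by field.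
lra.
Qed.

Lemma lin_tr_comp l m : lin_tr l \o lin_tr m =
  lin_tr [seq ((p.1 * q.1)%g, p.2 * q.2) | p <- l, q <- m].
Proof.
apply/funext => f; rewrite /lin_tr big_allpairs_dep /=; apply: eq_bigr => p _.
rewrite linsum; last exact: tr_linear.
rewrite scaler_sumr; apply: eq_bigr => q _.
rewrite linZ; last exact: tr_linear.
by rewrite scalerA tr_mul.
Qed.

Lemma Cr_mul a b : Cr a -> Cr b -> Cr (a \o b).
Proof.
move=> /CrP[ba ha] /CrP[bb hb]; apply/CrP; split; first exact: bounded_op_comp.
have [A A0 hA] := bounded_op_bound ba.
move=> e e0; have e2 : 0 < e / 2 by rewrite divr_gt0.
have [d d0 hd] := small_factor A0 e2; have [m hm] := hb _ d0.
have [B B0 hB] := bounded_op_bound (lin_tr_bounded m).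
have [d' d'0 hd'] := small_factor B0 e2.
have [l hl] := ha _ d'0; exists [seq ((p.1 * q.1)%g, p.2 * q.2) | p <- l, q <- m] => f.
rewrite -lin_tr_comp /=.
have la := ba.1.
have h1 : hnorm (a (b f) - a (lin_tr m f)) <= e / 2 * hnorm f.
  rewrite -(linB _ _ la); apply: le_trans (hA _) _.
  by apply: le_trans (ler_wpM2l A0 (hm f)) _; rewrite mulrA ler_wpM2r ?hnorm_ge0.
have h2 : hnorm (a (lin_tr m f) - lin_tr l (lin_tr m f)) <= e / 2 * hnorm f.
  apply: le_trans (hl _) _; apply: le_trans (ler_wpM2l (ltW d'0) (hB f)) _.
  by rewrite mulrA ler_wpM2r ?hnorm_ge0 // mulrC.
apply: le_trans (hnorm_dist hE (a (lin_tr m f)) _ _) _.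
have -> : e * hnorm f = e / 2 * hnorm f + e / 2 * hnorm f by field.
by rewrite lerD.
Qed.

Lemma lin_tr_adjoint l : is_adjoint (lin_tr l) (lin_tr [seq (p.1^-1%g, Num.conj p.2) | p <- l]).
Proof.
move=> u v; rewrite /lin_tr big_map.
elim: l => [|p l IHl]; first by rewrite !big_nil (inner0l hE) (inner0r hE).
rewrite !big_cons (innerDl hE) (innerDr hE) IHl; congr (_ + _).
by rewrite (innerZl hE) (innerZr hE) conjCK tr_adjoint.
Qed.

(** Taking adjoints preserves operator bounds, hence approximations. *)
Lemma Cr_adjoint a : Cr a -> exists2 b, Cr b & is_adjoint a b.
Proof.
move=> /CrP[ba ha]; have ad := riesz_adjoint ba; exists (riesz a) => //.
apply/CrP; split; first exact: riesz_bounded.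
move=> e e0; have [l hl] := ha e e0.
exists [seq (p.1^-1%g, Num.conj p.2) | p <- l] => f.
apply: (adjoint_le hE (T := fun f => a f - lin_tr l f)
  (T' := fun f => riesz a f - lin_tr [seq (p.1^-1%g, Num.conj p.2) | p <- l] f)) => //.
- move=> u v; rewrite (innerBr hE) -ad -lin_tr_adjoint.
  by rewrite -[- lin_tr l u]scaleN1r (innerDl hE) (innerZl hE) mulN1r.
- exact: ltW.
Qed.

Lemma Cr_closed a : bounded_op a ->
  (forall e : K, 0 < e -> exists2 b, Cr b & opnorm (fun v => a v - b v) < e) -> Cr a.
Proof.
move=> ba h; apply/CrP; split=> // e e0; have e2 : 0 < e / 2 by rewrite divr_gt0.
have [b /CrP[bb hb] ab] := h _ e2; have [l hl] := hb _ e2; exists l => f.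
apply: le_trans (hnorm_dist hE (b f) _ _) _.
have -> : e * hnorm f = e / 2 * hnorm f + e / 2 * hnorm f by field.
apply: lerD; last exact: hl.
apply: le_trans (opnormP hE f (bounded_opB hE ba bb)) _.
by rewrite ler_wpM2r ?hnorm_ge0 // ltW.
Qed.

Lemma Cr_cstar : is_cstar_algebra Cr.
Proof.
split; [exact: ell2_hilbert|exact: Cr_bounded|exact: id_Cr|exact: Cr_linear|
  exact: Cr_mul|exact: Cr_adjoint|exact: Cr_closed].
Qed.

(** ** Right translations *)

Definition rtr k f : E := to_ell2 (fun h => f (h * k)%g).

Lemma rtrE k f h : rtr k f h = f (h * k)%g.
Proof.
rewrite /rtr to_ell2E //; rewrite /sqsum.
rewrite -(@reindex_esum _ _ _ setT setT (fun h => h * k)%g (fun h => (csq (f h))%:E)).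
  exact: ell2P.
split=> // [u v _ _ /mulIg //|u _]; exists (u * k^-1)%g => //=.
by rewrite mulgVK.
Qed.

Lemma rtr_hnorm k f : hnorm (rtr k f) = hnorm f.
Proof.
rewrite !ell2_hnorm /nsq; congr (Num.sqrt (fine _)).
rewrite [RHS](@tsum_reindex _ _ _ (fun h => h * k)%g (fun h => h * k^-1)%g).
- by apply: eq_esum => h _; rewrite rtrE.
- exact: mulgK.
- exact: mulgVK.
Qed.

(** Left translations commute with right ones, and this passes to norm limits. *)
Lemma Cr_rtr a k f : Cr a -> a (rtr k f) = rtr k (a f).
Proof.
have fin (p q D c : K) : D <= p + q -> p <= c -> q <= c -> c <= D / 4 -> 0 < D -> False.
  by lra.
move=> /CrP[ba ha].
have lr l : lin_tr l (rtr k f) = rtr k (lin_tr l f).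
  apply: ell2_ext => h; rewrite rtrE /lin_tr !ell2_sumE; apply: eq_bigr => p _.
  have e1 : tr p.1 (rtr k f) h = tr p.1 f (h * k)%g.
    by rewrite (trE p.1 (rtr k f) h) (rtrE k f) (trE p.1 f) mulgA.
  exact: (congr1 (fun z => p.2 * z) e1).
have rB (u v : E) : rtr k (u - v) = rtr k u - rtr k v.
  by apply: ell2_ext => h; rewrite rtrE !ell2BE !rtrE.
apply/eqP; rewrite -subr_eq0; apply/eqP/(hnorm_eq0 hE)/eqP.
rewrite eq_le hnorm_ge0 andbT leNgt; apply/negP => d0; set d := hnorm _ in d0.
have [t t0 ht] := small_factor (hnorm_ge0 f) (divr_gt0 d0 (ltr0n K 4)).
have [l hl] := ha _ t0.
have h1 : d <= hnorm (a (rtr k f) - lin_tr l (rtr k f)) + hnorm (rtr k (lin_tr l f - a f)).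
  by rewrite rB -lr; apply: hnorm_dist; exact: hE.
have h2 := hl (rtr k f); have h3 := hl f; rewrite rtr_hnorm in h2.
rewrite rtr_hnorm [hnorm (lin_tr l f - _)](hnormBC hE) in h1.
rewrite mulrC in ht.
exact: (fin _ _ _ _ h1 h2 h3 ht d0).
Qed.

End GroupAlgebra.


(** * The regular representation on the Rips complex *)

Section Representation.
Variables (K : realType) (G : groupType) (S : {fset G}).
Hypothesis genS : generating S.
Variable R : K.
Hypothesis R0 : 0 <= R.
Local Notation C := K[i].
Local Notation E := (ell2_space K G).
Local Notation hE := (@ell2_hilbert K G).
Local Notation hL := (@ell2_hilbert K {fset G}).
Local Notation H := (H_R S R).
Local Notation hH := (@rips_hilbert K G S R).
Local Notation smp := (simplex S R).
Local Notation Cr := (Cr K G).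
Local Notation tr := (@translation K G).
Implicit Types (f : H) (A B : {fset G}) (a b : E -> E) (g h k u : G).

(** Up to translation these finitely many simplices are all simplices. *)
Definition bases : {fset {fset G}} :=
  [fset B in fpowerset (ball S (Num.truncn R)) | `[< smp B >] && (1%g \in B)]%fset.

Lemma in_bases B : B \in bases <-> smp B /\ 1%g \in B.
Proof.
rewrite !inE /=; split=> [/andP[_ /andP[/asboolP]] //|[sB B1]].
rewrite B1 andbT; apply/andP; split; last exact/asboolP.
rewrite fpowersetE; apply/fsubsetP => y yB; apply: (mem_ball genS).
by rewrite truncn_ge_nat //; have := sB.2 _ _ B1 yB; rewrite /wdist invg1 mul1g.
Qed.

Lemma base_gset h A : smp A -> h \in A -> gset h^-1 A \in bases.
Proof.
move=> sA hA; apply/in_bases; split; first exact/simplex_gset.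
by rewrite in_gset invgK mulg1.
Qed.

(** A simplex A is a translate h B of a base B in as many ways as it has vertices,
namely once for each h in A. The weight compensates for this. *)
Definition wgt A : K := (Num.sqrt #|` A|%:R)^-1.

Lemma wgt_gset g A : wgt (gset g A) = wgt A.
Proof. by rewrite /wgt card_gset. Qed.

Lemma wgt_sqr A : smp A -> wgt A ^+ 2 * #|` A|%:R = 1.
Proof.
move=> [A0 _]; have c0 : (#|` A|%:R : K) != 0 by rewrite pnatr_eq0 cardfs_eq0.
by rewrite /wgt exprVn sqr_sqrtr ?ler0n // mulVf.
Qed.

(** In the coordinates (B, h), a vector f of the Rips complex becomes a finite
family of functions on the group.  The weight makes this an isometry, and the
sign makes it equivariant. *)
Definition raw B (F : {fset G} -> C) h : C := (wgt B)%:C%C * eps K h B * F (gset h B).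

Lemma csq_raw B F h : csq (raw B F h) = wgt B ^+ 2 * csq (F (gset h B)).
Proof. by rewrite /raw !csqM (csq_sign (eps_sqr K h B)) csq_real mulr1. Qed.

Lemma raw_isometry (F : {fset G} -> C) : (forall A, ~ smp A -> F A = 0) ->
  (\sum_(B <- enum_fset bases) nsq (raw B F))%E = nsq F.
Proof.
move=> F0; pose P := [set A | smp A] `*`` (fun A => [set` A]).
pose e (k : {fset G} * G) := (gset k.2^-1 k.1, k.2).
transitivity (\esum_(k in [set` bases] `*`` (fun=> [set: G]))
   (wgt k.1 ^+ 2 * csq (F (gset k.2 k.1)))%:E)%E.
  rewrite -(@esum_esum _ _ _ [set` bases] (fun=> [set: G])
    (fun B h => (wgt B ^+ 2 * csq (F (gset h B)))%:E)); last first.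
    by move=> *; rewrite lee_fin mulr_ge0 ?sqr_ge0 ?csq_ge0.
  rewrite esum_fset; [|exact: finite_fset|]; last first.
    by move=> B _; apply: esum_ge0 => h _; rewrite lee_fin mulr_ge0 ?sqr_ge0 ?csq_ge0.
  rewrite fsbig_finite ?set_fsetK; last exact: finite_fset.
  by apply: eq_bigr => B _; apply: eq_esum => h _; rewrite csq_raw.
transitivity (\esum_(k in P) (wgt k.1 ^+ 2 * csq (F k.1))%:E)%E.
  rewrite (@reindex_esum _ _ _ P _ e).
    apply: eq_esum => -[A h] _; rewrite /e /= gsetKV wgt_gset //.
  split=> [[A h] [/= sA hA]|[A h] [B k] _ _ /= [e1 e2]|[B h] [/= /in_bases[sB B1] _]].
  - by split=> //=; exact: base_gset.
  - by rewrite e2 in e1 *; rewrite -(gsetKV k A) e1 gsetKV.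
  - exists (gset h B, h); last by rewrite /e /= gsetK.
    by split=> /=; [exact/simplex_gset|rewrite in_gset mulVg].
rewrite -(@esum_esum _ _ _ [set A | smp A] (fun A => [set` A])
   (fun A h => (wgt A ^+ 2 * csq (F A))%:E)); last first.
  by move=> *; rewrite lee_fin mulr_ge0 ?sqr_ge0 ?csq_ge0.
rewrite /nsq /tsum esum_mkcond; apply: eq_esum => A _.
have [sA|nA] := pselect (smp A); last first.
  by rewrite memNset // F0 // csq0.
rewrite mem_set // esum_fset; [|exact: finite_fset|]; last first.
  by move=> *; rewrite lee_fin mulr_ge0 ?sqr_ge0 ?csq_ge0.
rewrite fsbig_finite ?set_fsetK; last exact: finite_fset.
rewrite sumEFin big_const_seq count_predT iter_addr_0 -mulr_natr mulrAC.
by rewrite -[X in (_ * X)%R]/(_) wgt_sqr ?mul1r.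
Qed.

Definition loc B f : E := to_ell2 (raw B (rips_val f)).

Lemma raw_fin B (F : {fset G} -> C) : B \in bases -> (forall A, ~ smp A -> F A = 0) ->
  (nsq F < +oo)%E -> sqsum (raw B F).
Proof.
move=> hB F0 fin; rewrite /sqsum -/(tsum _) -/(nsq _); apply: le_lt_trans fin.
rewrite -raw_isometry // (big_fsetD1 B) //= leeDl //.
by apply: sume_ge0 => D _; apply: tsum_ge0 => h; exact: csq_ge0.
Qed.

Lemma locE B f h : B \in bases -> loc B f h = (wgt B)%:C%C * eps K h B * rips_val f (gset h B).
Proof.
move=> hB; rewrite /loc to_ell2E //; apply: raw_fin => //; first exact: rips_off.
by rewrite ell2_nsq ltry.
Qed.

Lemma loc_linear (c : C) f f' B : B \in bases -> loc B (c *: f + f') = c *: loc B f + loc B f'.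
Proof.
move=> hB; apply: ell2_ext => h.
transitivity (c * loc B f h + loc B f' h); last by [].
rewrite !locE // rips_valE; ring.
Qed.

Lemma loc_norm f : hnorm f ^+ 2 = \sum_(B <- enum_fset bases) hnorm (loc B f) ^+ 2.
Proof.
apply: EFin_inj; rewrite -sumEFin rips_hnorm -ell2_nsq -raw_isometry; last exact: rips_off.
rewrite big_seq [RHS]big_seq; apply: eq_bigr => B hB; rewrite -ell2_nsq.
by congr nsq; apply/funext => h; rewrite locE.
Qed.

Lemma locD f f' B : B \in bases -> loc B (f + f') = loc B f + loc B f'.
Proof. by move=> hB; have := loc_linear 1 f f' hB; rewrite !scale1r. Qed.

Lemma loc0 B : B \in bases -> loc B 0 = 0.
Proof.
move=> hB; by have := loc_linear (-1) 0 0 hB; rewrite !scaleN1r !addNr.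
Qed.

Lemma locZ (c : C) f B : B \in bases -> loc B (c *: f) = c *: loc B f.
Proof. by move=> hB; have := loc_linear c f 0 hB; rewrite !addr0 loc0 // addr0. Qed.

(** Polarization of loc_norm. *)
Lemma loc_inner f f' : inner f f' = \sum_(B <- enum_fset bases) inner (loc B f) (loc B f').
Proof.
have re p q : complex.Re (inner p q) =
    \sum_(B <- enum_fset bases) complex.Re (inner (loc B p) (loc B q)).
  rewrite (polar_re hH) !loc_norm -sumrB mulr_suml big_seq [RHS]big_seq.
  apply: eq_bigr => B hB; rewrite (polar_re hE) locD //.
  by have := loc_linear (-1) q p hB; rewrite !scaleN1r ![- _ + _]addrC => ->.
apply/eqP; rewrite eq_complex; apply/andP; split; apply/eqP.
  by rewrite re raddf_sum.
rewrite (polar_im hH) re raddf_sum big_seq [RHS]big_seq; apply: eq_bigr => B hB.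
by rewrite locZ // -(polar_im hE).
Qed.

Lemma wgt_neq0 A : smp A -> ((wgt A)%:C)%C != 0 :> C.
Proof.
move=> sA; rewrite fmorph_eq0; apply/eqP => h; have := wgt_sqr sA.
by rewrite h expr0n mul0r => /esym/eqP; rewrite oner_eq0.
Qed.

Lemma eps_neq0 g A : eps K g A != 0.
Proof.
by apply/eqP => h; have := eps_sqr K g A; rewrite h mul0r => /esym/eqP; rewrite oner_eq0.
Qed.

Lemma loc_inj f f' : (forall B, B \in bases -> loc B f = loc B f') -> f = f'.
Proof.
move=> e; apply: rips_ext => A sA; have [A0 _] := sA.
have [h hA] := fset0Pn _ A0; have hB := base_gset sA hA.
have := congr1 (fun v : E => v h) (e _ hB); rewrite /= !locE // gsetKV.
by apply: mulfI; rewrite mulf_neq0 ?eps_neq0 // wgt_neq0 //; exact/simplex_gset.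
Qed.

(** The coordinates for two bases which are translates of each other determine each
other, by a right translation. *)
Lemma loc_rtr f B k : B \in bases -> gset k B \in bases ->
  loc (gset k B) f = eps K k B *: rtr k (loc B f).
Proof.
move=> hB hkB; apply: ell2_ext => u; rewrite locE // wgt_gset -gsetM.
transitivity (eps K k B * loc B f (u * k)%g); last by rewrite -(rtrE k (loc B f)).
rewrite locE // epsM.
have := eps_sqr K k B => s2.
transitivity ((eps K k B * eps K k B) * ((wgt B)%:C%C * eps K u (gset k B) * rips_val f (gset (u * k) B))).
  by rewrite s2 mul1r.
by ring.
Qed.

(** The operator a acts on the coordinate functions. Each h in A yields a
reconstruction of the value at A from the result, and these are averaged. *)
Definition rho_fun a f A : C := if `[< smp A >] then
  \sum_(h <- enum_fset A) (wgt A)%:C%C * eps K h (gset h^-1 A) * a (loc (gset h^-1 A) f) h else 0.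

Definition rho a f : H := rmk S R (to_ell2 (rho_fun a f)).

(** All reconstructions of a value agree, because a commutes with the right
translations which relate them. *)
Lemma raw_rho a f B : Cr a -> B \in bases -> raw B (rho_fun a f) = a (loc B f) :> (G -> C).
Proof.
move=> Ca hB; have [sB B1] := (in_bases B).1 hB; apply/funext => h.
rewrite /raw /rho_fun; case: asboolP => [sA|[]]; last exact/simplex_gset.
have term u : u \in gset h B ->
    (wgt (gset h B))%:C%C * eps K u (gset u^-1 (gset h B)) * a (loc (gset u^-1 (gset h B)) f) u
    = (wgt B)%:C%C * eps K h B * a (loc B f) h.
  move=> uA; have hk := base_gset sA uA; rewrite -gsetM in hk *.
  rewrite wgt_gset loc_rtr // (linZ _ _ (Cr_lin Ca)) Cr_rtr //.
  have -> : eps K h B = eps K (u^-1 * h)%g B * eps K u (gset (u^-1 * h) B).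
    by rewrite -epsM mulVKg.
  have -> : (eps K (u^-1 * h) B *: rtr (u^-1 * h) (a (loc B f)) : E) u =
      eps K (u^-1 * h) B * a (loc B f) (u * (u^-1 * h))%g.
    by rewrite -(rtrE _ (a (loc B f))).
  by rewrite mulVKg; ring.
rewrite (eq_big_seq _ term) big_const_seq count_predT iter_addr_0 -mulr_natr card_gset.
transitivity (((wgt B ^+ 2 * #|` B|%:R)%:C)%C * (eps K h B * eps K h B) * a (loc B f) h).
  rewrite !rmorphM /= rmorph_nat; ring.
by rewrite wgt_sqr // eps_sqr !mul1r.
Qed.

Lemma rho_fun_off a f A : ~ smp A -> rho_fun a f A = 0.
Proof. by rewrite /rho_fun; case: asboolP. Qed.

Lemma rho_val a f : Cr a -> rips_val (rho a f) = rho_fun a f :> ({fset G} -> C).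
Proof.
move=> Ca; have sq : sqsum (rho_fun a f).
  rewrite /sqsum -/(tsum _) -/(nsq _) -raw_isometry; last exact: rho_fun_off.
  rewrite big_seq; apply: lte_sum_pinfty => B hB; rewrite raw_rho //.
  by rewrite ell2_nsq ltry.
rewrite /rho rmkE to_ell2E // => A nA; exact: rho_fun_off.
Qed.

Lemma loc_rho a f B : Cr a -> B \in bases -> loc B (rho a f) = a (loc B f).
Proof.
move=> Ca hB; apply: ell2_ext => h; rewrite locE // rho_val //.
by have := congr1 (fun v => v h) (raw_rho f Ca hB).
Qed.

Lemma rho_linear a : Cr a -> linear (rho a).
Proof.
move=> Ca c f f'; apply: loc_inj => B hB.
transitivity (a (loc B (c *: f + f'))); first exact: (loc_rho _ Ca hB).
rewrite (loc_linear c f f' hB) (loc_linear c (rho a f) (rho a f') hB).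
transitivity (c *: a (loc B f) + a (loc B f')); first exact: (Cr_lin Ca c (loc B f) (loc B f')).
exact: (congr2 (fun u v : E => c *: u + v) (esym (loc_rho f Ca hB)) (esym (loc_rho f' Ca hB))).
Qed.

Lemma rho_norm a f (M : K) : Cr a -> 0 <= M ->
  (forall v, hnorm (a v) <= M * hnorm v) -> hnorm (rho a f) <= M * hnorm f.
Proof.
move=> Ca M0 hM; rewrite -(@ler_pXn2r _ 2) ?nnegrE ?mulr_ge0 ?hnorm_ge0 //.
rewrite exprMn !loc_norm mulr_sumr big_seq [leRHS]big_seq; apply: ler_sum => B hB.
rewrite loc_rho // -exprMn ler_pXn2r ?nnegrE ?mulr_ge0 ?hnorm_ge0 //.
Qed.

Lemma rho_bounded a : Cr a -> bounded_op (rho a).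
Proof.
move=> Ca; have [M M0 hM] := bounded_op_bound (Cr_bounded Ca).
by apply: (@bounded_opP _ _ _ M); [exact: rho_linear|move=> f; exact: rho_norm].
Qed.

Lemma rho_lincomb c a b : Cr a -> Cr b ->
  rho (fun v => c *: a v + b v) = (fun f => c *: rho a f + rho b f).
Proof.
move=> Ca Cb; apply/funext => f; apply: loc_inj => B hB.
rewrite (loc_linear c (rho a f) (rho b f) hB) (loc_rho f Ca hB) (loc_rho f Cb hB).
exact: (loc_rho f (Cr_linear c Ca Cb) hB).
Qed.

Lemma rho_mul a b : Cr a -> Cr b -> rho (a \o b) = rho a \o rho b.
Proof.
move=> Ca Cb; apply/funext => f; apply: loc_inj => B hB.
transitivity (a (b (loc B f))); first exact: (loc_rho f (Cr_mul Ca Cb) hB).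
transitivity (a (loc B (rho b f))); first by rewrite (loc_rho f Cb hB).
exact/esym/(loc_rho (rho b f) Ca hB).
Qed.

Lemma rho_adjoint a b : Cr a -> Cr b -> is_adjoint a b -> is_adjoint (rho a) (rho b).
Proof.
move=> Ca Cb ad f f'; rewrite !loc_inner big_seq [RHS]big_seq.
by apply: eq_bigr => B hB; rewrite !loc_rho.
Qed.

Lemma rho_id : rho id = id.
Proof. by apply/funext => f; apply: loc_inj => B hB; rewrite loc_rho //; exact: id_Cr. Qed.

Lemma rho_representation : is_representation Cr rho.
Proof.
by split; [exact: rho_bounded|exact: rho_lincomb|exact: rho_mul|exact: rho_adjoint].
Qed.

Lemma rho_nondegenerate : Defs.nondegenerate Cr rho.
Proof.
apply/seteqP; split=> // v _ e e0; exists v; last by rewrite subrr (hnorm0 hH).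
exists 1%N, (fun=> 1), (fun=> v); split.
  by move=> _; exists id, v; split; [exact: id_Cr|rewrite rho_id].
by rewrite big_ord_recl big_ord0 scale1r addr0.
Qed.

Lemma rho_support a f A : Cr a -> rips_val (rho a f) A != 0 ->
  exists2 B, rips_val f B != 0 & #|` B| = #|` A|.
Proof.
move=> Ca h; apply: contrapT => nB.
have sA : smp A by apply: contrapT => nA; move: h; rewrite rips_off // eqxx.
have [A0 _] := sA; have [u uA] := fset0Pn _ A0; have hB := base_gset sA uA.
have l0 : loc (gset u^-1 A) f = 0.
  apply: ell2_ext => k; rewrite locE //.
  have [->|f0] := eqVneq (rips_val f (gset k (gset u^-1 A))) 0; first by rewrite mulr0.
  by case: nB; exists (gset k (gset u^-1 A)); rewrite ?card_gset.
have := congr1 (fun v : E => v u) (loc_rho f Ca hB).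
rewrite l0 (lin0 (Cr_lin Ca)) /= locE // gsetKV => /eqP.
rewrite -[X in _ == X]/(0 : C) !mulf_eq0 (negPf (eps_neq0 _ _)) (negPf h) orbF orbF.
by apply/negP/wgt_neq0/simplex_gset.
Qed.

Lemma rho_even a : Cr a -> even_op (H_even S R) (H_odd S R) (rho a).
Proof.
by move=> Ca; split=> f hf A /(rho_support Ca)[B /hf + <-].
Qed.

Lemma rho_translation g f A : rips_val (rho (tr g) f) (gset g A) = eps K g A * rips_val f A.
Proof.
have [sA|nA] := pselect (smp A); last first.
  by rewrite !rips_off ?mulr0 // => /simplex_gset.
have [A0 _] := sA; have [u uA] := fset0Pn _ A0; have hB := base_gset sA uA.
have := congr1 (fun v : E => v (g * u)%g) (loc_rho f (tr_Cr K g) hB).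
rewrite /= trE !locE // mulKg gsetM gsetKV epsM gsetKV.
have := wgt_neq0 ((in_bases _).1 hB).1; set w_ := (_%:C)%C => w0.
have e1 := eps_sqr K g A; have e2 := eps_neq0 u (gset u^-1 A).
set x1 := eps K u _ in e2 *; set x2 := eps K g A in e1 *.
set y1 := rips_val (rho _ _) _; set y2 := rips_val f A => h.
apply: (mulfI (mulf_neq0 w0 e2)).
transitivity (w_ * (x1 * x2) * y1 * x2); last by rewrite h; ring.
transitivity (w_ * x1 * y1 * (x2 * x2)); [by rewrite e1 mulr1|by ring].
Qed.

Lemma rho_extends : extends_translation rho.
Proof.
move=> g s os; have [us s0 ds] := os.
have os' : oriented_simplex S R [seq (g * y)%g | y <- s].
  split; first by rewrite map_inj_uniq //; exact: mulgI.
    by case: (s) s0.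
  by move=> p q /= /mapP[p' ps ->] /mapP[q' qs ->]; rewrite wdist_mul; exact: ds.
apply: rips_ext => A sA; rewrite -(gsetKV g A) rho_translation !e_E // !wedgeE.
set B := gset g^-1 A; have [eB|nB] := pselect (B =i s).
  by rewrite wedge_gset // mulrC.
have -> : wedge_coef K s B = 0.
  by apply/eqP; apply: contraT => /wedge_coef_neq0[_ e]; case: nB => y; rewrite e !inE.
rewrite mulr0; apply/esym/eqP; apply: contraT => /wedge_coef_neq0[_ e].
case: nB => y; have := congr1 (fun D : {fset G} => (g * y)%g \in D) e.
by rewrite in_gset mulKg !inE mem_map //; exact: mulgI.
Qed.

End Representation.


(** * Compact operators and singular values *)

Section Summation.
Variable K : realType.

Lemma powR_expn (c : K) (p : K) (n : nat) : 0 <= c -> (c ^+ n) `^ p = (c `^ p) ^+ n.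
Proof.
move=> c0; elim: n => [|n IHn]; first by rewrite !expr0 powR1.
by rewrite !exprS powRM ?exprn_ge0 // IHn.
Qed.

(** The block of indices between m q^j and m q^(j+1) contributes at most a constant
times (q lam^p)^j. *)
Lemma geometric_summable (s : nat -> K) (m q : nat) (c lam p D : K) :
  (1 < q)%N -> (0 < m)%N -> 0 <= c -> 0 < lam -> 0 < p -> q%:R * lam `^ p < 1 ->
  (forall N, 0 <= s N <= D) ->
  (forall n N, (m * q ^ n <= N)%N -> s N <= c * lam ^+ n) ->
  (\sum_(0 <= N <oo) (s N `^ p)%:E < +oo)%E.
Proof.
move=> q1 m0 c0 l0 p0 r1 sD hs; set r := q%:R * lam `^ p in r1.
have r0 : 0 <= r by rewrite mulr_ge0 ?powR_ge0.
pose A : K := (m * q)%:R * c `^ p; pose B : K := (m%:R * D `^ p) + A / (1 - r).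
have A0 : 0 <= A by rewrite mulr_ge0 ?powR_ge0.
have r1' : 0 < 1 - r by rewrite subr_gt0.
have s0 N : 0 <= s N by have /andP[] := sD N.
have part j : \sum_(0 <= N < m * q ^ j) s N `^ p + A * r ^+ j / (1 - r) <= B.
  elim: j => [|j IHj].
    rewrite expn0 muln1 expr0 mulr1 /B lerD2r.
    apply: (@le_trans _ _ (\sum_(0 <= N < m) D `^ p)).
      apply: ler_sum => N _; have /andP[h1 h2] := sD N.
      by rewrite ge0_ler_powR ?nnegrE // ?(ltW p0) // (le_trans h1).
    by rewrite big_const_nat iter_addr_0 subn0 -[leLHS]mulr_natl.
  apply: le_trans IHj.
  have le1 : (m * q ^ j <= m * q ^ j.+1)%N by rewrite leq_mul2l leq_exp2l // leqnSn orbT.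
  rewrite (@big_cat_nat _ _ _ (m * q ^ j)) //= -addrA lerD2l.
  have b1 : \sum_(m * q ^ j <= N < m * q ^ j.+1) s N `^ p <= A * r ^+ j.
    apply: (@le_trans _ _ (\sum_(m * q ^ j <= N < m * q ^ j.+1) (c * lam ^+ j) `^ p)).
      rewrite big_nat_cond [leRHS]big_nat_cond; apply: ler_sum => N /andP[/andP[h1 _] _].
      rewrite ge0_ler_powR ?nnegrE ?(ltW p0) ?mulr_ge0 ?exprn_ge0 ?(ltW l0) //.
      exact: hs.
    rewrite big_const_nat iter_addr_0 -[leLHS]mulr_natl powRM ?exprn_ge0 ?(ltW l0) //.
    rewrite powR_expn ?(ltW l0) // /A /r exprMn.
    apply: (@le_trans _ _ ((m * q ^ j.+1)%:R * (c `^ p * (lam `^ p) ^+ j))).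
      by rewrite ler_wpM2r ?mulr_ge0 ?exprn_ge0 ?powR_ge0 // ler_nat leq_subr.
    rewrite le_eqVlt; apply/orP; left; apply/eqP.
    by rewrite !natrM natrX exprS; ring.
  apply: le_trans (lerD b1 (lexx _)) _.
  rewrite le_eqVlt; apply/orP; left; apply/eqP; rewrite exprS; field.
  by rewrite gt_eqF.
apply: (@le_lt_trans _ _ B%:E); last exact: ltry.
apply: lime_le.
  by apply: is_cvg_nneseries => n _ _; rewrite lee_fin powR_ge0.
near=> k; rewrite sumEFin lee_fin.
apply: (@le_trans _ _ (\sum_(0 <= N < m * q ^ k) s N `^ p)).
  rewrite [leRHS](@big_cat_nat _ _ _ k) //=; last first.
    apply: (@leq_trans (q ^ k)); first exact: ltnW (ltn_expl _ q1).
    by rewrite leq_pmull.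
  by rewrite lerDl; apply: sumr_ge0 => N _; exact: powR_ge0.
apply: le_trans (part k); rewrite lerDl mulr_ge0 ?invr_ge0 ?(ltW r1') // mulr_ge0 ?exprn_ge0 //.
Unshelve. all: by end_near. Qed.

End Summation.

Section DecayingOperators.
Variables (K : realType) (G : groupType) (S : {fset G}).
Hypothesis genS : generating S.
Variable R : K.
Hypothesis R0 : 0 <= R.
Local Notation C := K[i].
Local Notation H := (H_R S R).
Local Notation hH := (@rips_hilbert K G S R).
Local Notation smp := (simplex S R).
Variable x : G.
Local Notation far := (@far K G S R x).
Implicit Types (f v : H) (A B : {fset G}) (T : H -> H).

(** The translates of the bases by the ball around x. Their number is at most a
constant times the size of the ball. *)
Definition nears n : seq {fset G} :=
  undup [seq gset (x * h)%g B | h <- enum_fset (ball S n), B <- enum_fset (bases S R)].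

Lemma size_nears n : (size (nears n) <= #|` ball S n| * #|` bases S R|)%N.
Proof. by apply: leq_trans (size_undup _) _; rewrite size_allpairs. Qed.

Lemma nears_simplex n A : A \in nears n -> smp A.
Proof.
rewrite mem_undup => /allpairsP[[h B] /= [_ hB ->]]; apply/simplex_gset.
by have [] := (in_bases genS R0 B).1 hB.
Qed.

Lemma in_nears n A a : smp A -> a \in A -> (wdist S x a <= n)%N -> A \in nears n.
Proof.
move=> sA aA an; rewrite mem_undup; apply/allpairsP.
exists ((x^-1 * a)%g, gset a^-1 A); split=> /=.
- exact: (mem_ball genS).
- exact: base_gset.
- by rewrite mulVKg gsetKV.
Qed.

Definition trunc n f : H := \sum_(A <- nears n) rips_val f A *: bvec S R A.

Lemma rips_sumE (J : Type) (r : seq J) (F : J -> H) A :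
  rips_val (\sum_(j <- r) F j) A = \sum_(j <- r) rips_val (F j) A.
Proof. by elim/big_rec2: _ => [|j y1 y2 _ <-]. Qed.

Lemma truncE n f A : rips_val (trunc n f) A = if A \in nears n then rips_val f A else 0.
Proof.
rewrite /trunc rips_sumE.
transitivity (\sum_(B <- nears n) rips_val f B * (A == B)%:R).
  rewrite big_seq [RHS]big_seq; apply: eq_bigr => B hB.
  by rewrite rips_valZ bvecE //; exact: nears_simplex hB.
case: ifPn => hA.
  rewrite (bigD1_seq A) ?undup_uniq //= eqxx mulr1 big1 ?addr0 // => B /negPf.
  by rewrite eq_sym => ->; rewrite mulr0.
rewrite big_seq big1 // => B hB; case: eqP => [e|_]; last by rewrite mulr0.
by move: hA; rewrite e hB.
Qed.

Lemma far_trunc n f : far n (f - trunc n f).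
Proof.
move=> A [a aA an]; rewrite rips_valB truncE.
have [sA|nA] := pselect (smp A); first by rewrite (in_nears sA aA an) subrr.
by rewrite rips_off // if_same subrr.
Qed.

Lemma trunc_le n f : hnorm (f - trunc n f) <= hnorm f.
Proof.
rewrite rips_hnorm; apply: ell2_hnorm_le; first exact: hnorm_ge0.
rewrite rips_hnorm -ell2_nsq; apply: le_tsum => A.
rewrite rips_valB truncE; case: ifP => _; last by rewrite subr0.
by rewrite subrr csq0 csq_ge0.
Qed.

(** For linear T, this says that T is the limit in norm of its truncations of finite rank. *)
Definition vanish T := forall e : K, 0 < e -> exists n, forall f, far n f ->
  hnorm (T f) <= e * hnorm f.

Definition decays (lam : K) T := exists2 c : K, 0 <= c & forall n f, far n f ->
  hnorm (T f) <= c * lam ^+ n * hnorm f.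

Lemma decays_vanish lam T : 0 < lam -> lam < 1 -> decays lam T -> vanish T.
Proof.
move=> l0 l1 [c c0 hT] e e0.
have [d d0 hd] := small_factor c0 e0.
have : (fun n => lam ^+ n) @ \oo --> (0 : K).
  by apply: cvg_expr; rewrite ger0_norm // ltW.
move/cvgrPdist_lt => /(_ d d0)[N _ /(_ N (leqnn N)) hN].
exists N => f hf; apply: le_trans (hT N f hf) _; rewrite ler_wpM2r ?hnorm_ge0 //.
move: hN; rewrite /= sub0r normrN ger0_norm ?exprn_ge0 ?(ltW l0) // => /ltW hN.
exact: le_trans (ler_wpM2l c0 hN) hd.
Qed.

Lemma decays_linear lam c T1 T2 : 0 < lam -> decays lam T1 -> decays lam T2 ->
  decays lam (fun f => c *: T1 f + T2 f).
Proof.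
move=> l0 [c1 c10 h1] [c2 c20 h2]; have q0 := sqrtr_ge0 (csq c); set q := Num.sqrt (csq c) in q0.
exists (q * c1 + c2) => [|n f hf]; first by rewrite addr_ge0 // mulr_ge0.
apply: le_trans (hnormD hH _ _) _; rewrite (hnormZ hH) -/q !mulrDl.
apply: lerD; last exact: h2.
by rewrite -!mulrA ler_wpM2l // mulrA h1.
Qed.

Section Compactness.
Variables (F : set_system nat) (uF : UltraFilter F) (ooF : \oo `<=` F).

(** The limit is the supremum of the t which lie below the sequence along F. *)
Lemma ultra_real (s : nat -> K) (M : K) : (forall n, `|s n| <= M) ->
  exists l, forall e : K, 0 < e -> F [set n | `|s n - l| < e].
Proof.
move=> sM; pose Q := [set t : K | F [set n | t <= s n]].
have Q0 : Q (- M).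
  rewrite /Q /= (_ : [set n | _] = setT); first exact: filterT.
  by apply/seteqP; split=> // n _ /=; have := sM n; rewrite ler_norml => /andP[].
have Qub : ubound Q M.
  move=> t; rewrite /Q /= => Ft; have [n /= tn] := filter_ex Ft.
  by apply: le_trans tn _; apply: le_trans (ler_norm _) (sM n).
have hs : has_sup Q by split; [exists (- M)|exists M].
exists (sup Q) => e e0.
have [t Qt lt] : exists2 t, Q t & sup Q - e < t.
  by have [t Qt ht] := sup_adherent e0 hs; exists t.
(* above the supremum the ultrafilter contains the complement *)
have nQ : ~ Q (sup Q + e / 2).
  by move=> /(sup_upper_bound hs); rewrite gerDl leNgt divr_gt0.
have Fc : F (~` [set n | sup Q + e / 2 <= s n]).
  by have [//|] := in_ultra_setVsetC [set n | sup Q + e / 2 <= s n] uF.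
apply: filterS (filterI Qt Fc) => n [/= h1 /negP]; rewrite -ltNge => h2.
by rewrite ltr_norml; apply/andP; split; lra.
Qed.

Lemma ultra_coord (u : nat -> H) (M : K) A : (forall n, hnorm (u n) <= M) ->
  exists z : C, forall e : K, 0 < e -> F [set n | csq (rips_val (u n) A - z) < e].
Proof.
move=> uM; have cM n : csq (rips_val (u n) A) <= `|M| ^+ 2.
  apply: le_trans (csq_rips_le _ _) _; rewrite ler_pXn2r ?nnegrE ?hnorm_ge0 //.
  by apply: le_trans (uM n) (ler_norm _).
have [a ha] := @ultra_real (fun n => complex.Re (rips_val (u n) A)) `|M| (fun n => ltac:(
  rewrite -(@ler_pXn2r _ 2) ?nnegrE // real_normK ?num_real //;
  apply: le_trans (cM n); rewrite /csq lerDl sqr_ge0 //)).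
have [b hb] := @ultra_real (fun n => complex.Im (rips_val (u n) A)) `|M| (fun n => ltac:(
  rewrite -(@ler_pXn2r _ 2) ?nnegrE // real_normK ?num_real //;
  apply: le_trans (cM n); rewrite /csq lerDr sqr_ge0 //)).
exists (a +i* b)%C => e e0.
have d0 : 0 < Num.sqrt (e / 2) by rewrite sqrtr_gt0 divr_gt0.
apply: filterS (filterI (ha _ d0) (hb _ d0)) => n [h1 h2].
by apply: csq_lt => //; rewrite raddfB.
Qed.

(** Far from x the operator is small, and the finitely many remaining coordinates
of the sequence converge along F. *)
Lemma ultra_image T (u : nat -> H) (M : K) : linear T -> vanish T -> (forall n, hnorm (u n) <= M) ->
  forall e : K, 0 < e -> exists v, F [set n | hnorm (T (u n) - v) <= e].
Proof.
move=> lT vT uM e e0.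
have M0 : 0 <= M by apply: le_trans (uM 0%N); exact: hnorm_ge0.
have [d1 d10 hd1] := small_factor M0 (divr_gt0 e0 (ltr0n K 2)).
have [n0 hn0] := vT _ d10.
pose z A := projT1 (cid (ultra_coord A uM)).
have hz A : forall d : K, 0 < d -> F [set n | csq (rips_val (u n) A - z A) < d].
  by rewrite /z; case: cid.
pose w r : H := \sum_(A <- r) z A *: bvec S R A.
have main (r : seq {fset G}) (d : K) : 0 < d ->
    F [set n | hnorm (T (\sum_(A <- r) rips_val (u n) A *: bvec S R A) - T (w r)) < d].
  elim: r d => [|A r IHr] d d0.
    rewrite (_ : [set n | _] = setT); first exact: filterT.
    apply/seteqP; split=> // n _ /=.
    by rewrite /w !big_nil subrr (hnorm0 hH).
  have d2 : 0 < d / 2 by rewrite divr_gt0.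
  have [t t0 ht] := small_factor (hnorm_ge0 (T (bvec S R A))) d2.
  have d3 : 0 < t ^+ 2 by rewrite exprn_gt0.
  apply: filterS (filterI (hz A _ d3) (IHr _ d2)) => n /= [h1 h2].
  rewrite /w !big_cons !lT opprD addrACA -scalerBl -/(w r).
  apply: le_lt_trans (hnormD hH _ _) _; rewrite (hnormZ hH).
  have h3 : Num.sqrt (csq (rips_val (u n) A - z A)) <= t.
    by rewrite -[leRHS](ger0_norm (ltW t0)) -sqrtr_sqr ler_sqrt ?ltW.
  have h4 : Num.sqrt (csq (rips_val (u n) A - z A)) * hnorm (T (bvec S R A)) <= d / 2.
    by apply: le_trans ht; rewrite mulrC ler_wpM2l ?hnorm_ge0.
  have -> : d = d / 2 + d / 2 by field.
  exact: ler_ltD.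
have e2 : 0 < e / 2 by rewrite divr_gt0.
exists (T (w (nears n0))); apply: filterS (main (nears n0) _ e2) => n /= hn.
apply: le_trans (hnorm_dist hH (T (trunc n0 (u n))) _ _) _.
have -> : e = e / 2 + e / 2 by field.
apply: lerD; last exact: ltW.
rewrite -(linB _ _ lT); apply: le_trans (hn0 _ (@far_trunc n0 (u n))) _.
apply: le_trans hd1; rewrite mulrC ler_wpM2r ?(ltW d10) //.
exact: le_trans (trunc_le _ _) (uM n).
Qed.

End Compactness.

(** Along an ultrafilter finer than the neighbourhoods of infinity, the images of a
bounded sequence come within e of some fixed vector, for each e. A subsequence whose
j-th member does so for the first j tolerances is a Cauchy sequence. *)
Lemma vanish_compact T : linear T -> vanish T -> compact_op T.
Proof.
move=> lT vT; split=> // u [M uM].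
have [F [uF ooF]] := @ultraFilterLemma nat \oo _.
have ev N : F [set n | (N < n)%N] by apply: ooF; exists N.+1.
pose V j := projT1 (cid (ultra_image uF lT vT uM (e := j.+1%:R^-1) ltac:(by rewrite invr_gt0))).
have hV j : F [set n | hnorm (T (u n) - V j) <= j.+1%:R^-1] by rewrite /V; case: cid.
have hW j : F [set n | forall i, (i <= j)%N -> hnorm (T (u n) - V i) <= i.+1%:R^-1].
  elim: j => [|j IHj].
    by apply: filterS (hV 0%N) => n /= h i; rewrite leqn0 => /eqP ->.
  apply: filterS (filterI IHj (hV j.+1)) => n /= [h1 h2] i.
  by rewrite leq_eqVlt => /orP[/eqP -> //|]; rewrite ltnS => /h1.
have pick j N : exists n, (N < n)%N /\ forall i, (i <= j)%N -> hnorm (T (u n) - V i) <= i.+1%:R^-1.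
  by have [n [h1 h2]] := filter_ex (filterI (ev N) (hW j)); exists n.
pose nx j N := projT1 (cid (pick j N)).
have hnx j N : (N < nx j N)%N /\ forall i, (i <= j)%N ->
    hnorm (T (u (nx j N)) - V i) <= i.+1%:R^-1 by rewrite /nx; case: cid.
pose k := fix k j := if j is j'.+1 then nx j (k j') else nx 0%N 0%N.
exists k; first by move=> n; have [] := hnx n.+1 (k n).
have hk j i : (i <= j)%N -> hnorm (T (u (k j)) - V i) <= i.+1%:R^-1.
  by case: j => [|j] /=; [have [_] := hnx 0%N 0%N|have [_] := hnx j.+1 (k j)]; apply.
have cau : hcauchy (fun n => T (u (k n))).
  move=> e e0; have e2 : 0 < e / 2 by rewrite divr_gt0.
  have [N hN] : exists N : nat, N.+1%:R^-1 < e / 2.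
    exists (Num.truncn (e / 2)^-1); rewrite invf_plt ?posrE //.
    have h0 : 0 <= (e / 2)^-1 by rewrite invr_ge0 ltW.
    by have /andP[] := truncn_itv h0.
  exists N => m n Nm Nn; apply: le_lt_trans (hnorm_dist hH (V N) _ _) _.
  have h1 := hk m N Nm; have h2 := hk n N Nn; rewrite (hnormBC hH) in h2.
  have -> : e = e / 2 + e / 2 by field.
  exact: ltrD (le_lt_trans h1 hN) (le_lt_trans h2 hN).
by have [v hv] := inner_complete hH cau; exists v.
Qed.

(** ** Singular values *)

Lemma trunc_linear n : linear (trunc n).
Proof.
move=> c f f'; apply: rips_ext => A _; rewrite rips_valE !truncE rips_valE.
by case: ifP => // _; rewrite mulr0 addr0.
Qed.

Lemma trunc_bounded n : bounded_op (trunc n).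
Proof.
apply: (@bounded_opP _ _ _ 2); first exact: trunc_linear.
move=> f; have := hnorm_dist hH (trunc n f - f) (trunc n f) 0.
have := trunc_le n f; rewrite (hnormBC hH); rewrite !subr0.
have := hnormD hH (trunc n f - f) f; rewrite subrK; lra.
Qed.

Lemma trunc_rank T n N : linear T -> (size (nears n) <= N)%N ->
  rank_le N (fun f => T (trunc n f)).
Proof.
move=> lT sN; exists (fun i => T (bvec S R (nth fset0 (nears n) i))) => f.
exists (fun i => if (i < size (nears n))%N then rips_val f (nth fset0 (nears n) i) else 0).
rewrite /trunc linsum // (big_nth fset0) big_mkord.
rewrite (big_ord_widen _ (fun i => T (rips_val f (nth fset0 (nears n) i) *: bvec S R (nth fset0 (nears n) i))) sN).
rewrite big_mkcond; apply: eq_bigr => i _; case: ifP => _; first by rewrite linZ.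
by rewrite scale0r.
Qed.

Lemma singular_value_le T T' N (e : K) : bounded_op T -> bounded_op T' -> rank_le N T' ->
  0 <= e -> (forall f, hnorm (T f - T' f) <= e * hnorm f) -> singular_value T N <= e.
Proof.
move=> bT bT' rT' e0 he; rewrite /singular_value.
apply: (@le_trans _ _ (opnorm (fun f => T f - T' f))); last exact: (opnorm_le hH).
apply: ge_inf; last by exists T'.
exists 0 => _ [T1 [b1 _] <-]; apply: (opnorm_ge0 hH); exact: (bounded_opB hH bT b1).1.
Qed.

Lemma rank_le0 N : rank_le N (fun=> 0 : H).
Proof.
exists (fun=> 0) => f; exists (fun=> 0); rewrite big1 // => i _; exact: scaler0.
Qed.

Lemma singular_value_ge0 T N : bounded_op T -> 0 <= singular_value T N.
Proof.
move=> bT; apply: lb_le_inf.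
  exists (opnorm (fun f => T f - (fun=> 0) f)), (fun=> 0) => //.
  by split; [exact: (bounded_op0 hH)|exact: rank_le0].
move=> _ [T1 [b1 _] <-]; apply: (opnorm_ge0 hH); exact: (bounded_opB hH bT b1).1.
Qed.

(** The truncation to the ball of radius n has rank at most a constant times the
size of that ball, hence at most m q^n, and its error is at most c lam^n. *)
Lemma decays_schatten T (q : nat) (lam p : K) : bounded_op T -> decays lam T ->
  (1 < q)%N -> 0 < lam -> lam < 1 -> 0 < p -> q%:R * lam `^ p < 1 ->
  (forall n, (#|` ball S n| <= q ^ n)%N) -> schatten p T.
Proof.
move=> bT dT q1 l0 l1 p0 qlp hq; have lT := bT.1.
split=> //; first exact: (vanish_compact lT (decays_vanish l0 l1 dT)).
have [c c0 hc] := dT; have [M M0 hM] := bounded_op_bound bT.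
pose m := (#|` bases S R|).+1.
apply: (@geometric_summable _ _ m q c lam p M) => // [N|n N mN].
  rewrite (singular_value_ge0 N bT) /=.
  apply: (singular_value_le bT (bounded_op0 hH) (rank_le0 N) M0) => f.
  by rewrite subr0.
have sN : (size (nears n) <= N)%N.
  apply: leq_trans mN; apply: leq_trans (size_nears n) _.
  by rewrite mulnC leq_mul // leqnSn.
have cl0 : 0 <= c * lam ^+ n by rewrite mulr_ge0 // exprn_ge0 // ltW.
apply: (singular_value_le bT (bounded_op_comp bT (trunc_bounded n)) (trunc_rank lT sN) cl0).
move=> f /=; rewrite -(linB f (trunc n f) lT).
apply: le_trans (hc n _ (@far_trunc n f)) _.
by rewrite ler_wpM2l // trunc_le.
Qed.

End DecayingOperators.


(** * Choice of the decay rate *)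

(** From ln (1 + v) <= v one gets ln lambda1 <= - (1 + |S|)^(-2 delta) / (10 delta),
so that the bound on p makes (1 + |S|) lambda1^p less than 1. If S is empty then
lambda1 = 0 and some other positive number takes its place. *)
Lemma decay_rate (K : realType) (G : groupType) (S : {fset G}) (delta : nat) (p : K) :
  (0 < delta)%N ->
  20 * delta%:R * ln (1 + #|` S|%:R) * (1 + #|` S|%:R) ^+ (2 * delta) < p ->
  exists (q : nat) (lam : K), [/\ (1 < q)%N /\ 0 < p, 0 < lam < 1,
    lambda1 K S delta <= lam, q%:R * lam `^ p < 1 &
    forall n, (#|` ball S n| <= q ^ n)%N].
Proof.
move=> d0; have [s0|s0] := posnP #|` S|.
  (* S is empty: the rate is chosen such that lam^p = 1/4 *)
  rewrite s0 addr0 ln1 mulr0 mul0r => p0.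
  have l4 : 0 < ln (4 : K) by rewrite ln_gt0 // ltr1n.
  exists 2%N, (expR (- (ln 4 / p))); split=> //.
  - by rewrite expR_gt0 expR_lt1 oppr_lt0 divr_gt0.
  - rewrite /lambda1 s0 addr0 powR1 subrr powR0 ?expR_ge0 //.
    by rewrite invr_neq0 // mulf_neq0 // pnatr_eq0 -lt0n.
  - rewrite -expRM mulNr divfK ?gt_eqF // expRN lnK ?posrE //.
    by rewrite ltr_pdivrMr // mul1r ltr_nat.
  - move=> n; apply: leq_trans (card_ball S n) _; rewrite s0 exp1n expn_gt0 //.
set Q : K := 1 + _; have QE : Q = (1 + #|` S|)%:R by rewrite natrD.
have Q1 : 1 < Q by rewrite QE ltr1n.
have Q0 : 0 < Q by apply: lt_trans Q1.
have L0 : 0 < ln Q by rewrite ln_gt0.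
have dd : 0 < (10 * delta%:R : K) by rewrite mulr_gt0 // ltr0n.
set P := Q ^+ (2 * delta) => hp.
have P0 : 0 < P by rewrite exprn_gt0.
have P1 : 1 < P by rewrite exprn_egt1 // muln_eq0 /= -lt0n.
have p0 : 0 < p by apply: lt_trans hp; rewrite !mulr_gt0 // ltr0n.
pose u := 1 - P^-1.
have v1 : P^-1 < 1 by rewrite invf_lt1.
have v0 : 0 < P^-1 by rewrite invr_gt0.
have u0 : 0 < u by rewrite subr_gt0.
have lE : lambda1 K S delta = u `^ (10 * delta%:R)^-1.
  by rewrite /lambda1 -/Q -natrM powR_invn // ltW.
have lu : ln u <= - P^-1 by apply: le_ln1Dx; rewrite ltrN2.
exists (1 + #|` S|)%N, (lambda1 K S delta); split=> //.
- rewrite lE powR_gt0 //= /powR gt_eqF // expR_lt1 pmulr_rlt0 ?invr_gt0 //.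
  by apply: le_lt_trans lu _; rewrite oppr_lt0.
- rewrite -QE lE -powRrM -[Q]lnK ?posrE // /powR gt_eqF // -expRD expR_lt1.
  have -> : (10 * delta%:R)^-1 * p * ln u = p / (10 * delta%:R) * ln u by ring.
  have pd : 0 < p / (10 * delta%:R) by rewrite divr_gt0.
  have h1 : p / (10 * delta%:R) * ln u <= - (p / (10 * delta%:R) / P).
    by rewrite -mulrN ler_pM2l.
  have h2 : 2 * ln Q < p / (10 * delta%:R) / P.
    rewrite ltr_pdivlMr // ltr_pdivlMr //; apply: le_lt_trans hp.
    by rewrite le_eqVlt; apply/orP; left; apply/eqP; ring.
  have fin (a b c : K) : b <= - c -> 2 * a < c -> 0 < a -> a + b < 0 by lra.
  exact: fin h1 h2 L0.
- by move=> n; exact: card_ball.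
Qed.

(** * The Fredholm module *)

Section FredholmModule.
Variables (K : realType) (G : groupType) (S : {fset G}) (delta : nat).
Hypothesis hyp : hyperbolic_group K S delta.
Variables (w : G -> seq G) (hw : minimal_words S w).
Variables (C1 : K) (phi1 : G -> G -> {fsfun G -> rat with 0}).
Hypothesis hphi1 : mineyev_map S delta w C1 phi1.
Variables (R : K) (hR : 48 * delta%:R <= R).
Local Notation C := K[i].
Local Notation E := (ell2_space K G).
Local Notation hE := (@ell2_hilbert K G).
Local Notation H := (H_R S R).
Local Notation hH := (@rips_hilbert K G S R).
Local Notation smp := (simplex S R).
Local Notation Cr := (Cr K G).
Local Notation tr := (@translation K G).
Local Notation genS := (genS hyp).
Local Notation R0 := (R_ge0 hR).
Local Notation nbe := (nbe S R).
Local Notation F := (Fop phi1).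
Local Notation rho := (@rho K G S R).
Implicit Types (f : H) (A B : {fset G}) (x y z g : G).

Lemma big_gset (V : nmodType) g (A : {fset G}) (f : G -> V) :
  \sum_(y <- enum_fset (gset g A)) f y = \sum_(y <- enum_fset A) f (g * y)%g.
Proof.
rewrite -(big_map (fun y => (g * y)%g) predT f); apply: perm_big; apply: uniq_perm.
- exact: fset_uniq.
- by rewrite map_inj_uniq ?fset_uniq //; exact: mulgI.
move=> z; rewrite -[LHS]/(z \in gset g A) in_gset; apply/idP/mapP => [h|[t tA ->]].
  by exists (g^-1 * z)%g => //; rewrite mulVKg.
by rewrite mulKg.
Qed.

Lemma nbe_gset g A : nbe (gset g A) = gset g (nbe A).
Proof.
have half h B y : y \in nbe B -> (h * y)%g \in nbe (gset h B).
  move=> /(in_nbe hyp hR)[sB Uy By]; apply/(in_nbe hyp hR); split.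
  - exact/simplex_gset.
  - by apply/(U_gset hyp hR h y sB).
  - apply: contraNN By => /eqP/(congr1 (gset h^-1)); rewrite gsetK => ->.
    by apply/eqP/fsetP => z; rewrite in_gset !inE invgK (can_eq (mulKg h)).
apply/fsetP => y; rewrite in_gset; apply/idP/idP => [/(half g^-1%g)|/(half g)].
  by rewrite gsetK.
by rewrite mulVKg.
Qed.

(** The construction is equivariant in the pair formed by the base point and the
simplex, so that translation moves the base point. *)
Lemma Fop_translation g x f : F x (rho (tr g) f) = rho (tr g) (F (g^-1 * x)%g f).
Proof.
apply: rips_ext => A sA; rewrite -(gsetKV g A); set B := gset g^-1 A.
have sB : smp B by exact/simplex_gset.
transitivity (eps K g B * rips_val (F (g^-1 * x)%g f) B); last first.
  exact/esym/(rho_translation genS R0).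
rewrite (FopE hyp hw hphi1 hR x (rho (tr g) f) (gset g B)) nbe_gset big_gset.
rewrite (FopE hyp hw hphi1 hR (g^-1 * x)%g f B) mulr_sumr.
apply: eq_bigr => y _.
have -> : rips_val (rho (tr g) f) (toggle (g * y)%g (gset g B)) =
    eps K g (toggle y B) * rips_val f (toggle y B).
  by rewrite -gset_toggle; exact: (rho_translation genS R0).
have -> : cF S phi1 R x (gset g B) (g * y)%g =
    (zeta S R phi1 (g^-1 * x)%g [set` B] y)%:C%C * sigma K (g * y)%g (gset g B).
  by rewrite /cF -(zeta_gset hyp hphi1 hR g (g^-1 * x)%g y sB) mulVKg.
have e2 : sigma K (g * y)%g (gset g B) * eps K g (toggle y B) = eps K g B * sigma K y B.
  have h := eps_sigma K g y B; have h1 := eps_sqr K g B; have h2 := eps_sqr K g (toggle y B).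
  transitivity (eps K g B * (eps K g B * sigma K (g * y)%g (gset g B)) * eps K g (toggle y B)).
    by rewrite mulrA h1 mul1r.
  by rewrite -h -!mulrA h2 mulr1.
rewrite /cF.
transitivity ((zeta S R phi1 (g^-1 * x)%g [set` B] y)%:C%C *
  (sigma K (g * y)%g (gset g B) * eps K g (toggle y B)) * rips_val f (toggle y B)); first by ring.
by rewrite e2; ring.
Qed.

Section DecayRate.
Variables (lam : K) (l0 : 0 < lam) (l1 : lam < 1) (hl : lambda1 K S delta <= lam).

(** The commutator is translation by g composed with the difference of F at the base
points g^-1 x and x. *)
Lemma commutator_translation_decays x g :
  decays x lam (commutator (F x) (rho (tr g))).
Proof.
have [c c0 hc] := Fop_diff_decay hyp hw hphi1 hR x (g^-1 * x)%g l0 l1 hl.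
exists c; first exact: c0.
move=> n f hf; rewrite /commutator (Fop_translation g x f).
have lr : linear (rho (tr g)) by apply: (rho_linear genS R0); exact: tr_Cr.
rewrite -(linB (F (g^-1 * x)%g f) (F x f) lr).
apply: (@le_trans _ _ (1 * hnorm (F (g^-1 * x)%g f - F x f))).
  apply: (rho_norm genS R0) => //; first exact: tr_Cr.
  by move=> v; rewrite mul1r tr_hnorm.
by rewrite mul1r (hnormBC hH); exact: hc.
Qed.

Lemma rho_lin_tr_cons g (c : C) l :
  rho (lin_tr ((g, c) :: l)) = (fun f => c *: rho (tr g) f + rho (lin_tr l) f).
Proof.
rewrite -(rho_lincomb genS R0 c (tr_Cr K g) (lin_tr_Cr l)); congr (rho _).
by apply/funext => f; rewrite /lin_tr big_cons.
Qed.

Lemma rho_lin_tr_nil f : rho (lin_tr [::]) f = 0.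
Proof.
have C0 := lin_tr_Cr (K := K) (G := G) [::].
apply/(hnorm_eq0 hH)/eqP; rewrite eq_le hnorm_ge0 andbT -(mul0r (hnorm f)).
apply: (rho_norm genS R0) => // v.
by rewrite /lin_tr big_nil (hnorm0 hE) mul0r.
Qed.

Lemma commutator_lin_tr_decays x l : decays x lam (commutator (F x) (rho (lin_tr l))).
Proof.
have lF := Fop_linear hyp hw hphi1 hR x.
elim: l => [|[g c] l IHl].
  exists 0 => // n f _; rewrite /commutator !rho_lin_tr_nil lin0 // subrr.
  by rewrite (hnorm0 hH) !mul0r.
rewrite (_ : commutator _ _ = fun f => c *: commutator (F x) (rho (tr g)) f +
    commutator (F x) (rho (lin_tr l)) f).
  exact: (decays_linear c l0 (commutator_translation_decays x g) IHl).
apply/funext => f; rewrite /commutator rho_lin_tr_cons lF.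
by rewrite scalerBr opprD addrACA.
Qed.

(** The square of F differs from the identity at the simplex x alone, where far
vectors vanish. *)
Lemma square_decays x : decays x lam (fun f => F x (F x f) - f).
Proof.
exists 0 => // n f hf; rewrite !mul0r.
have -> : F x (F x f) - f = 0; last by rewrite (hnorm0 hH).
apply: rips_ext => A sA; transitivity (rips_val (F x (F x f)) A - rips_val f A) => //.
rewrite (Fop_sqr hyp hw hphi1 hR x f sA); case: eqP => [Ax|_]; last exact: subrr.
rewrite hf ?subr0 //; exists x; first by rewrite Ax inE.
by rewrite (wdistxx genS).
Qed.

Lemma adjoint_decays x : decays x lam (fun f => F x f - adjoint (F x) f).
Proof.
exists 0 => // n f _; rewrite (adjointE hH (Fop_selfadjoint hyp hw hphi1 hR x)).
by rewrite subrr (hnorm0 hH) !mul0r.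
Qed.

End DecayRate.

Lemma commutator_bounded x a : Cr a -> bounded_op (commutator (F x) (rho a)).
Proof.
move=> Ca; have bF := Fop_bounded hyp hw hphi1 hR x; have br := rho_bounded genS R0 Ca.
exact: (bounded_opB hH (bounded_op_comp bF br) (bounded_op_comp br bF)).
Qed.

(** Vanishing at infinity passes to limits in norm, hence from the group ring to
its closure. *)
Lemma commutator_vanish x a : Cr a -> vanish x (commutator (F x) (rho a)).
Proof.
move=> Ca e e0; have bF := Fop_bounded hyp hw hphi1 hR x; have lF := bF.1.
have [M M0 hM] := bounded_op_bound bF.
have [d e1 hd] := small_factor M0 (divr_gt0 e0 (ltr0n K 4)).
have [_ /(_ _ e1)[l hla]] := (CrP a).1 Ca.
have Cl := lin_tr_Cr (K := K) l.
pose D f := rho a f - rho (lin_tr l) f.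
have hD f : hnorm (D f) <= d * hnorm f.
  have -> : D f = rho (fun v => (-1) *: lin_tr l v + a v) f.
    by rewrite (rho_lincomb genS R0 (-1) Cl Ca) scaleN1r addrC.
  apply: (rho_norm genS R0); [exact: Cr_linear|exact: ltW|move=> v].
  by rewrite scaleN1r addrC.
have [lam [l0 l1 hl]] : exists lam : K, [/\ 0 < lam, lam < 1 & lambda1 K S delta <= lam].
  (* any exponent beyond the bound provides a rate *)
  have d0 := delta_gt0 hyp; have := @decay_rate K G S delta _ d0 (ltr_pwDr (ltr01) (lexx _)).
  by move=> [q [lam [_ /andP[l0 l1] hl _ _]]]; exists lam.
have [n hn] := decays_vanish l0 l1 (commutator_lin_tr_decays l0 l1 hl x l) (e := e / 2) ltac:(by rewrite divr_gt0).
exists n => f hf.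
have -> : commutator (F x) (rho a) f =
    commutator (F x) (rho (lin_tr l)) f + (F x (D f) - D (F x f)).
  rewrite /commutator /D (linB _ _ lF); move: (F x (rho _ f)) (rho _ (F x f)) (F x (rho _ f)) (rho _ (F x f)).
  by move=> a1 a2 a3 a4; rewrite [- (_ - a2)]opprB addrACA addKr [a1 + _]addrC subrK.
have h1 := hn f hf; have h2 := hD (F x f); have h3 := hM (D f).
have h4 : hnorm (F x (D f)) <= e / 4 * hnorm f.
  apply: le_trans h3 _; apply: le_trans (ler_wpM2l M0 (hD f)) _.
  by rewrite mulrA ler_wpM2r ?hnorm_ge0.
have h5 : hnorm (D (F x f)) <= e / 4 * hnorm f.
  apply: le_trans h2 _; apply: le_trans (ler_wpM2l (ltW e1) (hM f)) _.
  by rewrite mulrA ler_wpM2r ?hnorm_ge0 // mulrC.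
apply: le_trans (hnormD hH _ _) _.
have h6 := hnormB hH (F x (D f)) (D (F x f)).
move: h1 h4 h5 h6; generalize (hnorm (F x (D f))) (hnorm (D (F x f))).
generalize (hnorm (commutator (F x) (rho (lin_tr l)) f)) (hnorm (F x (D f) - D (F x f))).
by move=> r1 r2 r3 r4; clear; move: (hnorm f) => r5; nra.
Qed.

Lemma commutator_compact x a : Cr a -> compact_op (commutator (F x) (rho a)).
Proof.
move=> Ca; apply: (vanish_compact genS R0 (x := x)); first exact: (commutator_bounded x Ca).1.
exact: commutator_vanish.
Qed.

(** ** The grading *)

Lemma csum_zero (I : choiceType) (f : I -> C) : (forall i, f i = 0) -> csum f = 0.
Proof.
move=> f0; have -> : f = (fun=> 0) by apply/funext.
by rewrite /csum /rsum /= oppr0 subrr.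
Qed.

Lemma support_subspace (P : {fset G} -> Prop) :
  Defs.subspace [set f : H | forall A, rips_val f A != 0 -> P A].
Proof.
split=> [A|c f f' hf hf' A]; first by rewrite /= eqxx.
rewrite rips_valE; have [f0|/hf //] := eqVneq (rips_val f A) 0.
by rewrite f0 mulr0 add0r; exact: hf'.
Qed.

Lemma rips_grading : is_grading (H_even S R) (H_odd S R).
Proof.
split; [exact: support_subspace|exact: support_subspace| |].
- move=> u v hu hv; apply: csum_zero => A.
  have [->|/hu uA] := eqVneq (rips_val u A) 0; first by rewrite mul0r.
  have [->|/hv vA] := eqVneq (rips_val v A) 0; first by rewrite conjC0 mulr0.
  by rewrite vA in uA.
move=> v; pose ev A := if odd #|` A|.-1 then 0 else rips_val v A.
have sev : sqsum ev.
  apply: sqsum_le (ell2P (rips_val v)) => A; rewrite /ev; case: ifP => // _.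
  by rewrite csq0 csq_ge0.
pose u : H := rmk S R (to_ell2 ev).
have uE A : rips_val u A = ev A.
  rewrite /u rmkE ?to_ell2E // => B nB.
  by rewrite /ev rips_off // if_same.
exists u, (v - u); split; last by rewrite addrC subrK.
- by move=> A; rewrite uE /ev; case: odd => //; rewrite eqxx.
- by move=> A; rewrite rips_valB uE /ev; case: odd => //; rewrite subrr eqxx.
Qed.

Lemma summable x (p : K) :
  20 * delta%:R * ln (1 + #|` S|%:R) * (1 + #|` S|%:R) ^+ (2 * delta) < p ->
  p_summable (group_ring K G) rho (F x) p.
Proof.
move=> /(decay_rate (delta_gt0 hyp))[q [lam [[q1 p0] /andP[l0 l1] hl qlp hq]]].
have bF := Fop_bounded hyp hw hphi1 hR x.
have sch (T : H -> H) : bounded_op T -> decays x lam T -> schatten p T.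
  by move=> bT dT; exact: (decays_schatten genS R0 bT dT q1 l0 l1 p0 qlp hq).
split.
- apply: sch (square_decays _ _).
  exact: (bounded_opB hH (bounded_op_comp bF bF) (bounded_op_id _)).
- apply: sch (adjoint_decays _ _).
  by rewrite (adjointE hH (Fop_selfadjoint hyp hw hphi1 hR x)); exact: (bounded_opB hH bF bF).
move=> a ra; have [l al] := group_ringP ra; rewrite al.
apply: sch (commutator_lin_tr_decays l0 l1 hl x l).
by apply: commutator_bounded; exact: lin_tr_Cr.
Qed.

Lemma fredholm x :
  even_fredholm_module Cr (H_even S R) (H_odd S R) rho (F x).
Proof.
have [p hp] : exists p : K,
    20 * delta%:R * ln (1 + #|` S|%:R) * (1 + #|` S|%:R) ^+ (2 * delta) < p.
  by eexists; exact: ltr_pwDr (ltr01) (lexx _).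
have [[_ cs _] [_ ca _] _] := summable x hp.
apply: EvenFredholmModule.
- exact: Cr_cstar.
- exact: hH.
- exact: rips_grading.
- exact: (rho_representation genS R0).
- exact: (rho_nondegenerate genS R0).
- by move=> a; exact: (rho_even genS R0).
- exact: (Fop_bounded hyp hw hphi1 hR).
- exact: (Fop_odd hyp hw hphi1 hR).
- exact: cs.
- exact: ca.
- by move=> a; exact: commutator_compact.
Qed.

End FredholmModule.

Theorem theorem4p8 (K : realType) (G : groupType) (S : {fset G}) (delta : nat)
    (hyp : hyperbolic_group K S delta)
    (w : G -> seq G) (hw : minimal_words S w)
    (C1 : K) (phi1 : G -> G -> {fsfun G -> rat with 0})
    (hphi1 : mineyev_map S delta w C1 phi1)
    (R : K) (hR : 48 * delta%:R <= R) (x : G) :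
  exists F : H_R S R -> H_R S R,
    [/\ is_F phi1 x F,
        bounded_op F, odd_op (H_even S R) (H_odd S R) F & selfadjoint F] /\
    exists rho : (ell2_space K G -> ell2_space K G) -> H_R S R -> H_R S R,
      [/\ extends_translation rho,
          even_fredholm_module (Cr K G) (H_even S R) (H_odd S R) rho F,
          finitely_summable (group_ring K G) rho F &
          forall p : K,
            20 * delta%:R * ln (1 + #|` S|%:R) * (1 + #|` S|%:R) ^+ (2 * delta)
              < p ->
            p_summable (group_ring K G) rho F p].
Proof.
exists (Fop phi1 x); split.
  split; [exact: (Fop_isF hyp hw hphi1 hR)|exact: (Fop_bounded hyp hw hphi1 hR)| |].
    exact: (Fop_odd hyp hw hphi1 hR).
  exact: (Fop_selfadjoint hyp hw hphi1 hR).
exists (@rho K G S R); split.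
- exact: (rho_extends (genS hyp) (R_ge0 hR)).
- exact: (fredholm hyp hw hphi1 hR).
- by eexists; move=> p; exact: (summable hyp hw hphi1 hR).
- by move=> p; exact: (summable hyp hw hphi1 hR).
Qed.
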